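(* For every $p\in\mathbb{R}^d\setminus\{0\}$, $$\lim_{\substack{q\to p\\ \Lambda_p\subseteq\Lambda_q}}H(q)=H(p)\qquad\text{and}\qquad \liminf_{\substack{q\to p\\ \Lambda_p\not\subseteq\Lambda_q}}H(q)>H(p)$$ (the latter being vacuous when no such $q$ accumulate at $p$, e.g. when $\Lambda_p=\{0\}$). Moreover, for $\mathcal H^{d-1}$-almost every unit vector $p\in\mathbb{R}^d$, $H(p)^2=2d\exp(\hat S(0))$.
   Context: Discrete Laplacian on $\mathbb{Z}^d$: $\Delta u(x)=\sum_{i=1}^d(u(x+e_i)+u(x-e_i)-2u(x))$. For $p\ne0$, $H(p)=\Delta u_p(0)$ where $u_p:\mathbb{Z}^d\to\mathbb{R}$ is the unique solution of $\Delta u=0$ on $\{p\cdot x>0\}$, $u=0$ on $\{p\cdot x\le0\}$, $\sup_{p\cdot x>0}|u(x)-p\cdot x|<\infty$. $\Lambda_p=\{q\in\mathbb{Z}^d:p\cdot q=0\}$. $S(\theta)=\log(1-\frac1d\sum_{j=1}^d\cos\theta_j)$ is $2\pi\mathbb{Z}^d$-periodic and $\hat S(q)=(2\pi)^{-d}\int_{[-\pi,\pi]^d}S(\theta)e^{-iq\cdot\theta}d\theta$. *)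

(* Defs.v *)
From Stdlib Require Import Reals Lra ZArith List ClassicalEpsilon.
Import ListNotations.
Open Scope R_scope.

(* Points of R^d and Z^d are functions nat -> R / nat -> Z; only the
   coordinates 0..d-1 matter (all quantities below only read them). *)
Definition vecR := nat -> R.
Definition vecZ := nat -> Z.

Fixpoint rsum (n : nat) (f : nat -> R) : R :=
  match n with O => 0 | S m => rsum m f + f m end.

Definition dotRZ (d : nat) (p : vecR) (x : vecZ) : R :=
  rsum d (fun i => p i * IZR (x i)).

(* x is a point of Z^d (coordinates >= d vanish) *)
Definition supported (d : nat) (x : vecZ) : Prop :=
  forall i, (d <= i)%nat -> x i = 0%Z.

Definition shift (x : vecZ) (i : nat) (s : Z) : vecZ :=
  fun j => if Nat.eqb j i then (x j + s)%Z else x j.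

Definition lap (d : nat) (u : vecZ -> R) (x : vecZ) : R :=
  rsum d (fun i => u (shift x i 1%Z) + u (shift x i (-1)%Z) - 2 * u x).

Definition zeroZ : vecZ := fun _ => 0%Z.

Definition is_up (d : nat) (p : vecR) (u : vecZ -> R) : Prop :=
  (forall x, supported d x -> dotRZ d p x > 0 -> lap d u x = 0) /\
  (forall x, supported d x -> dotRZ d p x <= 0 -> u x = 0) /\
  (exists M, forall x, supported d x -> dotRZ d p x > 0 ->
      Rabs (u x - dotRZ d p x) <= M).

(* H(p) = Delta u_p (0), u_p the (unique) solution *)
Definition H (d : nat) (p : vecR) : R :=
  epsilon (inhabits 0) (fun h => exists u, is_up d p u /\ lap d u zeroZ = h).

Definition Lam (d : nat) (p : vecR) (x : vecZ) : Prop :=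
  supported d x /\ dotRZ d p x = 0.
Definition Lam_sub (d : nat) (p q : vecR) : Prop :=
  forall x, Lam d p x -> Lam d q x.

Definition nonzeroR (d : nat) (p : vecR) : Prop :=
  exists i, (i < d)%nat /\ p i <> 0.

Definition distR (d : nat) (p q : vecR) : R :=
  sqrt (rsum d (fun i => (p i - q i) ^ 2)).

Definition Sfun (d : nat) (th : vecR) : R :=
  ln (1 - / INR d * rsum d (fun j => cos (th j))).

(* max(S, -n), written so that it is correct also where S = -infinity *)
Definition Strunc (d : nat) (n : R) (th : vecR) : R :=
  let a := 1 - / INR d * rsum d (fun j => cos (th j)) in
  if Rlt_dec (exp (- n)) a then Sfun d th else - n.

Fixpoint grid (d N : nat) : list (nat -> nat) :=
  match d with
  | O => [fun _ => O]
  | S m => flat_map (fun k => map (fun j => fun i => if Nat.eqb i m then j else k i)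
                                  (seq 0 N)) (grid m N)
  end.

Definition lsum (l : list R) : R := fold_right Rplus 0 l.

(* midpoints of the uniform grid of [-pi,pi]^d with N^d cells *)
Definition theta (N : nat) (k : nat -> nat) : vecR :=
  fun i => - PI + (2 * INR (k i) + 1) * PI / INR N.

(* midpoint Riemann sum for the average (2 pi)^{-d} int_{[-pi,pi]^d} f *)
Definition riem (d N : nat) (f : vecR -> R) : R :=
  / (INR N ^ d) * lsum (map (fun k => f (theta N k)) (grid d N)).

(* (2 pi)^{-d} int max(S,-n): Riemann integral of a continuous function *)
Definition trunc_avg (d : nat) (n : R) : R :=
  epsilon (inhabits 0) (fun l => Un_cv (fun N => riem d (S N) (Strunc d n)) l).

(* \hat S(0) = (2 pi)^{-d} int S, via monotone convergence n -> infinity *)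
Definition Shat0 (d : nat) : R :=
  epsilon (inhabits 0) (fun l => Un_cv (fun n => trunc_avg d (INR n)) l).

(* weight of an open ball of radius r for s-dim Hausdorff content
   (empty ball, r = 0, has weight 0) *)
Definition ball_w (s : nat) (r : R) : R :=
  if Req_EM_T r 0 then 0 else (2 * r) ^ s.

Definition Hnull (d s : nat) (N : vecR -> Prop) : Prop :=
  forall eps, eps > 0 ->
    exists (c : nat -> vecR) (r : nat -> R),
      (forall n, 0 <= r n) /\
      (forall x, N x -> exists n, distR d x (c n) < r n) /\
      (forall M, rsum M (fun n => ball_w s (r n)) <= eps).

(* Main.v *)
(** Project simple random walk to [Y = p.X] and let [T >= 1] be the first time with [Y_T <= 0].
    The martingale [Y] gives [u_p(x) = p.x - E_x[Y_T]] for [p.x > 0], hence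
    [H(p) = 2d E|Y_T|]; uniqueness of [u_p] is a maximum principle on strips.
    Let [Q(s)] be the generating function of the laws of [Y_n] on [n < T] and [V(s)] that of the
    law of [Y_T] (time marked by [s]).  Then [Q (1 - s mu) = 1 - V], and by the symmetry of [mu]
    the reflected objects satisfy the same equation, so [Q (1 - V') = Q' (1 - V)].  The left
    side lives on [x >= 0] and the right side on [x <= 0]; both are therefore the scalar
    [c(s) = 1 - V(s){0}], and [(1 - V)(1 - V') = c(s) (1 - s mu)].  Taking masses, second
    moments and logarithmic derivatives of this identity and letting [s -> 1] gives
      [H(p)^2 = 2d |p|^2 exp(- A(p))],  [A(p) = sum_(n >= 1) P(p.X_n = 0) / n],
    and the mass identity bounds the tails of [A(p)] by [4d / sqrt(N + 1)] uniformly in [p].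
    For [q] near [p] the finitely many relevant probabilities satisfy
    [P(q.X_n = 0) <= P(p.X_n = 0)], with equality if [Lam p] is contained in [Lam q] and a
    definite loss otherwise (test on a finite spanning subset of [Lam p]).  If
    [Lam p = {0}] then [A(p) = sum_n P(X_n = 0) / n], which is [- Shat0]; the remaining unit
    vectors lie on countably many great subspheres. *)

From Coquelicot Require Import Coquelicot.
From Stdlib Require Import Reals Lra Lia ZArith List ClassicalEpsilon FunctionalExtensionality Psatz Cantor.
Require Import Defs.
Import ListNotations.
Open Scope R_scope.

(** No probability space is built. The law of the walk at a fixed time is a finite weighted sum of
    point evaluations, kept as a linear functional, and products of generating functions are
    convolutions of such functionals in space-time, compared only on test functions that vanish
    after time [N]. The factorization is therefore finite algebra; analysis enters only for scalar
    power series on [[0, 1)]. All estimates come from the mass identity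
    [(1 - E s^T)^2 = (1 - s) c(s)] with [c <= 1], i.e. [1 - E s^T <= sqrt (1 - s)]. It shows that
    [T] is almost surely finite and, as the first step is negative with probability at least [1/2d],
    it gives constants depending on [d] alone. This uniformity matters because [A(q)] depends on the
    arithmetic of [q]: it lets finitely many times decide what happens near [p]. [Shat0] is a limit
    of Riemann sums of truncations. These are functions of the mean cosine [phi] only, so by
    polynomial approximation it suffices to average the powers of [phi], for which the midpoint rule
    is eventually exact. *)

(** * Finite sums *)

Lemma rsum_ext (n : nat) (f g : nat -> R) :
  (forall i, (i < n)%nat -> f i = g i) -> rsum n f = rsum n g.
Proof.
  induction n as [|n IH]; intros E; simpl; [reflexivity|].
  rewrite IH, E; auto.
Qed.

Lemma rsum_plus (n : nat) (f g : nat -> R) :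
  rsum n (fun i => f i + g i) = rsum n f + rsum n g.
Proof. induction n as [|n IH]; simpl; [lra|rewrite IH; lra]. Qed.

Lemma rsum_scal (n : nat) (c : R) (f : nat -> R) :
  rsum n (fun i => c * f i) = c * rsum n f.
Proof. induction n as [|n IH]; simpl; [lra|rewrite IH; lra]. Qed.

Lemma rsum_minus (n : nat) (f g : nat -> R) :
  rsum n (fun i => f i - g i) = rsum n f - rsum n g.
Proof. induction n as [|n IH]; simpl; [lra|rewrite IH; lra]. Qed.

Lemma rsum_const (n : nat) (c : R) : rsum n (fun _ => c) = INR n * c.
Proof. induction n as [|n IH]; [simpl; lra|]. rewrite S_INR. simpl. rewrite IH; lra. Qed.

Lemma rsum_le (n : nat) (f g : nat -> R) :
  (forall i, (i < n)%nat -> f i <= g i) -> rsum n f <= rsum n g.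
Proof.
  induction n as [|n IH]; intros E; simpl; [lra|].
  apply Rplus_le_compat; auto.
Qed.

Lemma rsum_nonneg (n : nat) (f : nat -> R) :
  (forall i, (i < n)%nat -> 0 <= f i) -> 0 <= rsum n f.
Proof.
  intros E. replace 0 with (rsum n (fun _ => 0)) by (rewrite rsum_const; ring).
  apply rsum_le; auto.
Qed.

Lemma rsum_zero (n : nat) (f : nat -> R) :
  (forall i, (i < n)%nat -> f i = 0) -> rsum n f = 0.
Proof. intros E. rewrite (rsum_ext n f (fun _ => 0)); auto. rewrite rsum_const; ring. Qed.

Lemma rsum_term_le (n : nat) (f : nat -> R) (i : nat) :
  (i < n)%nat -> (forall j, (j < n)%nat -> 0 <= f j) -> f i <= rsum n f.
Proof.
  induction n as [|n IH]; intros Hi P; [lia|]. simpl.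
  assert (P0 : 0 <= rsum n f) by (apply rsum_nonneg; auto).
  destruct (Nat.eq_dec i n) as [->|Hn]; [lra|].
  assert (f i <= rsum n f) by (apply IH; auto; lia).
  assert (0 <= f n) by auto. lra.
Qed.

Lemma rsum_single (n k : nat) (f : nat -> R) :
  (k < n)%nat -> (forall i, (i < n)%nat -> i <> k -> f i = 0) -> rsum n f = f k.
Proof.
  induction n as [|n IH]; intros Hk E; [lia|]. simpl.
  destruct (Nat.eq_dec k n) as [->|Hn].
  - rewrite rsum_zero; [lra|]. intros i Hi. apply E; lia.
  - rewrite IH; [|lia|]. rewrite (E n); [lra|lia|lia]. intros i Hi. apply E; lia.
Qed.

Lemma rsum_swap (n m : nat) (f : nat -> nat -> R) :
  rsum n (fun i => rsum m (fun j => f i j)) = rsum m (fun j => rsum n (fun i => f i j)).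
Proof.
  induction n as [|n IH]; simpl.
  - rewrite rsum_zero; auto.
  - rewrite IH, rsum_plus. reflexivity.
Qed.

Lemma rsum_S_l (n : nat) (f : nat -> R) : rsum (S n) f = f O + rsum n (fun i => f (S i)).
Proof. induction n as [|n IH]; [simpl; lra|]. cbn [rsum]. cbn [rsum] in IH. rewrite IH; lra. Qed.

Lemma Rabs_rsum_le (n : nat) (f : nat -> R) : Rabs (rsum n f) <= rsum n (fun i => Rabs (f i)).
Proof.
  induction n as [|n IH]; simpl; [rewrite Rabs_R0; lra|].
  eapply Rle_trans; [apply Rabs_triang|]. lra.
Qed.

(** * Finitely supported signed measures, as functionals *)

(** A measure is identified with its integral: images, restrictions and convolutions become
    substitutions, and the list of atoms is needed only to know that linearity and Fubini hold. *)
Definition fin {X : Type} (A : (X -> R) -> R) : Prop :=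
  exists l : list (R * X), forall f, A f = lsum (map (fun wx => fst wx * f (snd wx)) l).

Definition posf {X : Type} (A : (X -> R) -> R) : Prop :=
  forall f, (forall x, 0 <= f x) -> 0 <= A f.

(** Says that [A] is carried by [D] without naming its atoms. *)
Definition on {X : Type} (D : X -> Prop) (A : (X -> R) -> R) : Prop :=
  forall f g, (forall x, D x -> f x = g x) -> A f = A g.

Section Fin.
Context {X Y : Type}.
Implicit Types (A : (X -> R) -> R) (B : (Y -> R) -> R).

Lemma fin_ext A f g : fin A -> (forall x, f x = g x) -> A f = A g.
Proof.
  intros [l Hl] E. rewrite !Hl. f_equal. apply map_ext. intros; rewrite E; auto.
Qed.

Lemma fin_plus A f g : fin A -> A (fun x => f x + g x) = A f + A g.
Proof.
  intros [l Hl]. rewrite !Hl. clear Hl. unfold lsum.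
  induction l as [|a l IH]; simpl; [lra|]. rewrite IH; lra.
Qed.

Lemma fin_scal A c f : fin A -> A (fun x => c * f x) = c * A f.
Proof.
  intros [l Hl]. rewrite !Hl. clear Hl. unfold lsum.
  induction l as [|a l IH]; simpl; [lra|]. rewrite IH; lra.
Qed.

Lemma fin_minus A f g : fin A -> A (fun x => f x - g x) = A f - A g.
Proof.
  intros F. rewrite (fin_ext A _ (fun x => f x + (-1) * g x)); auto; [|intros; lra].
  rewrite fin_plus, fin_scal; auto; lra.
Qed.

Lemma fin_zero A f : fin A -> (forall x, f x = 0) -> A f = 0.
Proof.
  intros F E. rewrite (fin_ext A f (fun x => 0 * 0)); auto; [|intros; rewrite E; lra].
  rewrite (fin_scal A 0 (fun _ => 0)); auto; lra.
Qed.

Lemma fin_rsum A n (f : nat -> X -> R) :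
  fin A -> A (fun x => rsum n (fun i => f i x)) = rsum n (fun i => A (f i)).
Proof.
  intros F. induction n as [|n IH]; simpl; [apply fin_zero; auto|].
  rewrite (fin_plus A (fun x => rsum n (fun i => f i x)) (f n)), IH; auto.
Qed.

End Fin.

Section Fin2.
Context {X Y : Type}.
Implicit Types (A : (X -> R) -> R) (B : (Y -> R) -> R).

Lemma fin_swap A B (F : X -> Y -> R) :
  fin A -> fin B -> A (fun x => B (fun y => F x y)) = B (fun y => A (fun x => F x y)).
Proof.
  intros [l Hl] FB. rewrite Hl.
  rewrite (fin_ext B _ (fun y => lsum (map (fun wx => fst wx * F (snd wx) y) l))); auto.
  clear Hl. unfold lsum. induction l as [|a l IH]; simpl.
  - rewrite fin_zero; auto.
  - rewrite (fin_plus B (fun y => fst a * F (snd a) y)), fin_scal, IH; auto.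
Qed.

Lemma fin_pt (x : X) : fin (fun f => f x).
Proof. exists [(1, x)]. intros; simpl; lra. Qed.

Lemma fin_funct A A' : (forall f, A' f = A f) -> fin A -> fin A'.
Proof. intros E [l Hl]. exists l. intros; rewrite E; auto. Qed.

Lemma fin_add A A' : fin A -> fin A' -> fin (fun f => A f + A' f).
Proof.
  intros [l Hl] [l' Hl']. exists (l ++ l'). intros f. rewrite Hl, Hl', map_app.
  unfold lsum. clear. induction l as [|a l IH]; simpl; [lra|rewrite <- IH; lra].
Qed.

Lemma fin_mult A c : fin A -> fin (fun f => c * A f).
Proof.
  intros [l Hl]. exists (map (fun wx => (c * fst wx, snd wx)) l). intros f. rewrite Hl.
  unfold lsum. clear. induction l as [|a l IH]; simpl; [lra|rewrite <- IH; lra].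
Qed.

Lemma fin_null : fin (fun _ : X -> R => 0).
Proof. exists nil. reflexivity. Qed.

Lemma fin_sum n (A : nat -> (X -> R) -> R) :
  (forall i, fin (A i)) -> fin (fun f => rsum n (fun i => A i f)).
Proof.
  intros F. induction n as [|n IH]; simpl; [apply fin_null|]. apply fin_add; auto.
Qed.

Lemma fin_weight A (h : X -> R) : fin A -> fin (fun f => A (fun x => h x * f x)).
Proof.
  intros [l Hl]. exists (map (fun wx => (fst wx * h (snd wx), snd wx)) l). intros f.
  rewrite Hl. unfold lsum. clear. induction l as [|a l IH]; simpl; [lra|rewrite IH; lra].
Qed.

Lemma pos_le A f g : fin A -> posf A -> (forall x, f x <= g x) -> A f <= A g.
Proof.
  intros F P E. assert (P0 : 0 <= A (fun x => g x - f x)) by (apply P; intros; specialize (E x); lra).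
  rewrite fin_minus in P0; auto; lra.
Qed.

Lemma on_zero (D : X -> Prop) A f : fin A -> on D A -> (forall x, D x -> f x = 0) -> A f = 0.
Proof.
  intros F O E. rewrite (O f (fun _ => 0)); auto. apply fin_zero; auto.
Qed.

End Fin2.

Lemma fin_map {X Y : Type} (A : (X -> R) -> R) (t : X -> Y) :
  fin A -> fin (fun f : Y -> R => A (fun x => f (t x))).
Proof.
  intros [l Hl]. exists (map (fun wx => (fst wx, t (snd wx))) l). intros f.
  rewrite Hl. unfold lsum. clear. induction l as [|a l IH]; simpl; [lra|rewrite IH; lra].
Qed.

Lemma fin_bind {X Y : Type} (A : (X -> R) -> R) (B : X -> (Y -> R) -> R) :
  fin A -> (forall x, fin (B x)) -> fin (fun f => A (fun x => B x f)).
Proof.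
  intros [l Hl] FB.
  assert (G : fin (fun f => lsum (map (fun wx => fst wx * B (snd wx) f) l))).
  { clear Hl. induction l as [|a l IH]; simpl; [apply fin_null|].
    apply fin_add; auto. apply fin_mult; auto. }
  revert G. apply fin_funct. intros f. apply Hl.
Qed.

(** * Convolution of space-time functionals *)

Definition zadd (z w : nat * R) : nat * R := ((fst z + fst w)%nat, snd z + snd w).
Definition zneg (z : nat * R) : nat * R := (fst z, - snd z).
Definition func := ((nat * R) -> R) -> R.
Definition conv (A B : func) : func := fun F => A (fun z => B (fun w => F (zadd z w))).
Definition refl_f (A : func) : func := fun F => A (fun z => F (zneg z)).
(** The derivation [s d/ds], since time is the exponent of [s]. *)
Definition dert (A : func) : func := fun F => A (fun z => INR (fst z) * F z).
Definition dlt : func := fun F => F (O, 0).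
Definition tst (N : nat) (F : nat * R -> R) : Prop := forall z, (N < fst z)%nat -> F z = 0.
(** Equality of generating functions modulo [s^(N+1)]. *)
Definition eqN (N : nat) (A B : func) : Prop := forall F, tst N F -> A F = B F.

(* Truncations at time [N] of the generating functions [sum_n s^n A_n]; the exponent of
   [s] is the time coordinate of the test function. *)
Definition gen (A : nat -> (R -> R) -> R) (N : nat) : func :=
  fun F => rsum (S N) (fun n => A n (fun x => F (n, x))).
(** [A (zer F)] integrates [F] over the part of [A] carried by the line [x = 0]. *)
Definition zer (F : nat * R -> R) : nat * R -> R :=
  fun z => if Req_EM_T (snd z) 0 then F z else 0.
Lemma zadd_comm z w : zadd z w = zadd w z.
Proof. unfold zadd. f_equal; [lia|lra]. Qed.
Lemma zadd_assoc z w v : zadd z (zadd w v) = zadd (zadd z w) v.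
Proof. unfold zadd; simpl. f_equal; [lia|lra]. Qed.
Lemma zadd_0_l z : zadd (O, 0) z = z.
Proof. destruct z; unfold zadd; simpl; f_equal; lra. Qed.
Lemma zadd_neg z w : zadd (zneg z) (zneg w) = zneg (zadd z w).
Proof. unfold zadd, zneg; simpl. f_equal; lra. Qed.

Lemma conv_comm A B : fin A -> fin B -> conv A B = conv B A.
Proof.
  intros FA FB. apply functional_extensionality. intros F. unfold conv.
  rewrite fin_swap; auto. apply fin_ext; auto. intros z. apply fin_ext; auto. intros w.
  rewrite zadd_comm; auto.
Qed.

Lemma conv_assoc A B C : conv A (conv B C) = conv (conv A B) C.
Proof.
  apply functional_extensionality. intros F. unfold conv.
  f_equal. apply functional_extensionality; intros z.
  f_equal. apply functional_extensionality; intros w.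
  f_equal. apply functional_extensionality; intros v. rewrite zadd_assoc; auto.
Qed.

Lemma conv_dlt_r A : conv A dlt = A.
Proof.
  apply functional_extensionality. intros F. unfold conv, dlt. f_equal.
  apply functional_extensionality; intros z. rewrite zadd_comm, zadd_0_l; auto.
Qed.

Lemma refl_conv A B : refl_f (conv A B) = conv (refl_f A) (refl_f B).
Proof.
  apply functional_extensionality. intros F. unfold conv, refl_f.
  f_equal. apply functional_extensionality; intros z.
  f_equal. apply functional_extensionality; intros w. rewrite zadd_neg; auto.
Qed.

Lemma fin_conv A B : fin A -> fin B -> fin (conv A B).
Proof.
  intros FA FB. unfold conv.
  apply (fin_bind A (fun z F => B (fun w => F (zadd z w))) FA). intros z.
  apply (fin_map B (fun w => zadd z w)). auto.
Qed.
Lemma fin_refl A : fin A -> fin (refl_f A).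
Proof. apply (fin_map A zneg). Qed.
Lemma fin_dert A : fin A -> fin (dert A).
Proof. apply (fin_weight A (fun z => INR (fst z))). Qed.

Lemma tst_shift N F z : tst N F -> tst N (fun w => F (zadd z w)).
Proof. intros T w Hw. apply T. simpl. lia. Qed.

(** Times are nonnegative and add up, so translating a test function keeps it in [tst N]: truncation
    is compatible with products. *)
Lemma eqN_conv N A A' B B' : fin A -> fin B' -> eqN N A A' -> eqN N B B' ->
  eqN N (conv A B) (conv A' B').
Proof.
  intros FA FB' EA EB F T. unfold conv.
  rewrite (fin_ext A _ (fun z => B' (fun w => F (zadd z w)))); auto.
  - apply EA. intros z Hz. apply fin_zero; auto. intros w. apply T. simpl. lia.
  - intros z. apply EB. apply tst_shift; auto.
Qed.

Lemma eqN_trans N A B C : eqN N A B -> eqN N B C -> eqN N A C.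
Proof. intros H1 H2 F T. rewrite H1, H2; auto. Qed.
Lemma eqN_sym N A B : eqN N A B -> eqN N B A.
Proof. intros H1 F T. rewrite H1; auto. Qed.
Lemma eqN_refl N A : eqN N A A.
Proof. intros F T; auto. Qed.
Lemma eqN_dert N A B : eqN N A B -> eqN N (dert A) (dert B).
Proof. intros E F T. apply E. intros z Hz. rewrite T; auto. lra. Qed.
Lemma eqN_reflf N A B : eqN N A B -> eqN N (refl_f A) (refl_f B).
Proof. intros E F T. apply E. intros z Hz. apply T; auto. Qed.

Lemma dert_conv A B F : fin A -> fin B ->
  dert (conv A B) F = conv (dert A) B F + conv A (dert B) F.
Proof.
  intros FA FB. unfold dert, conv. rewrite <- fin_plus; auto. apply fin_ext; auto. intros z.
  rewrite <- fin_scal, <- fin_plus; auto. apply fin_ext; auto. intros w.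
  simpl. rewrite plus_INR. ring.
Qed.

Lemma fin_gen A N : (forall n, fin (A n)) -> fin (gen A N).
Proof.
  intros F. unfold gen. apply (fin_sum (S N) (fun n F => A n (fun x => F (n, x)))).
  intros n. apply (fin_map (A n) (fun x => (n, x))). auto.
Qed.
Lemma fin_sub {X} (A B : (X -> R) -> R) : fin A -> fin B -> fin (fun F => A F - B F).
Proof.
  intros FA FB. apply (fin_funct (fun F => A F + (-1) * B F)); [intros; lra|].
  apply fin_add; auto. apply fin_mult; auto.
Qed.
(** * Ladder functionals of the projected walk *)

Definition mu (d : nat) (p : vecR) (f : R -> R) : R :=
  / (2 * INR d) * rsum d (fun i => f (p i) + f (- p i)).

Section Walk.
Context (d : nat) (p : vecR) (Hd : (1 <= d)%nat).

(** The transition operator; it splits as [Bop + Nop] according to whether the step lands in the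
    open half-line or leaves it. *)
Definition Pop (f : R -> R) (x : R) : R := mu d p (fun y => f (x + y)).
Definition Bop (f : R -> R) (x : R) : R :=
  mu d p (fun y => if Rlt_dec 0 (x + y) then f (x + y) else 0).
Definition Nop (f : R -> R) (x : R) : R :=
  mu d p (fun y => if Rlt_dec 0 (x + y) then 0 else f (x + y)).

(* For the walk [Y] from [0] and [T] the first [n >= 1] with [Y_n <= 0], these are
   [E f(Y_n)], [E (f(Y_n); n < T)] and [E (f(Y_n); n = T)]. *)
Fixpoint walk (n : nat) (f : R -> R) : R :=
  match n with O => f 0 | S n => walk n (Pop f) end.
Fixpoint stay (n : nat) (f : R -> R) : R :=
  match n with O => f 0 | S n => stay n (Bop f) end.
Definition ladder (n : nat) (f : R -> R) : R :=
  match n with O => 0 | S n => stay n (Nop f) end.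

Lemma INR_d_pos : 0 < INR d.
Proof. apply lt_0_INR; lia. Qed.

Lemma fin_mu : fin (mu d p).
Proof.
  unfold mu. apply fin_mult. apply (fin_sum d (fun i f => f (p i) + f (- p i))).
  intros i. apply fin_add; apply fin_pt.
Qed.

Lemma pos_mu : posf (mu d p).
Proof.
  intros f Hf. unfold mu. apply Rmult_le_pos.
  - left. apply Rinv_0_lt_compat. generalize INR_d_pos; lra.
  - apply rsum_nonneg. intros. apply Rplus_le_le_0_compat; auto.
Qed.

Lemma mu_const (c : R) : mu d p (fun _ => c) = c.
Proof. unfold mu. rewrite rsum_const. field. generalize INR_d_pos; lra. Qed.

Lemma mu_opp (f : R -> R) : mu d p (fun y => f (- y)) = mu d p f.
Proof.
  unfold mu. f_equal. apply rsum_ext. intros. rewrite Ropp_involutive. lra.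
Qed.

Lemma mu_id : mu d p (fun y => y) = 0.
Proof. unfold mu. rewrite rsum_zero; [lra|]. intros; lra. Qed.

Lemma mu_sqr : mu d p (fun y => y ^ 2) = rsum d (fun i => p i ^ 2) / INR d.
Proof.
  unfold mu. rewrite (rsum_ext _ _ (fun i => 2 * p i ^ 2)) by (intros; ring).
  rewrite rsum_scal. field. generalize INR_d_pos; lra.
Qed.

Definition step_bound : R := rsum d (fun i => Rabs (p i)).

Lemma step_bound_nonneg : 0 <= step_bound.
Proof. apply rsum_nonneg. intros; apply Rabs_pos. Qed.

Lemma step_le (i : nat) : (i < d)%nat -> Rabs (p i) <= step_bound.
Proof.
  intros Hi. apply (rsum_term_le d (fun i => Rabs (p i))); auto. intros; apply Rabs_pos.
Qed.

Lemma on_mu : on (fun y => Rabs y <= step_bound) (mu d p).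
Proof.
  intros f g E. unfold mu. f_equal. apply rsum_ext. intros i Hi.
  rewrite !E; auto; [rewrite Rabs_Ropp|]; apply step_le; auto.
Qed.

Lemma fin_if (D : R -> Prop) (dec : forall x, {D x} + {~ D x}) (x : R) :
  fin (fun f : R -> R => mu d p (fun y => if dec (x + y) then f (x + y) else 0)).
Proof.
  apply (fin_bind (mu d p) (fun y f => if dec (x + y) then f (x + y) else 0) fin_mu).
  intros y. destruct (dec (x + y)); [apply fin_pt|apply fin_null].
Qed.

Lemma fin_Bop x : fin (fun f => Bop f x).
Proof. apply (fin_if (fun z => 0 < z) (fun z => Rlt_dec 0 z)). Qed.

Lemma fin_Nop x : fin (fun f => Nop f x).
Proof.
  apply (fin_bind (mu d p) (fun y f => if Rlt_dec 0 (x + y) then 0 else f (x + y)) fin_mu).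
  intros y. destruct (Rlt_dec 0 (x + y)); [apply fin_null|apply fin_pt].
Qed.

Lemma fin_Pop x : fin (fun f => Pop f x).
Proof. apply (fin_map (mu d p) (fun y => x + y)). apply fin_mu. Qed.

Lemma fin_walk n : fin (walk n).
Proof.
  induction n as [|n IH]; [apply fin_pt|]. simpl.
  apply (fin_bind _ (fun x f => Pop f x) IH). apply fin_Pop.
Qed.

Lemma fin_stay n : fin (stay n).
Proof.
  induction n as [|n IH]; [apply fin_pt|]. simpl.
  apply (fin_bind _ (fun x f => Bop f x) IH). apply fin_Bop.
Qed.

Lemma fin_ladder n : fin (ladder n).
Proof.
  destruct n as [|n]; [apply fin_null|]. simpl.
  apply (fin_bind _ (fun x f => Nop f x) (fin_stay n)). apply fin_Nop.
Qed.

Lemma pos_walk n : posf (walk n).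
Proof.
  induction n as [|n IH]; intros f Hf; simpl; auto. apply IH. intros x. apply pos_mu. auto.
Qed.

Lemma Bop_nonneg f x : (forall y, 0 < y -> 0 <= f y) -> 0 <= Bop f x.
Proof. intros Hf. apply pos_mu. intros y. destruct (Rlt_dec 0 (x + y)); auto; lra. Qed.

Lemma pos_stay n : posf (stay n).
Proof.
  induction n as [|n IH]; intros f Hf; simpl; auto. apply IH. intros x. apply Bop_nonneg. auto.
Qed.

Lemma pos_ladder n : posf (ladder n).
Proof.
  intros f Hf. destruct n as [|n]; simpl; [lra|]. apply pos_stay. intros x.
  apply pos_mu. intros y. destruct (Rlt_dec 0 (x + y)); auto; lra.
Qed.

(** The successor matters: [stay 0] is the point mass at [0], outside the open half-line. *)
Lemma on_stay_S n : on (fun x => 0 < x) (stay (S n)).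
Proof.
  intros f g E. simpl. apply fin_ext; [apply fin_stay|]. intros x. unfold Bop.
  apply fin_ext; [apply fin_mu|]. intros y. destruct (Rlt_dec 0 (x + y)); auto.
Qed.

(* The overshoot below [0] is at most one step. *)
Lemma on_ladder n : on (fun x => - step_bound <= x <= 0) (ladder n).
Proof.
  intros f g E. destruct n as [|n]; [reflexivity|].
  assert (K : forall x, 0 <= x -> Nop f x = Nop g x).
  { intros x Hx. unfold Nop. apply on_mu. intros y Hy.
    destruct (Rlt_dec 0 (x + y)); auto. apply E. apply Rabs_le_between in Hy. lra. }
  destruct n as [|n]; [apply K; lra|].
  change (stay (S n) (Nop f) = stay (S n) (Nop g)). apply on_stay_S.
  intros x Hx; apply K; lra.
Qed.

(** A surviving walk either survives or exits at its next step; in generating functions this is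
    [Q (1 - s mu) = 1 - V]. *)
Lemma stay_ladder n f : stay (S n) f + ladder (S n) f = stay n (Pop f).
Proof.
  simpl. rewrite <- (fin_plus (stay n)); [|apply fin_stay]. apply fin_ext; [apply fin_stay|].
  intros x. unfold Bop, Nop, Pop. rewrite <- fin_plus; [|apply fin_mu].
  apply fin_ext; [apply fin_mu|]. intros y. destruct (Rlt_dec 0 (x + y)); lra.
Qed.

(** * The Wiener-Hopf factorization *)

(** Truncations of the objects of the overview: [QQ] is [Q], [VV] is [V], [UU] is [1 - V], [WW] is
    [1 - s mu], [CC] is the scalar [c(s)]; [GG] is the Green function, the inverse of [1 - s mu]. *)
Definition QQ := gen stay.
Definition GG := gen walk.
Definition VV := gen ladder.
Definition UU (N : nat) : func := fun F => F (O, 0) - VV N F.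
Definition WW : func := fun F => F (O, 0) - mu d p (fun y => F (1%nat, y)).
Definition CC (N : nat) : func := fun F => UU N (zer F).

Lemma fin_QQ N : fin (QQ N). Proof. apply fin_gen, fin_stay. Qed.
Lemma fin_GG N : fin (GG N). Proof. apply fin_gen, fin_walk. Qed.
Lemma fin_VV N : fin (VV N). Proof. apply fin_gen, fin_ladder. Qed.
Lemma fin_UU N : fin (UU N).
Proof. apply fin_sub; [apply fin_pt|apply fin_VV]. Qed.
Lemma fin_WW : fin WW.
Proof.
  apply fin_sub; [apply fin_pt|]. apply (fin_map (mu d p) (fun y => (1%nat, y))). apply fin_mu.
Qed.
Lemma fin_CC N : fin (CC N).
Proof.
  apply (fin_funct (fun F => UU N (fun z => (if Req_EM_T (snd z) 0 then 1 else 0) * F z))).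
  - intros F. unfold CC, zer. apply fin_ext; [apply fin_UU|]. intros z.
    destruct (Req_EM_T (snd z) 0); lra.
  - apply fin_weight. apply fin_UU.
Qed.
Hint Resolve fin_QQ fin_GG fin_VV fin_UU fin_WW fin_CC fin_conv fin_refl fin_dert
  fin_mu fin_stay fin_walk fin_ladder eqN_refl : fn.

(** The coefficients of [A (1 - s mu)] are [A_0] and [A_(n+1) - A_n mu]. The boundary term [A_N mu]
    sits at time [N + 1], where [F] vanishes. *)
Lemma conv_gen_WW A N : (forall n, fin (A n)) ->
  forall F, tst N F -> conv (gen A N) WW F =
   A O (fun x => F (O, x)) - rsum N (fun n => A n (Pop (fun x => F (S n, x))) - A (S n) (fun x => F (S n, x))).
Proof.
  intros FA F T. unfold conv, gen, WW.
  rewrite (rsum_ext (S N) _ (fun n => A n (fun x => F (n, x)) - A n (Pop (fun x => F (S n, x))))).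
  2:{ intros n _. rewrite <- fin_minus; auto. apply fin_ext; auto. intros x.
      unfold zadd, Pop; simpl. rewrite Nat.add_0_r, Rplus_0_r, Nat.add_1_r. reflexivity. }
  rewrite rsum_minus. rewrite (rsum_S_l N (fun n => A n (fun x => F (n, x)))).
  cbn [rsum]. rewrite rsum_minus.
  rewrite (fin_zero (A N) (Pop (fun x => F (S N, x)))); auto; [lra|].
  intros x. apply (fin_zero (mu d p)); [apply fin_mu|]. intros; apply T; simpl; lia.
Qed.

Lemma QW N : eqN N (conv (QQ N) WW) (UU N).
Proof.
  intros F T. unfold QQ. rewrite conv_gen_WW; auto with fn. unfold UU, VV, gen.
  rewrite rsum_S_l. simpl (ladder 0 _). simpl (stay 0 _).
  rewrite (rsum_ext N _ (fun n => ladder (S n) (fun x => F (S n, x)))); [lra|].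
  intros n _. rewrite <- stay_ladder. lra.
Qed.

Lemma GW N : eqN N (conv (GG N) WW) dlt.
Proof.
  intros F T. unfold GG. rewrite conv_gen_WW; auto with fn. unfold dlt.
  rewrite rsum_zero; [simpl; lra|]. intros n _. simpl. lra.
Qed.

(** The point where the symmetry of the step law enters the factorization. *)
Lemma refl_WW : refl_f WW = WW.
Proof.
  apply functional_extensionality. intros F. unfold refl_f, WW, zneg; simpl.
  rewrite Ropp_0, (mu_opp (fun y => F (1%nat, y))). auto.
Qed.

Notation QR N := (refl_f (QQ N)).
Notation UR N := (refl_f (UU N)).

Lemma QrW N : eqN N (conv (QR N) WW) (UR N).
Proof. rewrite <- refl_WW, <- refl_conv. apply eqN_reflf, QW. Qed.

(** Both sides are [Q Q' (1 - s mu)], where [Q'] is the reflection of [Q]. *)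
Lemma Q_Ur N : eqN N (conv (QQ N) (UR N)) (conv (QR N) (UU N)).
Proof.
  apply eqN_trans with (conv (QQ N) (conv (QR N) WW)).
  - apply eqN_conv; auto with fn. apply eqN_sym, QrW.
  - rewrite conv_assoc, (conv_comm (QQ N) (QR N)), <- conv_assoc; auto with fn.
    apply eqN_conv; auto with fn. apply QW.
Qed.

(** Surviving at a time [n >= 1] means being strictly positive, so on [x <= 0] the measure [Q] is
    just its unit starting mass. *)
Lemma Q_origin N h : (forall z, 0 < snd z -> h z = 0) -> QQ N h = h (O, 0).
Proof.
  intros E. unfold QQ, gen. rewrite rsum_S_l, rsum_zero; [simpl; lra|].
  intros n _. apply (on_zero (fun x => 0 < x) _ _ (fin_stay (S n)) (on_stay_S n)).
  intros x Hx. apply E; auto.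
Qed.

Lemma dQ_origin N h : (forall z, 0 < snd z -> h z = 0) -> dert (QQ N) h = 0.
Proof.
  intros E. unfold dert. rewrite Q_origin; [simpl; lra|]. intros z Hz. rewrite E; auto; lra.
Qed.

Lemma on_QQ N : on (fun z => 0 <= snd z) (QQ N).
Proof.
  intros f g E. apply Rminus_diag_uniq. rewrite <- fin_minus; auto with fn.
  rewrite Q_origin; [rewrite E; simpl; lra|]. intros z Hz. rewrite E; lra.
Qed.

Lemma on_UU N : on (fun z => snd z <= 0) (UU N).
Proof.
  intros f g E. unfold UU, VV, gen. rewrite (E (O, 0)); [|simpl; lra]. f_equal.
  apply rsum_ext. intros n _. apply on_ladder. intros x Hx. apply E; simpl; lra.
Qed.

Lemma on_refl (D D' : nat * R -> Prop) A :
  (forall z, D z -> D' (zneg z)) -> on D A -> on D' (refl_f A).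
Proof. intros HD O f g E. apply O. intros z Hz. auto. Qed.

Lemma on_UR N : on (fun z => 0 <= snd z) (UR N).
Proof. apply (on_refl (fun z => snd z <= 0)); [simpl; intros; lra|apply on_UU]. Qed.
Lemma on_QR N : on (fun z => snd z <= 0) (QR N).
Proof. apply (on_refl (fun z => 0 <= snd z)); [simpl; intros; lra|apply on_QQ]. Qed.

Lemma conv_on (D1 D2 D : nat * R -> Prop) A B :
  (forall z w, D1 z -> D2 w -> D (zadd z w)) -> on D1 A -> on D2 B -> on D (conv A B).
Proof. intros HD O1 O2 f g E. apply O1. intros z Hz. apply O2. intros w Hw. auto. Qed.

Lemma zer_0 F z : snd z <> 0 -> zer F z = 0.
Proof. intros Hz. unfold zer. destruct (Req_EM_T (snd z) 0); auto; lra. Qed.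

Lemma tst_zer N F : tst N F -> tst N (zer F).
Proof. intros T z Hz. unfold zer. destruct (Req_EM_T (snd z) 0); auto. Qed.

Lemma zer_neg F z : zer F (zneg z) = zer F z.
Proof.
  destruct z as [n x]. unfold zer, zneg; simpl.
  destruct (Req_EM_T x 0) as [->|Hx].
  - rewrite Ropp_0. destruct (Req_EM_T 0 0); auto; lra.
  - destruct (Req_EM_T (- x) 0); auto; lra.
Qed.

(* [Q (1 - ladder reversed)] lives on [x >= 0] while [Q reversed (1 - ladder)] lives on
   [x <= 0]; being equal, both live at [x = 0]. *)
Lemma Q_Ur_C N : eqN N (conv (QQ N) (UR N)) (CC N).
Proof.
  intros F T.
  assert (O1 : on (fun z => 0 <= snd z) (conv (QQ N) (UR N))).
  { apply (conv_on (fun z => 0 <= snd z) (fun z => 0 <= snd z)); [simpl; intros; lra| |].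
    apply on_QQ. apply on_UR. }
  assert (O2 : on (fun z => snd z <= 0) (conv (QR N) (UU N))).
  { apply (conv_on (fun z => snd z <= 0) (fun z => snd z <= 0)); [simpl; intros; lra| |].
    apply on_QR. apply on_UU. }
  (* The left form allows cutting [F] down to [x >= 0], the right form then to [x = 0]; back in the
     left form, [Q] contributes only its starting mass. *)
  set (P := fun z => if Rle_dec 0 (snd z) then F z else 0).
  assert (TP : tst N P). { intros z Hz. unfold P. destruct (Rle_dec 0 (snd z)); auto. }
  rewrite (O1 F P).
  2:{ intros z Hz. unfold P. destruct (Rle_dec 0 (snd z)); auto; lra. }
  rewrite (Q_Ur N P TP).
  rewrite (O2 P (zer F)).
  2:{ intros z Hz. unfold P, zer. destruct (Rle_dec 0 (snd z)), (Req_EM_T (snd z) 0); auto; lra. }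
  rewrite <- (Q_Ur N) by (apply tst_zer; auto).
  unfold conv. rewrite Q_origin.
  - unfold CC, refl_f. apply fin_ext; auto with fn. intros z. rewrite zadd_0_l.
    apply zer_neg.
  - intros z Hz. apply (on_zero _ _ _ (fin_refl _ (fin_UU N)) (on_UR N)). intros w Hw. apply zer_0.
    simpl. lra.
Qed.

Lemma U_Ur N : eqN N (conv (UU N) (UR N)) (conv WW (CC N)).
Proof.
  apply eqN_trans with (conv (conv (QQ N) WW) (UR N)).
  - apply eqN_conv; auto with fn. apply eqN_sym, QW.
  - rewrite (conv_comm (QQ N) WW), <- conv_assoc; auto with fn.
    apply eqN_conv; auto with fn. apply Q_Ur_C.
Qed.

(** Divide [Q' (1 - s mu) = 1 - V'] by [1 - s mu]. *)
Lemma G_Ur N : eqN N (conv (GG N) (UR N)) (QR N).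
Proof.
  apply eqN_trans with (conv (GG N) (conv (QR N) WW)).
  - apply eqN_conv; auto with fn. apply eqN_sym, QrW.
  - rewrite (conv_comm (QR N) WW), conv_assoc, conv_comm; auto with fn.
    rewrite <- (conv_dlt_r (QR N)) at 2. apply eqN_conv; auto with fn. apply fin_pt. apply GW.
Qed.

(** Leibniz rule for [1 - V = Q (1 - s mu)], multiplied by [Q' = G (1 - V')]. This is the
    logarithmic derivative in a form free of logarithms: at [x = 0] the left side reduces to
    [s c'(s)], the first term on the right dies, and the second is [c(s)] times minus the generating
    function of the returns. *)
Lemma dU_Qr N F : tst N F ->
  conv (dert (UU N)) (QR N) F = conv (dert (QQ N)) (UR N) F + conv (CC N) (conv (dert WW) (GG N)) F.
Proof.
  intros T.
  assert (E1 : eqN N (conv (dert (UU N)) (QR N))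
                     (conv (dert (conv (QQ N) WW)) (conv (GG N) (UR N)))).
  { apply eqN_conv; auto with fn; [|apply eqN_sym, G_Ur]. apply eqN_dert, eqN_sym, QW. }
  rewrite E1; auto. clear E1.
  unfold conv at 1. rewrite dert_conv; auto with fn. f_equal.
  - change (conv (conv (dert (QQ N)) WW) (conv (GG N) (UR N)) F = conv (dert (QQ N)) (UR N) F).
    assert (E2 : eqN N (conv (conv (dert (QQ N)) WW) (conv (GG N) (UR N))) (conv (conv (dert (QQ N)) (UR N)) dlt)).
    { rewrite (conv_comm (GG N) (UR N)), <- conv_assoc, (conv_assoc WW), (conv_comm WW (UR N)); auto with fn.
      rewrite <- (conv_assoc (UR N)), (conv_assoc (dert (QQ N))), (conv_comm WW); auto with fn.
      apply eqN_conv; auto with fn. apply fin_pt. apply GW. }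
    rewrite E2, conv_dlt_r; auto.
  - change (conv (conv (QQ N) (dert WW)) (conv (GG N) (UR N)) F = conv (CC N) (conv (dert WW) (GG N)) F).
    assert (E2 : eqN N (conv (conv (QQ N) (dert WW)) (conv (GG N) (UR N))) (conv (CC N) (conv (dert WW) (GG N)))).
    { rewrite <- conv_assoc, (conv_assoc (dert WW)), (conv_comm (conv (dert WW) (GG N))), conv_assoc; auto with fn.
      apply eqN_conv; auto with fn. apply Q_Ur_C. }
    apply E2; auto.
Qed.

End Walk.

(** * Coefficient identities *)

Definition ind0 (x : R) : R := if Req_EM_T x 0 then 1 else 0.

Lemma ind0_0 : ind0 0 = 1.
Proof. unfold ind0. destruct (Req_EM_T 0 0); lra. Qed.

Lemma ind0_ne x : x <> 0 -> ind0 x = 0.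
Proof. intros Hx. unfold ind0. destruct (Req_EM_T x 0); lra. Qed.

Lemma ind0_range x : 0 <= ind0 x <= 1.
Proof. unfold ind0. destruct (Req_EM_T x 0); lra. Qed.

Lemma sum_rsum n f : sum_f_R0 f n = rsum (S n) f.
Proof. induction n as [|n IH]; [simpl; lra|]. simpl. simpl in IH. rewrite IH. lra. Qed.

Section Coeff.
Context (d : nat) (p : vecR) (Hd : (1 <= d)%nat).

(** Coefficient of [s^n] in [1 - V]; its moments and its atom at [0] are then coefficient sequences
    for [PS_mult]. *)
Definition ufn (n : nat) (f : R -> R) : R :=
  match n with O => f 0 | S _ => - ladder d p n f end.
Definition umom (j n : nat) : R := ufn n (fun x => x ^ j).
Definition ccf (n : nat) : R := ufn n ind0.
Definition ret (n : nat) : R := walk d p n ind0.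
(** Coefficients of [s a'(s)] for [a(s) = sum_(n >= 1) P(p.X_n = 0) s^n / n], hence no term at
    [n = 0]. *)
Definition retp (n : nat) : R := match n with O => 0 | S _ => ret n end.
Definition sigma2 : R := mu d p (fun x => x ^ 2).

Lemma fin_ufn n : fin (ufn n).
Proof.
  destruct n as [|n]; [apply fin_pt|].
  apply (fin_funct (fun f => (-1) * ladder d p (S n) f)); [intros; simpl; lra|].
  apply fin_mult, fin_ladder.
Qed.

Lemma UU_gen N F : UU d p N F = gen ufn N F.
Proof.
  unfold UU, VV, gen. rewrite !rsum_S_l. unfold ufn at 1. simpl (ladder d p 0 _).
  rewrite (rsum_ext N (fun i => ufn (S i) _)
    (fun i => (-1) * ladder d p (S i) (fun x => F (S i, x)))).
  2:{ intros; unfold ufn; lra. }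
  rewrite rsum_scal. lra.
Qed.

Lemma CC_ccf N F : CC d p N F = rsum (S N) (fun n => ccf n * F (n, 0)).
Proof.
  unfold CC. rewrite UU_gen. unfold gen. apply rsum_ext. intros n _.
  unfold ccf. rewrite Rmult_comm, <- fin_scal; [|apply fin_ufn].
  apply fin_ext; [apply fin_ufn|]. intros x. unfold zer, ind0; simpl.
  destruct (Req_EM_T x 0) as [->|]; lra.
Qed.

(** Extracts the coefficient of [s^k], integrated against [f]; it belongs to [tst k], so identities
    modulo [s^(k+1)] apply to it. *)
Definition at_time (k : nat) (f : R -> R) : nat * R -> R :=
  fun z => if Nat.eqb (fst z) k then f (snd z) else 0.

Lemma tst_at_time k f : tst k (at_time k f).
Proof. intros z Hz. unfold at_time. destruct (Nat.eqb_spec (fst z) k); auto; lia. Qed.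

Lemma conv_gen_at_time (A B : nat -> (R -> R) -> R) k f :
  (forall n, fin (A n)) -> (forall n, fin (B n)) ->
  conv (gen A k) (gen B k) (at_time k f) =
  rsum (S k) (fun n => A n (fun x => B (k - n)%nat (fun y => f (x + y)))).
Proof.
  intros FA FB. unfold conv, gen. apply rsum_ext. intros n Hn.
  apply fin_ext; auto. intros x. rewrite (rsum_single (S k) (k - n)); [|lia|].
  - apply fin_ext; auto. intros y. unfold at_time, zadd; simpl.
    replace (n + (k - n))%nat with k by lia. rewrite Nat.eqb_refl. auto.
  - intros i Hi Hne. apply fin_zero; auto. intros y. unfold at_time, zadd; simpl.
    destruct (Nat.eqb_spec (n + i) k); auto; lia.
Qed.

Lemma conv_W_C k f :
  conv (WW d p) (CC d p k) (at_time k f) = ccf k * f 0 - PS_incr_1 ccf k * mu d p f.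
Proof.
  unfold conv, WW. rewrite CC_ccf. f_equal.
  - rewrite (rsum_single (S k) k); [|lia|].
    + unfold at_time, zadd; simpl. rewrite Nat.eqb_refl, Rplus_0_l. auto.
    + intros i Hi Hne. unfold at_time, zadd; simpl.
      destruct (Nat.eqb_spec i k); [lia|lra].
  - rewrite (fin_ext (mu d p) _ (fun y => PS_incr_1 ccf k * f y)).
    + apply fin_scal, fin_mu.
    + apply fin_mu.
    + intros y. rewrite CC_ccf. destruct k as [|k].
      * simpl. unfold at_time, zadd, zero; simpl. lra.
      * rewrite (rsum_single (S (S k)) k); [|lia|].
        -- unfold at_time, zadd; simpl. rewrite Nat.eqb_refl, Rplus_0_r. auto.
        -- intros i Hi Hne. unfold at_time, zadd; simpl.
           destruct (Nat.eqb_spec i k); [lia|lra].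
Qed.

Lemma U_Ur_coeff k f :
  rsum (S k) (fun n => ufn n (fun x => ufn (k - n)%nat (fun y => f (x - y))))
  = ccf k * f 0 - PS_incr_1 ccf k * mu d p f.
Proof.
  rewrite <- conv_W_C, <- (U_Ur d p Hd k _ (tst_at_time k f)).
  assert (E : conv (UU d p k) (refl_f (UU d p k)) =
     conv (gen ufn k) (gen (fun n f => ufn n (fun x => f (- x))) k)).
  { replace (UU d p k) with (gen ufn k); [reflexivity|].
    apply functional_extensionality; intros; rewrite UU_gen; auto. }
  rewrite E, conv_gen_at_time; [reflexivity|apply fin_ufn|].
  intros n. apply (fin_map (ufn n) Ropp), fin_ufn.
Qed.

Lemma mass_coeff k : PS_mult (umom 0) (umom 0) k = ccf k - PS_incr_1 ccf k.
Proof.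
  unfold PS_mult. rewrite sum_rsum.
  transitivity (ccf k * (fun _ => 1) 0 - PS_incr_1 ccf k * mu d p (fun _ => 1)).
  - rewrite <- (U_Ur_coeff k (fun _ => 1)). apply rsum_ext. intros n _. unfold umom.
    rewrite Rmult_comm, <- fin_scal; [|apply fin_ufn]. apply fin_ext; [apply fin_ufn|].
    intros x. simpl. lra.
  - rewrite (mu_const d p Hd). lra.
Qed.

(** Test the factorization with the square function. The reflection turns it into [(x - y)^2], whose
    cross term produces the square of the first moment; this is what makes the mean of [Y_T]
    computable. *)
Lemma second_moment_coeff k :
  PS_mult (umom 2) (umom 0) k - 2 * PS_mult (umom 1) (umom 1) k + PS_mult (umom 0) (umom 2) k
  = - (sigma2 * PS_incr_1 ccf k).
Proof.
  unfold PS_mult. rewrite !sum_rsum, <- rsum_scal, <- rsum_minus, <- rsum_plus.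
  transitivity (ccf k * (fun x => x ^ 2) 0 - PS_incr_1 ccf k * mu d p (fun x => x ^ 2)).
  - rewrite <- (U_Ur_coeff k (fun x => x ^ 2)). apply rsum_ext. intros n _. unfold umom.
    pose proof (fin_ufn n) as F1. pose proof (fin_ufn (k - n)) as F2.
    set (A := ufn n) in *. set (B := ufn (k - n)) in *.
    assert (E : forall x, B (fun y => (x - y) ^ 2) =
       (B (fun y => y ^ 0) * x ^ 2 + - 2 * B (fun y => y ^ 1) * x ^ 1) + B (fun y => y ^ 2) * x ^ 0).
    { intros x. rewrite (fin_ext B _ (fun y => (x ^ 2 * y ^ 0 + (-2 * x) * y ^ 1) + y ^ 2)); auto.
      - rewrite !fin_plus, !fin_scal; auto. ring.
      - intros; ring. }
    rewrite (fin_ext A _ _ F1 E), !fin_plus, !fin_scal; auto. ring.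
  - unfold sigma2. ring.
Qed.

(** Coefficient form of [s c'(s) = - c(s) s a'(s)], read off from [dU_Qr] at [x = 0]. *)
Lemma ret_coeff k : INR k * ccf k = - PS_mult ccf retp k.
Proof.
  pose proof (dU_Qr d p Hd k _ (tst_at_time k ind0)) as E.
  (* Both factors live on [x <= 0], so positions adding up to [0] see the reflected [Q] only at its
     starting mass. *)
  assert (E1 : conv (dert (UU d p k)) (refl_f (QQ d p k)) (at_time k ind0) = INR k * ccf k).
  { rewrite conv_comm; [|apply fin_dert, fin_UU|apply fin_refl, fin_QQ].
    unfold conv at 1. unfold refl_f. rewrite Q_origin.
    - unfold zneg; simpl. rewrite Ropp_0. unfold dert. rewrite UU_gen. unfold gen.
      rewrite (rsum_single (S k) k); [|lia|].
      + unfold ccf. rewrite <- fin_scal; [|apply fin_ufn]. apply fin_ext; [apply fin_ufn|].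
        intros x. unfold at_time, zadd; simpl. rewrite Nat.eqb_refl, Rplus_0_l. auto.
      + intros i Hi Hne. apply fin_zero; [apply fin_ufn|]. intros x.
        unfold at_time, zadd; simpl. destruct (Nat.eqb_spec i k); [lia|lra].
    - intros z Hz. unfold dert. apply (on_zero _ _ _ (fin_UU d p k) (on_UU d p k)).
      intros w Hw. unfold at_time, zadd, zneg; simpl.
      destruct (Nat.eqb (fst z + fst w) k); [|lra]. rewrite ind0_ne; lra. }
  (* The same support argument on [x >= 0], except that the starting mass has time [0] and [dert]
     gives it weight [0]. *)
  assert (E2 : conv (dert (QQ d p k)) (refl_f (UU d p k)) (at_time k ind0) = 0).
  { unfold conv at 1. rewrite dQ_origin; auto. intros z Hz.
    apply (on_zero _ _ _ (fin_refl _ (fin_UU d p k)) (on_UR d p k)). intros w Hw.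
    unfold at_time, zadd; simpl. destruct (Nat.eqb (fst z + fst w) k); [|lra].
    rewrite ind0_ne; lra. }
  (* [dert WW] is [- s mu], and one step followed by [n] steps returns to [0] with probability
     [ret (S n)]. *)
  assert (E3 : conv (CC d p k) (conv (dert (WW d p)) (GG d p k)) (at_time k ind0)
               = - PS_mult ccf retp k).
  { unfold conv at 1. rewrite CC_ccf. unfold PS_mult. rewrite sum_rsum.
    rewrite <- (Rmult_1_l (rsum (S k) (fun n => ccf n * retp (k - n)))), Ropp_mult_distr_l, <- rsum_scal.
    apply rsum_ext. intros m Hm.
    transitivity (ccf m * (- retp (k - m))); [|ring]. f_equal.
    unfold conv, dert, WW; simpl (fst _). simpl (INR 0). simpl (INR 1).
    rewrite Rmult_0_l, Rminus_0_l. f_equal.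
    rewrite (fin_ext (mu d p) _ (fun y => rsum (S k) (fun n => walk d p n
      (fun x => at_time k ind0 (zadd (m, 0) (zadd (1%nat, y) (n, x))))))); [|apply fin_mu|].
    2:{ intros y. rewrite Rmult_1_l. reflexivity. }
    rewrite (fin_rsum (mu d p)); [|apply fin_mu].
    rewrite (rsum_ext (S k) _ (fun n => if Nat.eqb (m + S n) k then ret (S n) else 0)).
    2:{ intros n _. rewrite (fin_swap (mu d p) (walk d p n)); [|apply fin_mu|apply fin_walk].
        unfold at_time; simpl (fst _). simpl (1 + n)%nat.
        destruct (Nat.eqb (m + S n) k) eqn:Q.
        - unfold ret. simpl walk. apply fin_ext; [apply fin_walk|]. intros x. unfold Pop.
          apply fin_ext; [apply fin_mu|]. intros y. simpl. f_equal. lra.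
        - apply fin_zero; [apply fin_walk|]. intros. apply fin_zero; auto. apply fin_mu. }
    destruct (k - m)%nat as [|j] eqn:J; simpl.
    - rewrite rsum_zero.
      + destruct (Nat.eqb_spec (m + S k) k); [lia|lra].
      + intros i Hi. destruct (Nat.eqb_spec (m + S i) k); [lia|lra].
    - change (rsum (S k) (fun i => if Nat.eqb (m + S i) k then ret (S i) else 0) = ret (S j)).
      rewrite (rsum_single (S k) j); [|lia|].
      + destruct (Nat.eqb_spec (m + S j) k); [auto|lia].
      + intros i Hi Hne. destruct (Nat.eqb_spec (m + S i) k); [lia|lra]. }
  rewrite E1, E2, E3 in E. lra.
Qed.

End Coeff.

(** * Nonnegative series and Abel summation *)

Lemma sum_n_rsum (f : nat -> R) (n : nat) : sum_n f n = rsum (S n) f.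
Proof. rewrite sum_n_Reals. apply sum_rsum. Qed.

Lemma rsum_mono (f : nat -> R) (n m : nat) :
  (forall k, 0 <= f k) -> (n <= m)%nat -> rsum n f <= rsum m f.
Proof. intros Hf L. induction L; [lra|]. simpl. generalize (Hf m); lra. Qed.

Lemma is_lim_seq_rsum (x : nat -> R) : ex_series x -> is_lim_seq (fun n => rsum (S n) x) (Series x).
Proof.
  intros E. apply (is_lim_seq_ext (sum_n x)); [intros; apply sum_n_rsum|].
  exact (Series_correct x E).
Qed.

Lemma ex_series_bounded (x : nat -> R) (K : R) :
  (forall n, 0 <= x n) -> (forall n, rsum n x <= K) -> ex_series x.
Proof.
  intros P B. destruct (ex_finite_lim_seq_incr (sum_n x) K) as [l Hl].
  - intros n. rewrite !sum_n_rsum. apply rsum_mono; auto.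
  - intros n. rewrite sum_n_rsum; auto.
  - exists l. exact Hl.
Qed.

Lemma Series_ge_rsum (x : nat -> R) n : (forall n, 0 <= x n) -> ex_series x -> rsum n x <= Series x.
Proof.
  intros P E. apply Rle_trans with (rsum (S n) x); [apply rsum_mono; auto|].
  apply (is_lim_seq_incr_compare (fun n => rsum (S n) x)); [apply is_lim_seq_rsum; auto|].
  intros k. apply rsum_mono; auto.
Qed.

Lemma Series_le_bound (x : nat -> R) K : ex_series x -> (forall n, rsum n x <= K) -> Series x <= K.
Proof.
  intros E B. apply (is_lim_seq_le (fun n => rsum (S n) x) (fun _ => K) (Series x) K); auto.
  - apply is_lim_seq_rsum; auto.
  - apply is_lim_seq_const.
Qed.

Lemma Series_term_le (x : nat -> R) n : (forall n, 0 <= x n) -> ex_series x -> x n <= Series x.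
Proof.
  intros P E. apply Rle_trans with (rsum (S n) x); [|apply Series_ge_rsum; auto].
  apply rsum_term_le; auto.
Qed.

Lemma pow_range (s : R) n : 0 <= s <= 1 -> 0 <= s ^ n <= 1.
Proof.
  intros Hs. split; [apply pow_le; lra|]. rewrite <- (pow1 n). apply pow_incr; lra.
Qed.

Lemma CV_bounded (x : nat -> R) (K s : R) :
  (forall n, Rabs (x n) <= K) -> Rabs s < 1 -> Rbar_lt (Rabs s) (CV_radius x).
Proof.
  intros B Hs. destruct (CV_radius_bounded x) as [U _].
  apply Rbar_lt_le_trans with 1; [exact Hs|]. apply U. exists K. intros n.
  rewrite pow1, Rmult_1_r; auto.
Qed.

Lemma ex_series_pow (x : nat -> R) (s : R) : (forall n, 0 <= x n) -> ex_series x ->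
  0 <= s <= 1 -> ex_series (fun n => x n * s ^ n).
Proof.
  intros P E Hs. apply (ex_series_le (fun n => x n * s ^ n) x); auto. intros n.
  generalize (pow_range s n Hs) (P n); intros.
  change (Rabs (x n * s ^ n) <= x n). rewrite Rabs_pos_eq; nra.
Qed.

Definition to1 (k : nat) : R := 1 - / (INR k + 2).

Lemma to1_range k : 0 <= to1 k < 1.
Proof.
  unfold to1. generalize (pos_INR k). intros.
  assert (0 < / (INR k + 2)) by (apply Rinv_0_lt_compat; lra).
  assert (/ (INR k + 2) <= / 2) by (apply Rinv_le_contravar; lra). lra.
Qed.

Lemma to1_lim : is_lim_seq to1 1.
Proof.
  unfold to1. replace (Finite 1) with (Finite (1 - 0)) by (f_equal; ring).
  apply is_lim_seq_minus'; [apply is_lim_seq_const|].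
  apply (is_lim_seq_inv (fun n => INR n + 2) p_infty); [|discriminate].
  apply is_lim_seq_plus with p_infty 2; [apply is_lim_seq_INR|apply is_lim_seq_const|reflexivity].
Qed.

Lemma lim_rsum_pow (x : nat -> R) n :
  is_lim_seq (fun k => rsum n (fun i => x i * to1 k ^ i)) (rsum n x).
Proof.
  assert (P : forall m, is_lim_seq (fun k => to1 k ^ m) 1).
  { induction m as [|m IH]; simpl; [apply is_lim_seq_const|].
    replace (Finite 1) with (Finite (1 * 1)) by (f_equal; ring).
    apply is_lim_seq_mult'; auto. apply to1_lim. }
  induction n as [|n IH]; simpl; [apply is_lim_seq_const|].
  apply is_lim_seq_plus'; auto.
  replace (Finite (x n)) with (Finite (x n * 1)) by (f_equal; ring).
  apply is_lim_seq_mult'; auto. apply is_lim_seq_const.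
Qed.

Lemma PSeries_le_Series (x : nat -> R) (s : R) : (forall n, 0 <= x n) -> ex_series x ->
  0 <= s <= 1 -> PSeries x s <= Series x.
Proof.
  intros P E Hs. apply Series_le; auto. intros n. generalize (pow_range s n Hs) (P n); intros.
  split; nra.
Qed.

(** With nonnegative terms the power series is squeezed between a finite polynomial part, which
    tends to a partial sum, and the full series. *)
Lemma Abel_nonneg (x : nat -> R) : (forall n, 0 <= x n) -> ex_series x ->
  is_lim_seq (fun k => PSeries x (to1 k)) (Series x).
Proof.
  intros P E. apply is_lim_seq_spec. intros eps. generalize (cond_pos eps); intros He.
  destruct (proj2 (is_lim_seq_spec _ _) (is_lim_seq_rsum x E) (pos_div_2 eps)) as [N HN].
  destruct (proj2 (is_lim_seq_spec _ _) (lim_rsum_pow x (S N)) (pos_div_2 eps)) as [K HK].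
  specialize (HN N (Nat.le_refl N)).
  exists K. intros k Hk. specialize (HK k Hk).
  assert (B := to1_range k).
  assert (U : PSeries x (to1 k) <= Series x) by (apply PSeries_le_Series; auto; lra).
  assert (L : rsum (S N) (fun i => x i * to1 k ^ i) <= PSeries x (to1 k)).
  { apply (Series_ge_rsum (fun i => x i * to1 k ^ i)).
    - intros n. apply Rmult_le_pos; auto. apply pow_le; lra.
    - apply ex_series_pow; auto; lra. }
  apply Rabs_def2 in HN, HK. change (pos (pos_div_2 eps)) with (eps / 2) in *.
  apply Rabs_def1; lra.
Qed.

(** With [x = 1/(N+1)], Bernoulli gives [(1 + x)^(N+1) >= 2], while [(1 - x)(1 + x) <= 1]. *)
Lemma one_minus_inv_pow (N n : nat) : (N < n)%nat -> (1 - / INR (S N)) ^ n <= / 2.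
Proof.
  intros Hn. set (x := / INR (S N)).
  assert (Hp : 0 < INR (S N)) by (apply lt_0_INR; lia).
  assert (Hx : 0 < x) by (apply Rinv_0_lt_compat; auto).
  assert (Hx1 : x <= 1).
  { unfold x. rewrite <- Rinv_1. apply Rinv_le_contravar; [lra|].
    rewrite S_INR. generalize (pos_INR N); lra. }
  apply Rle_trans with ((1 - x) ^ S N).
  - replace n with ((n - S N) + S N)%nat by lia. rewrite pow_add.
    assert (0 <= (1 - x) ^ S N) by (apply pow_le; lra).
    assert (K : 0 <= (1 - x) ^ (n - S N) <= 1) by (apply pow_range; lra). nra.
  - assert (B : 2 <= (1 + x) ^ S N).
    { generalize (poly (S N) x Hx). unfold x at 1. rewrite Rinv_r; lra. }
    assert (A : (1 - x) ^ S N * (1 + x) ^ S N <= 1).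
    { rewrite <- Rpow_mult_distr. apply pow_range. split; nra. }
    assert (0 <= (1 - x) ^ S N) by (apply pow_le; lra).
    nra.
Qed.

(** * Generating functions of the ladder moments *)

Section Analytic.
Context (d : nat) (p : vecR) (Hd : (1 <= d)%nat) (Hp : nonzeroR d p).

(** [E (f(Y_T); T = n)]. Below, [g] is the part with [Y_T = 0], [l0] the law of [T], and [l1], [l2]
    the first two moments of the overshoot [- Y_T]. *)
Definition lmom (f : R -> R) (n : nat) : R := ladder d p n f.
Notation g := (lmom ind0).
Notation l0 := (lmom (fun _ => 1)).
Notation l1 := (lmom (fun x => - x)).
Notation l2 := (lmom (fun x => x ^ 2)).
Definition retn (n : nat) : R := retp d p n / INR n.

Lemma lmom_le f h n : (forall x, - step_bound d p <= x <= 0 -> f x <= h x) -> lmom f n <= lmom h n.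
Proof.
  intros E. unfold lmom.
  set (D := fun x => - step_bound d p <= x <= 0).
  assert (dec : forall x, {D x} + {~ D x}).
  { intros x. unfold D. destruct (Rle_dec (- step_bound d p) x), (Rle_dec x 0); tauto. }
  rewrite (on_ladder d p n f (fun x => if dec x then f x else h x)).
  - apply pos_le; [apply fin_ladder|apply pos_ladder; auto|]. intros x. destruct (dec x); [auto|lra].
  - intros x Hx. destruct (dec x); auto. unfold D in *; tauto.
Qed.

Lemma lmom_nonneg f n : (forall x, - step_bound d p <= x <= 0 -> 0 <= f x) -> 0 <= lmom f n.
Proof.
  intros E. apply Rle_trans with (lmom (fun _ => 0) n); [|apply lmom_le; auto].
  right. unfold lmom. rewrite fin_zero; auto. apply fin_ladder.
Qed.

Lemma lmom_scal c f n : lmom (fun x => c * f x) n = c * lmom f n.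
Proof. exact (fin_scal (ladder d p n) c f (fin_ladder d p n)). Qed.

Lemma stay_l0 n : stay d p n (fun _ => 1) + rsum (S n) l0 = 1.
Proof.
  induction n as [|n IH].
  - unfold lmom; simpl. lra.
  - assert (E := stay_ladder d p n (fun _ => 1)).
    rewrite (fin_ext (stay d p n) (Pop d p (fun _ => 1)) (fun _ => 1)) in E.
    + change (stay d p (S n) (fun _ => 1) + (rsum (S n) l0 + ladder d p (S n) (fun _ => 1)) = 1). lra.
    + apply fin_stay.
    + intros x. exact (mu_const d p Hd 1).
Qed.

(** Optional stopping at [min(n, T)]: the martingale starts at [0], so the mean of the surviving
    part balances the overshoot so far. *)
Lemma stay_l1 n : stay d p n (fun x => x) = rsum (S n) l1.
Proof.
  induction n as [|n IH].
  - unfold lmom; simpl. lra.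
  - assert (E := stay_ladder d p n (fun x => x)).
    rewrite (fin_ext (stay d p n) (Pop d p (fun x => x)) (fun x => x)) in E.
    + change (stay d p (S n) (fun x => x) = rsum (S n) l1 + ladder d p (S n) (fun x => - x)).
      assert (Q : ladder d p (S n) (fun x => - x) = - ladder d p (S n) (fun x => x)).
      { rewrite (fin_ext (ladder d p (S n)) _ (fun x => (-1) * x)); [|apply fin_ladder|intros; lra].
        rewrite fin_scal; [lra|apply fin_ladder]. }
      lra.
    + apply fin_stay.
    + intros x. unfold Pop. rewrite (fin_plus (mu d p) (fun _ => x) (fun y => y)); [|apply fin_mu].
      rewrite mu_const, mu_id; auto. lra.
Qed.

Lemma l0_partial n : rsum n l0 <= 1.
Proof.
  apply Rle_trans with (rsum (S n) l0).
  - apply rsum_mono; auto. intros. apply lmom_nonneg. intros; lra.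
  - generalize (stay_l0 n) (pos_stay d p Hd n (fun _ => 1)). intros A B.
    assert (0 <= stay d p n (fun _ => 1)) by (apply B; intros; lra). clear B; lra.
Qed.

Lemma lmom_facts f K : (forall x, - step_bound d p <= x <= 0 -> 0 <= f x <= K) ->
  (forall n, 0 <= lmom f n) /\ ex_series (lmom f) /\ (forall n, Rabs (lmom f n) <= K) /\
  (forall n, lmom f n <= K * l0 n).
Proof.
  intros E.
  assert (K0 : 0 <= K). { generalize (E 0) (step_bound_nonneg d p). lra. }
  assert (A : forall n, 0 <= lmom f n) by (intros; apply lmom_nonneg; apply E).
  assert (B : forall n, lmom f n <= K * l0 n).
  { intros n. rewrite <- lmom_scal. apply lmom_le. intros x Hx. generalize (E x Hx); lra. }
  assert (L : forall n, 0 <= l0 n) by (intros; apply lmom_nonneg; intros; lra).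
  repeat split; auto.
  - apply ex_series_bounded with K; auto. intros n. apply Rle_trans with (rsum n (fun i => K * l0 i)).
    + apply rsum_le; auto.
    + rewrite rsum_scal. generalize (l0_partial n); nra.
  - intros n. rewrite Rabs_pos_eq; auto. apply Rle_trans with (K * l0 n); auto.
    assert (l0 n <= 1); [|nra]. apply Rle_trans with (rsum (S n) l0); [|apply l0_partial].
    apply rsum_term_le; auto.
Qed.

Lemma g_facts : (forall n, 0 <= g n) /\ ex_series g /\ (forall n, Rabs (g n) <= 1) /\
  (forall n, g n <= 1 * l0 n).
Proof. apply lmom_facts. intros. apply ind0_range. Qed.
Lemma l0_facts : (forall n, 0 <= l0 n) /\ ex_series l0 /\ (forall n, Rabs (l0 n) <= 1) /\
  (forall n, l0 n <= 1 * l0 n).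
Proof. apply lmom_facts. intros. lra. Qed.
Lemma l1_facts : (forall n, 0 <= l1 n) /\ ex_series l1 /\ (forall n, Rabs (l1 n) <= step_bound d p) /\
  (forall n, l1 n <= step_bound d p * l0 n).
Proof. apply lmom_facts. intros. lra. Qed.
Lemma l2_facts : (forall n, 0 <= l2 n) /\ ex_series l2 /\ (forall n, Rabs (l2 n) <= step_bound d p ^ 2) /\
  (forall n, l2 n <= step_bound d p ^ 2 * l0 n).
Proof. apply lmom_facts. intros. nra. Qed.

Lemma PSeries_ext_opp (x y : nat -> R) s : (forall n, x n = - y n) -> PSeries x s = - PSeries y s.
Proof.
  intros E. rewrite (PSeries_ext x (PS_opp y)); [apply PSeries_opp|]. intros n. rewrite E. reflexivity.
Qed.

Lemma PSeries_one_minus (x y : nat -> R) s K : Rabs s < 1 -> (forall n, Rabs (y n) <= K) -> y O = 0 ->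
  x O = 1 -> (forall n, x (S n) = - y (S n)) -> PSeries x s = 1 - PSeries y s.
Proof.
  intros Hs By Y0 X0 E.
  assert (Ey : ex_pseries y s) by (apply CV_radius_inside, (CV_bounded y K); auto).
  assert (Bx : forall n, Rabs (x n) <= Rmax 1 K).
  { intros [|n]; [rewrite X0, Rabs_R1; apply Rmax_l|]. rewrite E, Rabs_Ropp.
    apply Rle_trans with K; auto. apply Rmax_r. }
  assert (Ex : ex_pseries x s) by (apply CV_radius_inside, (CV_bounded x (Rmax 1 K)); auto).
  rewrite (PSeries_decr_1 x), (PSeries_decr_1 y), X0, Y0; auto.
  rewrite (PSeries_ext_opp (PS_decr_1 x) (PS_decr_1 y)); [ring|]. intros n. apply E.
Qed.

Section AtS.
Context (s : R) (Hs : Rabs s < 1).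

Lemma PS_umom0 : PSeries (umom d p 0) s = 1 - PSeries l0 s.
Proof. apply PSeries_one_minus with 1; auto. apply l0_facts. Qed.
Lemma PS_ccf : PSeries (ccf d p) s = 1 - PSeries g s.
Proof. apply PSeries_one_minus with 1; auto; [apply g_facts|]. unfold ccf; simpl. apply ind0_0. Qed.
Lemma PS_umom1 : PSeries (umom d p 1) s = PSeries l1 s.
Proof.
  apply PSeries_ext. intros [|n]; unfold umom, lmom, ufn; [simpl; lra|].
  rewrite (fin_ext (ladder d p (S n)) (fun x => - x) (fun x => (-1) * x ^ 1)), fin_scal;
    [lra|apply fin_ladder|apply fin_ladder|intros; lra].
Qed.
Lemma PS_umom2 : PSeries (umom d p 2) s = - PSeries l2 s.
Proof. apply PSeries_ext_opp. intros [|n]; unfold umom, lmom, ufn; [simpl; lra|reflexivity]. Qed.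

Lemma umom_bounded j : exists K, forall n, Rabs (umom d p j n) <= K.
Proof.
  set (K0 := step_bound d p ^ j).
  assert (S0 := step_bound_nonneg d p).
  assert (KP : 0 <= K0) by (apply pow_le; auto).
  (* [x ^ j] may be negative; the shift by [K0] makes [lmom_facts] applicable. *)
  assert (F : forall x, - step_bound d p <= x <= 0 -> 0 <= K0 + x ^ j <= 2 * K0).
  { intros x Hx. assert (Rabs (x ^ j) <= K0).
    { rewrite <- RPow_abs. apply pow_incr. split; [apply Rabs_pos|]. apply Rabs_le; lra. }
    apply Rabs_le_between in H. lra. }
  destruct (lmom_facts _ _ F) as (A & _ & B & _).
  assert (C0 : forall x, - step_bound d p <= x <= 0 -> 0 <= K0 <= K0) by (intros; lra).
  destruct (lmom_facts _ _ C0) as (A' & _ & B' & _).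
  exists (Rmax (Rabs (0 ^ j)) (3 * K0)). intros [|n]; [apply Rmax_l|].
  apply Rle_trans with (3 * K0); [|apply Rmax_r].
  specialize (A (S n)); specialize (B (S n)); specialize (A' (S n)); specialize (B' (S n)).
  unfold lmom in *. rewrite (fin_plus (ladder d p (S n)) (fun _ => K0) (fun x => x ^ j)) in *; [|apply fin_ladder..].
  unfold umom, ufn. rewrite Rabs_Ropp.
  rewrite Rabs_pos_eq in B, B'; auto. apply Rabs_le. lra.
Qed.

Lemma ccf_bounded n : Rabs (ccf d p n) <= 1.
Proof.
  destruct n as [|n]; unfold ccf; simpl.
  - rewrite ind0_0, Rabs_R1; lra.
  - rewrite Rabs_Ropp. destruct g_facts as (_ & _ & B & _). apply (B (S n)).
Qed.

Lemma CV_umom j : Rbar_lt (Rabs s) (CV_radius (umom d p j)).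
Proof. destruct (umom_bounded j) as [K HK]. apply CV_bounded with K; auto. Qed.
Lemma CV_ccf : Rbar_lt (Rabs s) (CV_radius (ccf d p)).
Proof. apply CV_bounded with 1; auto. apply ccf_bounded. Qed.

Lemma mass_identity : (1 - PSeries l0 s) ^ 2 = (1 - PSeries g s) * (1 - s).
Proof.
  rewrite <- PS_umom0, <- PS_ccf.
  replace (PSeries (umom d p 0) s ^ 2) with (PSeries (umom d p 0) s * PSeries (umom d p 0) s) by ring.
  rewrite <- PSeries_mult by apply CV_umom.
  rewrite (PSeries_ext _ (PS_minus (ccf d p) (PS_incr_1 (ccf d p)))).
  - rewrite PSeries_minus, PSeries_incr_1; [ring| |].
    + apply CV_radius_inside, CV_ccf.
    + apply CV_radius_inside. rewrite CV_radius_incr_1. apply CV_ccf.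
  - intros n. rewrite mass_coeff; auto.
Qed.

Lemma second_moment_identity :
  2 * (1 - PSeries l0 s) * PSeries l2 s + 2 * PSeries l1 s ^ 2
  = (1 - PSeries g s) * s * sigma2 d p.
Proof.
  assert (E : PSeries (PS_plus (PS_minus (PS_mult (umom d p 2) (umom d p 0))
        (PS_scal 2 (PS_mult (umom d p 1) (umom d p 1)))) (PS_mult (umom d p 0) (umom d p 2))) s
     = PSeries (PS_scal (- sigma2 d p) (PS_incr_1 (ccf d p))) s).
  { apply PSeries_ext. intros n. generalize (second_moment_coeff d p Hd n).
    unfold PS_plus, PS_minus, PS_scal. cbn -[PS_mult umom sigma2 PS_incr_1].
    intros. unfold plus, minus, plus, opp, scal, mult in *; simpl in *; unfold mult in *; simpl in *. lra. }
  assert (X : forall i j, ex_pseries (PS_mult (umom d p i) (umom d p j)) s).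
  { intros. apply ex_pseries_mult; apply CV_umom. }
  rewrite PSeries_plus, PSeries_minus, !PSeries_scal, !PSeries_mult, PSeries_incr_1,
    PS_umom0, PS_umom1, PS_umom2, PS_ccf in E; auto using CV_umom.
  - simpl in E |- *. lra.
  - apply ex_pseries_scal; auto. apply Rmult_comm.
  - apply ex_pseries_minus; auto. apply ex_pseries_scal; auto. apply Rmult_comm.
Qed.

End AtS.
End Analytic.

(** * The exponential formula *)

Lemma lim_sqrt_gap : is_lim_seq (fun k => sqrt (1 - to1 k)) 0.
Proof.
  rewrite <- sqrt_0. apply is_lim_seq_continuous.
  - apply continuity_pt_sqrt; lra.
  - replace 0 with (1 - 1) by ring. apply is_lim_seq_minus'; [apply is_lim_seq_const|apply to1_lim].
Qed.

Section Formula.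
Context (d : nat) (p : vecR) (Hd : (1 <= d)%nat) (Hp : nonzeroR d p).

Notation g := (lmom d p ind0).
Notation l0 := (lmom d p (fun _ => 1)).
Notation l1 := (lmom d p (fun x => - x)).
Notation l2 := (lmom d p (fun x => x ^ 2)).
Notation an := (retn d p).

(** The right side of [mass_identity] is at most [1 - s] because [g] has nonnegative terms. *)
Lemma one_minus_l0 (s : R) : 0 <= s < 1 -> 0 <= 1 - PSeries l0 s <= sqrt (1 - s).
Proof.
  intros Hs. destruct (g_facts d p Hd) as (G0 & GE & GB & GL).
  destruct (l0_facts d p Hd) as (L0 & LE & LB & _).
  assert (As : Rabs s < 1) by (rewrite Rabs_pos_eq; lra).
  assert (P0 : 0 <= PSeries g s).
  { apply Rle_trans with (rsum 0 (fun n => g n * s ^ n)); [simpl; lra|].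
    apply Series_ge_rsum. intros n; apply Rmult_le_pos; auto; apply pow_le; lra.
    apply ex_series_pow; auto; lra. }
  assert (P1 : PSeries l0 s <= 1).
  { apply Rle_trans with (Series l0); [apply PSeries_le_Series; auto; lra|].
    apply Series_le_bound; auto. intros; apply l0_partial; auto. }
  split; [lra|]. rewrite <- (sqrt_pow2 (1 - PSeries l0 s)) by lra.
  apply sqrt_le_1_alt. rewrite (mass_identity d p Hd); auto. nra.
Qed.

(* The walk returns below [0] almost surely. *)
Lemma l0_total : Series l0 = 1.
Proof.
  destruct (l0_facts d p Hd) as (L0 & LE & LB & _). apply Rle_antisym.
  - apply Series_le_bound; auto. intros; apply l0_partial; auto.
  - assert (L : is_lim_seq (fun k => PSeries l0 (to1 k) + sqrt (1 - to1 k)) (Series l0 + 0)).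
    { apply is_lim_seq_plus'; [apply Abel_nonneg; auto|apply lim_sqrt_gap]. }
    rewrite Rplus_0_r in L.
    apply (is_lim_seq_le (fun _ => 1) _ 1 (Series l0)) with (3 := L); [|apply is_lim_seq_const].
    intros k. generalize (one_minus_l0 (to1 k) (to1_range k)). lra.
Qed.

(** As [g n <= l0 n], this gap is dominated term by term by that of [l0], which has total mass
    [1]. *)
Lemma g_gap (s : R) : 0 <= s < 1 -> 0 <= Series g - PSeries g s <= sqrt (1 - s).
Proof.
  intros Hs. destruct (g_facts d p Hd) as (G0 & GE & GB & GL).
  destruct (l0_facts d p Hd) as (L0 & LE & LB & _).
  assert (W : forall x, (forall n, 0 <= x n) -> ex_series x ->
     Series x - PSeries x s = Series (fun n => x n * (1 - s ^ n)) /\ ex_series (fun n => x n * (1 - s ^ n))).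
  { intros x Px Ex. assert (E2 : ex_series (fun n => x n * s ^ n)) by (apply ex_series_pow; auto; lra).
    split.
    - unfold PSeries. rewrite <- Series_minus; auto. apply Series_ext. intros; ring.
    - apply (ex_series_ext (fun n => x n - x n * s ^ n)); [intros; apply Rminus_diag_uniq; unfold minus, plus, opp; simpl; ring|].
      apply (ex_series_minus (V := R_NormedModule)); auto. }
  destruct (W g) as [Wg Xg]; auto. destruct (W l0) as [Wl Xl]; auto. split.
  - generalize (PSeries_le_Series g s G0 GE). lra.
  - apply Rle_trans with (1 - PSeries l0 s); [|apply one_minus_l0; auto].
    replace (1 - PSeries l0 s) with (Series l0 - PSeries l0 s) by (rewrite l0_total; ring).
    rewrite Wg, Wl. apply Series_le; auto. intros n.
    assert (0 <= s ^ n <= 1) by (apply pow_range; lra). specialize (G0 n); specialize (GL n). split; nra.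
Qed.

Lemma d_pos : 0 < INR d.
Proof. apply lt_0_INR; lia. Qed.

(* With probability at least [1/2d] the first step goes strictly below [0]. *)
Lemma one_minus_g : / (2 * INR d) <= 1 - Series g.
Proof.
  destruct (g_facts d p Hd) as (G0 & GE & GB & GL).
  destruct (l0_facts d p Hd) as (L0 & LE & LB & _).
  replace (1 - Series g) with (Series l0 - Series g) by (rewrite l0_total; ring).
  rewrite <- Series_minus; auto.
  apply Rle_trans with (l0 1%nat - g 1%nat).
  2:{ apply (Series_term_le (fun n => l0 n - g n) 1).
      - intros n. specialize (GL n). lra.
      - apply (ex_series_minus (V := R_NormedModule)); auto. }
  unfold lmom; simpl. unfold Nop. rewrite <- fin_minus; [|apply fin_mu].
  unfold mu. rewrite <- (Rmult_1_r (/ (2 * INR d))) at 1.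
  generalize d_pos; intros. apply Rmult_le_compat_l.
  - left; apply Rinv_0_lt_compat; lra.
  - destruct Hp as (i & Hi & Hne).
    set (f := fun i => _).
    assert (P : forall y, 0 <= (if Rlt_dec 0 (0 + y) then 0 else 1) - (if Rlt_dec 0 (0 + y) then 0 else ind0 (0 + y))).
    { intros y. destruct (Rlt_dec 0 (0 + y)); [lra|]. generalize (ind0_range (0 + y)); lra. }
    apply Rle_trans with (f i).
    + unfold f. assert (K : forall y, y < 0 -> (if Rlt_dec 0 (0 + y) then 0 else 1) - (if Rlt_dec 0 (0 + y) then 0 else ind0 (0 + y)) = 1).
      { intros y Hy. destruct (Rlt_dec 0 (0 + y)); [lra|]. rewrite ind0_ne; lra. }
      destruct (Rtotal_order (p i) 0) as [L|[L|L]]; [|lra|].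
      * rewrite (K (p i)); auto. generalize (P (- p i)); lra.
      * rewrite (K (- p i)); [|lra]. generalize (P (p i)); lra.
    + apply rsum_term_le; auto. intros j _. unfold f. generalize (P (p j)) (P (- p j)); lra.
Qed.

Lemma ret_range n : 0 <= ret d p n <= 1.
Proof.
  unfold ret. split; [apply pos_walk; auto; intros; apply ind0_range|].
  apply Rle_trans with (walk d p n (fun _ => 1)).
  - apply pos_le; [apply fin_walk|apply pos_walk; auto|intros; apply ind0_range].
  - right. induction n as [|n IH]; simpl; auto.
    transitivity (walk d p n (fun _ => 1)); [|exact IH]. apply fin_ext; [apply fin_walk|].
    intros x. apply (mu_const d p Hd 1).
Qed.

Lemma retn_range n : 0 <= an n <= 1.
Proof.
  unfold retn. destruct n as [|n]; [simpl; lra|].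
  change (retp d p (S n)) with (ret d p (S n)).
  generalize (ret_range (S n)); intros.
  assert (1 <= INR (S n)) by (rewrite S_INR; generalize (pos_INR n); lra).
  assert (0 < / INR (S n) <= 1).
  { split; [apply Rinv_0_lt_compat; lra|]. rewrite <- Rinv_1. apply Rinv_le_contravar; lra. }
  unfold Rdiv. nra.
Qed.

Lemma CV_an (s : R) : Rabs s < 1 -> Rbar_lt (Rabs s) (CV_radius an).
Proof.
  intros Hs. apply CV_bounded with 1; auto. intros n. generalize (retn_range n); intros.
  rewrite Rabs_pos_eq; lra.
Qed.

Lemma derive_ccf n : PS_derive (ccf d p) n = - PS_mult (ccf d p) (PS_derive an) n.
Proof.
  unfold PS_derive at 1. rewrite ret_coeff; auto. f_equal. unfold PS_mult.
  rewrite !sum_rsum. cbn [rsum]. rewrite Nat.sub_diag. simpl (retp d p 0).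
  rewrite Rmult_0_r, Rplus_0_r. f_equal.
  - apply rsum_ext. intros k Hk. f_equal. unfold PS_derive, retn.
    replace (S n - k)%nat with (S (n - k)) by lia. field. apply not_0_INR; lia.
  - f_equal. unfold PS_derive, retn. replace (S n - n)%nat with (S (n - n)) by lia.
    field. apply not_0_INR; lia.
Qed.

(** Solves the linear equation [c' = - c a']: the product [c exp(a)] has zero derivative and equals
    [1] at [0]. *)
Lemma exp_formula (s : R) : 0 <= s < 1 -> 1 - PSeries g s = exp (- PSeries an s).
Proof.
  intros Hs. rewrite <- (PS_ccf d p Hd s) by (rewrite Rabs_pos_eq; lra).
  set (E := fun s => PSeries (ccf d p) s * exp (PSeries an s)).
  assert (D : forall t, 0 <= t <= s -> is_derive E t 0).
  { intros t Ht. assert (At : Rabs t < 1) by (rewrite Rabs_pos_eq; lra).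
    assert (D1 := is_derive_PSeries (ccf d p) t (CV_ccf d p Hd t At)).
    assert (D2 := is_derive_PSeries an t (CV_an t At)).
    assert (Q : PSeries (PS_derive (ccf d p)) t = - (PSeries (ccf d p) t * PSeries (PS_derive an) t)).
    { rewrite <- PSeries_mult; [|apply CV_ccf; auto|rewrite CV_radius_derive; apply CV_an; auto].
      apply PSeries_ext_opp. apply derive_ccf. }
    rewrite Q in D1. unfold E.
    evar_last.
    - apply (is_derive_mult (PSeries (ccf d p)) (fun s => exp (PSeries an s)) t); [exact D1| |intros; apply Rmult_comm].
      apply (is_derive_comp exp (PSeries an)); [apply is_derive_exp|exact D2].
    - unfold plus, mult, scal; simpl. unfold mult; simpl. ring. }
  assert (C : E 0 = E s).
  { destruct (Req_dec s 0) as [->|Hne]; [reflexivity|]. apply eq_is_derive; [exact D|lra]. }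
  unfold E in C. rewrite !PSeries_0 in C.
  assert (C0 : ccf d p 0 = 1) by (unfold ccf; simpl; apply ind0_0).
  assert (A0 : an O = 0) by (unfold retn; simpl; lra).
  rewrite C0, A0, exp_0, Rmult_1_l in C.
  rewrite exp_Ropp, <- (Rmult_1_l (/ exp _)), C. field. generalize (exp_pos (PSeries an s)); lra.
Qed.

(** [c(s) >= c(1) >= 1/2d]. Being uniform in [s], the bound makes [A(p)] finite. *)
Lemma PS_an_le (s : R) : 0 <= s < 1 -> PSeries an s <= ln (2 * INR d).
Proof.
  intros Hs. assert (K := exp_formula s Hs). generalize one_minus_g (g_gap s Hs) d_pos; intros A B C.
  assert (L : ln (/ (2 * INR d)) <= ln (exp (- PSeries an s))).
  { apply ln_le; [apply Rinv_0_lt_compat; lra|]. lra. }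
  rewrite ln_exp, ln_Rinv in L; lra.
Qed.

Lemma an_partial n : rsum n an <= ln (2 * INR d).
Proof.
  apply (is_lim_seq_le (fun k => rsum n (fun i => an i * to1 k ^ i)) (fun _ => ln (2 * INR d))
     (rsum n an) (ln (2 * INR d))); [|apply lim_rsum_pow|apply is_lim_seq_const].
  intros k. generalize (to1_range k); intros B.
  apply Rle_trans with (PSeries an (to1 k)); [|apply PS_an_le; auto].
  destruct n as [|n].
  - apply (Series_ge_rsum (fun i => an i * to1 k ^ i) 0).
    + intros i. apply Rmult_le_pos; [apply retn_range|apply pow_le; lra].
    + apply ex_pseries_R, CV_radius_inside, CV_an. rewrite Rabs_pos_eq; lra.
  - apply (Series_ge_rsum (fun i => an i * to1 k ^ i)).
    + intros i. apply Rmult_le_pos; [apply retn_range|apply pow_le; lra].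
    + apply ex_pseries_R, CV_radius_inside, CV_an. rewrite Rabs_pos_eq; lra.
Qed.

Lemma ex_an : ex_series an.
Proof. apply ex_series_bounded with (ln (2 * INR d)); [apply retn_range|apply an_partial]. Qed.

Definition Aexp : R := Series an.

Lemma one_minus_g_exp : 1 - Series g = exp (- Aexp).
Proof.
  destruct (g_facts d p Hd) as (G0 & GE & GB & GL).
  assert (L1 : is_lim_seq (fun k => 1 - PSeries g (to1 k)) (1 - Series g)).
  { apply is_lim_seq_minus'; [apply is_lim_seq_const|apply Abel_nonneg; auto]. }
  assert (L2 : is_lim_seq (fun k => exp (- PSeries an (to1 k))) (exp (- Aexp))).
  { apply (is_lim_seq_continuous exp (fun k => - PSeries an (to1 k))).
    - apply derivable_continuous_pt, derivable_pt_exp.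
    - apply (is_lim_seq_opp (fun k => PSeries an (to1 k)) Aexp).
      apply Abel_nonneg; [apply retn_range|apply ex_an]. }
  apply (is_lim_seq_ext _ (fun k => exp (- PSeries an (to1 k)))) in L1.
  - apply is_lim_seq_unique in L1, L2. rewrite L1 in L2. injection L2; auto.
  - intros k. apply exp_formula, to1_range.
Qed.

(** For [D = A - a(s)] one has [exp(D) c(1) = c(s)], so [exp(D) >= 1 + D] gives
    [D c(1) <= c(s) - c(1) <= sqrt (1 - s)]; then divide by [c(1) >= 1/2d]. *)
Lemma Aexp_gap (s : R) : 0 <= s < 1 -> Aexp - PSeries an s <= 2 * INR d * sqrt (1 - s).
Proof.
  intros Hs. generalize one_minus_g (g_gap s Hs) d_pos; intros A B C.
  assert (E1 := one_minus_g_exp). assert (E2 := exp_formula s Hs).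
  assert (E3 : exp (Aexp - PSeries an s) * (1 - Series g) = 1 - PSeries g s).
  { rewrite E1, E2, <- exp_plus. f_equal. ring. }
  assert (E4 := exp_ineq1_le (Aexp - PSeries an s)).
  set (D := Aexp - PSeries an s) in *. set (c := 1 - Series g) in *.
  assert (E5 : D * c <= sqrt (1 - s)).
  { assert (0 <= c) by (apply Rle_trans with (/ (2 * INR d)); [left; apply Rinv_0_lt_compat; lra|auto]).
    assert (1 - PSeries g s - c <= sqrt (1 - s)) by (unfold c; lra). nra. }
  destruct (Rle_dec D 0) as [L|L]; [generalize (sqrt_pos (1 - s)); nra|].
  assert (D * / (2 * INR d) <= sqrt (1 - s)) by nra.
  apply (Rmult_le_compat_r (2 * INR d)) in H; [|lra].
  rewrite Rmult_assoc, Rinv_l in H; lra.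
Qed.

(** Take [s = 1 - 1/(N+1)]. For [n > N] one has [s^n <= 1/2], so the tail is at most twice
    [A - a(s)]; hence [4d = 2 . 2d]. *)
Lemma an_tail N : Aexp - rsum (S N) an <= 4 * INR d * sqrt (/ INR (S N)).
Proof.
  set (s := 1 - / INR (S N)).
  assert (Hs : 0 <= s < 1).
  { unfold s. assert (1 <= INR (S N)) by (rewrite S_INR; generalize (pos_INR N); lra).
    assert (0 < / INR (S N)) by (apply Rinv_0_lt_compat; lra).
    assert (/ INR (S N) <= 1) by (rewrite <- Rinv_1; apply Rinv_le_contravar; lra). lra. }
  assert (K := Aexp_gap s Hs). replace (1 - s) with (/ INR (S N)) in K by (unfold s; ring).
  assert (E2 : ex_series (fun n => an n * s ^ n)) by (apply ex_series_pow; [apply retn_range|apply ex_an|lra]).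
  assert (E3 : ex_series (fun n => an n - an n * s ^ n)) by (apply (ex_series_minus (V := R_NormedModule)); [apply ex_an|auto]).
  assert (Q : Aexp - rsum (S N) an <= 2 * Series (fun n => an n - an n * s ^ n)); [|rewrite Series_minus in Q; [unfold PSeries, Aexp in *; lra|apply ex_an|auto]].
  apply Rplus_le_reg_r with (rsum (S N) an).
  replace (Aexp - rsum (S N) an + rsum (S N) an) with Aexp by ring.
  apply Series_le_bound; [apply ex_an|]. intros M.
  assert (P : forall n, 0 <= an n - an n * s ^ n).
  { intros n. generalize (retn_range n) (pow_range s n); intros. assert (0 <= s ^ n <= 1) by (apply pow_range; lra). nra. }
  apply Rle_trans with (2 * rsum (Nat.max M (S N)) (fun n => an n - an n * s ^ n) + rsum (S N) an).
  2:{ apply Rplus_le_compat_r, Rmult_le_compat_l; [lra|]. apply Series_ge_rsum; auto. }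
  apply Rle_trans with (rsum (Nat.max M (S N)) an); [apply rsum_mono; [apply retn_range|lia]|].
  generalize (Nat.max M (S N)) (Nat.le_max_r M (S N)). clear -Hs P Hd Hp.
  intros m Hm. induction Hm as [|m Hm IH].
  - assert (0 <= rsum (S N) (fun n => an n - an n * s ^ n)) by (apply rsum_nonneg; auto). lra.
  - cbn [rsum] in *. assert (s ^ m <= / 2) by (apply one_minus_inv_pow; lia).
    generalize (retn_range m); intros. nra.
Qed.

(** As [s] tends to [1], the factor [1 - E s^T] kills the second moment and leaves the square of the
    mean. *)
Lemma ladder_mean_sqr : Series l1 ^ 2 = exp (- Aexp) * sigma2 d p / 2.
Proof.
  destruct (g_facts d p Hd) as (G0 & GE & GB & GL).
  destruct (l1_facts d p Hd) as (L10 & L1E & L1B & _).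
  destruct (l2_facts d p Hd) as (L20 & L2E & L2B & _).
  destruct (l0_facts d p Hd) as (L0 & LE & LB & _).
  assert (A : is_lim_seq (fun k => 2 * (1 - PSeries l0 (to1 k)) * PSeries l2 (to1 k) + 2 * (PSeries l1 (to1 k) * PSeries l1 (to1 k)))
     (2 * (1 - Series l0) * Series l2 + 2 * (Series l1 * Series l1))).
  { apply is_lim_seq_plus'; repeat apply is_lim_seq_mult'; try apply is_lim_seq_const; try apply Abel_nonneg; auto.
    apply is_lim_seq_minus'; [apply is_lim_seq_const|apply Abel_nonneg; auto]. }
  assert (B : is_lim_seq (fun k => (1 - PSeries g (to1 k)) * to1 k * sigma2 d p) ((1 - Series g) * 1 * sigma2 d p)).
  { repeat apply is_lim_seq_mult'; try apply is_lim_seq_const; [|apply to1_lim].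
    apply is_lim_seq_minus'; [apply is_lim_seq_const|apply Abel_nonneg; auto]. }
  apply (is_lim_seq_ext _ (fun k => (1 - PSeries g (to1 k)) * to1 k * sigma2 d p)) in A.
  - apply is_lim_seq_unique in A, B. rewrite A in B. injection B; clear A B; intros E.
    rewrite l0_total in E. rewrite <- one_minus_g_exp. lra.
  - intros k. generalize (to1_range k); intros. rewrite <- second_moment_identity; auto; [ring|].
    rewrite Rabs_pos_eq; lra.
Qed.

End Formula.

(** * The harmonic function of the half-space *)

Lemma dot_shift (d : nat) (p : vecR) (x : vecZ) (i : nat) (s : Z) :
  (i < d)%nat -> dotRZ d p (shift x i s) = dotRZ d p x + p i * IZR s.
Proof.
  intros Hi. unfold dotRZ. apply Rminus_diag_uniq.
  replace (rsum d (fun j => p j * IZR (shift x i s j)) - (rsum d (fun j => p j * IZR (x j)) + p i * IZR s))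
    with (rsum d (fun j => p j * IZR (shift x i s j) - p j * IZR (x j)) - p i * IZR s)
    by (rewrite rsum_minus; ring).
  rewrite (rsum_single d i); auto.
  - unfold shift. rewrite Nat.eqb_refl, plus_IZR. ring.
  - intros j Hj Hne. unfold shift. destruct (Nat.eqb_spec j i); [lia|ring].
Qed.

Lemma supported_shift d x i s : (i < d)%nat -> supported d x -> supported d (shift x i s).
Proof.
  intros Hi Sx j Hj. unfold shift. destruct (Nat.eqb_spec j i); [lia|auto].
Qed.

Lemma supported_zero d : supported d zeroZ.
Proof. intros i _; reflexivity. Qed.

Lemma dot_zero d p : dotRZ d p zeroZ = 0.
Proof. apply rsum_zero. intros; unfold zeroZ; simpl; ring. Qed.

Lemma is_lim_seq_rsum_fun (m : nat) (F : nat -> nat -> R) (f : nat -> R) :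
  (forall i, (i < m)%nat -> is_lim_seq (fun n => F n i) (f i)) ->
  is_lim_seq (fun n => rsum m (F n)) (rsum m f).
Proof.
  intros E. induction m as [|m IH]; simpl; [apply is_lim_seq_const|].
  apply is_lim_seq_plus'; auto.
Qed.

Section Half.
Context (d : nat) (p : vecR) (Hd : (1 <= d)%nat) (Hp : nonzeroR d p).
Notation Rb := (step_bound d p).

Lemma mu_le f h : (forall y, Rabs y <= Rb -> f y <= h y) -> mu d p f <= mu d p h.
Proof.
  intros E. unfold mu. apply Rmult_le_compat_l.
  - left; apply Rinv_0_lt_compat. generalize (d_pos d Hd); lra.
  - apply rsum_le. intros i Hi. apply Rplus_le_compat; apply E; [|rewrite Rabs_Ropp]; apply step_le; auto.
Qed.

Lemma lim_mu (F : nat -> R -> R) (f : R -> R) :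
  (forall y, is_lim_seq (fun n => F n y) (f y)) -> is_lim_seq (fun n => mu d p (F n)) (mu d p f).
Proof.
  intros E. unfold mu. apply is_lim_seq_mult'; [apply is_lim_seq_const|].
  apply (is_lim_seq_rsum_fun d (fun n i => F n (p i) + F n (- p i))). intros i _. apply is_lim_seq_plus'; auto.
Qed.

(** [E_x (Y_n; n < T)] for the walk started at [x]. It increases in [n], since exits discard
    nonpositive values; for [x >= 0] it stays below [x + Rb], and its limit is [x - E_x Y_T]. *)
Definition hit (n : nat) : R -> R := Nat.iter n (Bop d p) (fun x => x).

Lemma stay_iter n f : stay d p n f = Nat.iter n (Bop d p) f 0.
Proof.
  revert f. induction n as [|n IH]; intros f; [reflexivity|].
  rewrite Nat.iter_succ_r. simpl. apply IH.
Qed.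

Lemma Bop_le f h x : (forall y, 0 < y -> f y <= h y) -> Bop d p f x <= Bop d p h x.
Proof. intros E. apply mu_le. intros y _. destruct (Rlt_dec 0 (x + y)); [auto|lra]. Qed.

Lemma mu_affine (x c : R) : mu d p (fun y => x + y + c) = x + c.
Proof.
  transitivity (mu d p (fun y => (x + c) + y)); [apply fin_ext; [apply fin_mu|intros; ring]|].
  rewrite (fin_plus (mu d p) (fun _ => x + c) (fun y => y)); [|apply fin_mu].
  rewrite (mu_const d p Hd), mu_id. ring.
Qed.

Lemma hit_incr n x : hit n x <= hit (S n) x.
Proof.
  revert x. induction n as [|n IH]; intros x.
  - simpl. rewrite <- (Rplus_0_r x) at 1. rewrite <- mu_affine. apply mu_le.
    intros y _. destruct (Rlt_dec 0 (x + y)); lra.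
  - apply Bop_le. auto.
Qed.

Lemma hit_le n x : 0 <= x -> hit n x <= x + Rb.
Proof.
  generalize (step_bound_nonneg d p). intros HR.
  revert x. induction n as [|n IH]; intros x Hx; [simpl; lra|].
  simpl. rewrite <- mu_affine. apply mu_le. intros y Hy. apply Rabs_le_between in Hy.
  destruct (Rlt_dec 0 (x + y)); [apply IH; lra|lra].
Qed.

Lemma hit_ge n x : x <= hit n x.
Proof. induction n as [|n IH]; [simpl; lra|]. generalize (hit_incr n x); lra. Qed.

Definition hitlim (x : R) : R := real (Lim_seq (fun n => hit n x)).

Lemma hit_lim x : 0 <= x -> is_lim_seq (fun n => hit n x) (hitlim x).
Proof.
  intros Hx. destruct (ex_finite_lim_seq_incr (fun n => hit n x) (x + Rb)) as [l Hl].
  - intros; apply hit_incr.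
  - intros; apply hit_le; auto.
  - unfold hitlim. rewrite (is_lim_seq_unique _ _ Hl). exact Hl.
Qed.

(** At [x = 0] the cut-off matters: [hitlim 0] is the mean overshoot while the solution vanishes,
    and the difference, times [2d], is the Laplacian at the origin. *)
Definition fsol (x : R) : R := if Rlt_dec 0 x then hitlim x else 0.

(** Pass to the limit in the recursion [hit (S n) = Bop (hit n)]. *)
Lemma mu_fsol x : 0 <= x -> mu d p (fun y => fsol (x + y)) = hitlim x.
Proof.
  intros Hx. assert (L : is_lim_seq (fun n => hit (S n) x) (mu d p (fun y => fsol (x + y)))).
  { apply (lim_mu (fun n y => if Rlt_dec 0 (x + y) then hit n (x + y) else 0)).
    intros y. unfold fsol. destruct (Rlt_dec 0 (x + y)); [apply hit_lim; lra|apply is_lim_seq_const]. }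
  assert (L2 := hit_lim x Hx). apply is_lim_seq_incr_1 in L2.
  apply is_lim_seq_unique in L, L2. rewrite L in L2. injection L2; auto.
Qed.

Lemma fsol_bounds x : 0 < x -> x <= fsol x <= x + Rb.
Proof.
  intros Hx. unfold fsol. destruct (Rlt_dec 0 x); [|lra].
  assert (L := hit_lim x (Rlt_le _ _ Hx)). split.
  - apply (is_lim_seq_le (fun _ => x) (fun n => hit n x) x (hitlim x)); auto.
    intros; apply hit_ge. apply is_lim_seq_const.
  - apply (is_lim_seq_le (fun n => hit n x) (fun _ => x + Rb) (hitlim x) (x + Rb)); auto.
    intros; apply hit_le; lra. apply is_lim_seq_const.
Qed.

Lemma hitlim_0 : hitlim 0 = Series (lmom d p (fun x => - x)).
Proof.
  assert (L := hit_lim 0 (Rle_refl 0)).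
  destruct (l1_facts d p Hd) as (_ & E & _).
  assert (L2 := is_lim_seq_rsum _ E).
  apply (is_lim_seq_ext _ (fun n => hit n 0)) in L2.
  - apply is_lim_seq_unique in L, L2. rewrite L in L2. injection L2; auto.
  - intros n. rewrite <- stay_l1; auto. apply stay_iter.
Qed.

Definition usol (x : vecZ) : R := fsol (dotRZ d p x).

Lemma lap_usol x : lap d usol x = 2 * INR d * (mu d p (fun y => fsol (dotRZ d p x + y)) - fsol (dotRZ d p x)).
Proof.
  unfold lap, mu. rewrite rsum_minus, rsum_const.
  rewrite (rsum_ext d (fun i => usol (shift x i 1) + usol (shift x i (-1)))
     (fun i => fsol (dotRZ d p x + p i) + fsol (dotRZ d p x + - p i))).
  - unfold usol. generalize (d_pos d Hd); intros. field. lra.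
  - intros i Hi. unfold usol. rewrite !dot_shift; auto. f_equal; f_equal; lra.
Qed.

Lemma is_up_usol : is_up d p usol.
Proof.
  split; [|split].
  - intros x Sx Px. rewrite lap_usol, mu_fsol by lra. unfold fsol.
    destruct (Rlt_dec 0 (dotRZ d p x)); [ring|lra].
  - intros x Sx Px. unfold usol, fsol. destruct (Rlt_dec 0 (dotRZ d p x)); [lra|auto].
  - exists Rb. intros x Sx Px. unfold usol. generalize (fsol_bounds _ Px).
    intros. rewrite Rabs_pos_eq; lra.
Qed.

Lemma lap_usol_0 : lap d usol zeroZ = 2 * INR d * Series (lmom d p (fun x => - x)).
Proof.
  rewrite lap_usol, dot_zero, mu_fsol, hitlim_0 by lra. unfold fsol.
  destruct (Rlt_dec 0 0); [lra|ring].
Qed.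

(** * Uniqueness of the half-space solution *)

Lemma lap_ext u v x : supported d x -> (forall y, supported d y -> u y = v y) -> lap d u x = lap d v x.
Proof.
  intros Sx E. apply rsum_ext. intros i Hi. rewrite !E; auto using supported_shift.
Qed.

Lemma lap_lin u v c x : lap d (fun y => u y - c * v y) x = lap d u x - c * lap d v x.
Proof.
  unfold lap. rewrite <- rsum_scal, <- rsum_minus. apply rsum_ext. intros; ring.
Qed.

(* From any point of a strip of width [k |p_i|], [k] steps in direction [i] leave it; so the
   maximum of [v] contracts by the factor [1 - (2d)^-k]. *)
Lemma strip_contraction (v : vecZ -> R) (L : R) :
  (forall x, supported d x -> dotRZ d p x > 0 -> lap d v x = 0) ->
  (forall x, supported d x -> dotRZ d p x <= 0 -> v x = 0) ->
  (forall x, supported d x -> dotRZ d p x > L -> v x <= 0) ->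
  exists t, 0 <= t < 1 /\ forall A, 0 <= A -> (forall x, supported d x -> v x <= A) ->
    forall x, supported d x -> v x <= t * A.
Proof.
  intros Hh Hz HL. destruct Hp as (i & Hi & Hne).
  assert (Ap : 0 < Rabs (p i)) by (apply Rabs_pos_lt; auto).
  destruct (INR_unbounded (L / Rabs (p i))) as [k Hk].
  assert (HkL : L <= INR k * Rabs (p i)).
  { apply Rmult_gt_compat_r with (r := Rabs (p i)) in Hk; auto.
    unfold Rdiv in Hk. rewrite Rmult_assoc, Rinv_l in Hk; lra. }
  set (b := / (2 * INR d)).
  assert (D1 : 1 <= INR d) by (apply (le_INR 1); auto).
  assert (Hb : 0 < b <= / 2).
  { unfold b. split; [apply Rinv_0_lt_compat; lra|apply Rinv_le_contravar; lra]. }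
  assert (Db : 2 * INR d * b = 1) by (unfold b; field; lra).
  assert (Pb : forall j, 0 < b ^ j <= 1).
  { intros j. split; [apply pow_lt; lra|]. apply pow_range; lra. }
  exists (1 - b ^ k). split; [generalize (Pb k); lra|].
  intros A HA HvA.
  assert (Key : forall j x, supported d x -> dotRZ d p x <= INR j * Rabs (p i) -> v x <= (1 - b ^ j) * A).
  { induction j as [|j IH]; intros x Sx Hx.
    - simpl in Hx. rewrite Hz; auto; [simpl; lra|lra].
    - destruct (Rle_dec (dotRZ d p x) 0) as [N|P].
      { rewrite Hz; auto. generalize (Pb (S j)); intros; nra. }
      apply Rnot_le_gt in P. specialize (Hh x Sx P). unfold lap in Hh.
      rewrite rsum_minus, rsum_const in Hh.
      set (F := fun i => v (shift x i 1) + v (shift x i (-1))) in *.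
      assert (F1 : F i <= A + (1 - b ^ j) * A).
      { unfold F. rewrite S_INR in Hx.
        destruct (Rtotal_order (p i) 0) as [G|[G|G]]; [|lra|].
        - assert (v (shift x i 1) <= (1 - b ^ j) * A).
          { apply IH; [apply supported_shift; auto|]. rewrite dot_shift; auto.
            rewrite (Rabs_left (p i)) in *; auto. lra. }
          assert (v (shift x i (-1)) <= A) by (apply HvA, supported_shift; auto). lra.
        - assert (v (shift x i (-1)) <= (1 - b ^ j) * A).
          { apply IH; [apply supported_shift; auto|]. rewrite dot_shift; auto.
            rewrite (Rabs_right (p i)) in *; lra. }
          assert (v (shift x i 1) <= A) by (apply HvA, supported_shift; auto). lra. }
      assert (F2 : 2 * A - F i <= rsum d (fun m => 2 * A - F m)).
      { apply (rsum_term_le d (fun m => 2 * A - F m)); auto. intros m Hm. unfold F.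
        assert (v (shift x m 1) <= A) by (apply HvA, supported_shift; auto).
        assert (v (shift x m (-1)) <= A) by (apply HvA, supported_shift; auto). lra. }
      rewrite rsum_minus, rsum_const in F2. simpl (b ^ S j).
      assert (G : 2 * INR d * v x <= 2 * INR d * A - b ^ j * A) by lra.
      apply (Rmult_le_compat_l b) in G; [|lra].
      replace (b * (2 * INR d * v x)) with (2 * INR d * b * v x) in G by ring.
      replace (b * (2 * INR d * A - b ^ j * A)) with (2 * INR d * b * A - b * b ^ j * A) in G by ring.
      rewrite Db in G. lra. }
  intros x Sx. destruct (Rle_dec (dotRZ d p x) (INR k * Rabs (p i))) as [Y|Y]; [apply Key; auto|].
  assert (v x <= 0) by (apply HL; auto; lra). generalize (Pb k); intros; nra.
Qed.

Lemma strip_max_principle (v : vecZ -> R) (L A : R) :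
  (forall x, supported d x -> dotRZ d p x > 0 -> lap d v x = 0) ->
  (forall x, supported d x -> dotRZ d p x <= 0 -> v x = 0) ->
  (forall x, supported d x -> dotRZ d p x > L -> v x <= 0) ->
  (forall x, supported d x -> v x <= A) -> 0 <= A ->
  forall x, supported d x -> v x <= 0.
Proof.
  intros Hh Hz HL HA A0 x Sx. destruct (strip_contraction v L Hh Hz HL) as (t & Ht & Hc).
  assert (E : forall m y, supported d y -> v y <= t ^ m * A).
  { induction m as [|m IH]; intros y Sy; simpl; [rewrite Rmult_1_l; auto|].
    rewrite Rmult_assoc. apply Hc; auto. apply Rmult_le_pos; auto. apply pow_le; lra. }
  assert (Lm : is_lim_seq (fun m => t ^ m * A) 0).
  { replace 0 with (0 * A) by ring. apply is_lim_seq_mult'; [|apply is_lim_seq_const].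
    apply is_lim_seq_geom. rewrite Rabs_pos_eq; lra. }
  apply (is_lim_seq_le (fun _ => v x) (fun m => t ^ m * A) (v x) 0); auto. apply is_lim_seq_const.
Qed.

(** [u - u'] is only known to be bounded far from the boundary. Subtracting [eps usol], which grows
    linearly, makes it nonpositive beyond a strip of width [K / eps], where the maximum principle
    applies; then [eps] is made small. *)
Lemma is_up_le u u' : is_up d p u -> is_up d p u' -> forall x, supported d x -> u x <= u' x.
Proof.
  intros (Hh & Hz & M & HM) (Hh' & Hz' & M' & HM') x Sx.
  destruct is_up_usol as (Hs & Hs0 & _).
  assert (S0 := step_bound_nonneg d p).
  set (K := Rabs M + Rabs M').
  assert (K0 : 0 <= K) by (unfold K; generalize (Rabs_pos M) (Rabs_pos M'); lra).
  assert (Bw : forall y, supported d y -> u y - u' y <= K).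
  { intros y Sy. destruct (Rle_dec (dotRZ d p y) 0) as [N|P].
    - rewrite Hz, Hz'; auto. lra.
    - apply Rnot_le_gt in P. specialize (HM y Sy P). specialize (HM' y Sy P).
      apply Rabs_le_between in HM, HM'. unfold K.
      generalize (Rle_abs M) (Rle_abs M'). lra. }
  assert (Bu : forall y, supported d y -> 0 <= usol y).
  { intros y Sy. unfold usol. destruct (Rlt_dec 0 (dotRZ d p y)) as [P|N].
    - generalize (fsol_bounds _ P). lra.
    - unfold fsol. destruct (Rlt_dec 0 (dotRZ d p y)); lra. }
  assert (Q : forall eps, 0 < eps -> u x - u' x <= eps * usol x).
  { intros eps He. set (v := fun y => (u y - 1 * u' y) - eps * usol y).
    assert (v x <= 0); [|unfold v in *; lra].
    apply (strip_max_principle v (K / eps) K); auto.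
    - intros y Sy Py. unfold v. rewrite (lap_lin (fun y => u y - 1 * u' y)), lap_lin, Hh, Hh', Hs; auto. ring.
    - intros y Sy Py. unfold v. rewrite Hz, Hz', Hs0; auto. ring.
    - intros y Sy Py. unfold v. specialize (Bw y Sy).
      assert (P0 : 0 < dotRZ d p y).
      { apply Rle_lt_trans with (K / eps); auto. apply Rmult_le_pos; auto. left; apply Rinv_0_lt_compat; auto. }
      generalize (fsol_bounds _ P0). fold (usol y). intros.
      assert (K <= eps * dotRZ d p y).
      { replace K with (eps * (K / eps)) by (field; lra). apply Rmult_le_compat_l; lra. }
      nra.
    - intros y Sy. unfold v. specialize (Bw y Sy). specialize (Bu y Sy). nra. }
  apply Rnot_lt_le. intros C. specialize (Bu x Sx).
  assert (0 < / (usol x + 1)) by (apply Rinv_0_lt_compat; lra).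
  specialize (Q ((u x - u' x) / 2 * / (usol x + 1))).
  assert (P : 0 < (u x - u' x) / 2 * / (usol x + 1)) by (apply Rmult_lt_0_compat; lra).
  specialize (Q P).
  assert (/ (usol x + 1) * usol x <= 1).
  { apply Rmult_le_reg_l with (usol x + 1); [lra|]. rewrite <- Rmult_assoc, Rinv_r; lra. }
  rewrite Rmult_assoc in Q. nra.
Qed.

Lemma H_mean : H d p = 2 * INR d * Series (lmom d p (fun x => - x)).
Proof.
  rewrite <- lap_usol_0.
  destruct (epsilon_spec (inhabits 0) (fun h => exists u, is_up d p u /\ lap d u zeroZ = h)) as (u & Hu & E).
  - exists (lap d usol zeroZ), usol. split; [apply is_up_usol|reflexivity].
  (* Uniqueness identifies the chosen solution with [usol] on supported points, the only ones seen
     by the Laplacian at [0]. *)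
  - unfold H. rewrite <- E. apply lap_ext; [apply supported_zero|]. intros y Sy.
    apply Rle_antisym; apply is_up_le; auto using is_up_usol.
Qed.

Theorem H_formula : H d p = sqrt (2 * INR d * rsum d (fun i => p i ^ 2)) * exp (- Aexp d p / 2).
Proof.
  destruct (l1_facts d p Hd) as (L0 & LE & _).
  assert (P : 0 <= Series (lmom d p (fun x => - x))).
  { apply Rle_trans with (rsum 0 (lmom d p (fun x => - x))); [simpl; lra|apply Series_ge_rsum; auto]. }
  generalize (d_pos d Hd); intros Dp.
  rewrite H_mean. rewrite <- (sqrt_pow2 (2 * INR d * Series _)) by (apply Rmult_le_pos; lra).
  rewrite <- (sqrt_pow2 (exp (- Aexp d p / 2))) by (left; apply exp_pos).
  rewrite <- sqrt_mult.
  (* [sigma2] is [|p|^2 / d], so [(2d)^2 sigma2 / 2 = 2d |p|^2]. *)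
  - f_equal. rewrite Rpow_mult_distr, (ladder_mean_sqr d p Hd Hp). unfold sigma2. rewrite mu_sqr; auto.
    replace (exp (- Aexp d p / 2) ^ 2) with (exp (- Aexp d p)); [field; lra|].
    simpl. rewrite Rmult_1_r, <- exp_plus. f_equal. field.
  - apply Rmult_le_pos; [lra|]. apply rsum_nonneg. intros; apply pow2_ge_0.
  - apply pow2_ge_0.
Qed.

End Half.

(** * Dependence on the direction *)

Lemma pos_le_on {X} (D : X -> Prop) (A : (X -> R) -> R) f g :
  fin A -> posf A -> on D A -> (forall x, D x -> f x <= g x) -> A f <= A g.
Proof.
  intros F P O E.
  rewrite (O f (fun x => if excluded_middle_informative (D x) then f x else g x)).
  - apply pos_le; auto. intros x. destruct (excluded_middle_informative (D x)); [auto|lra].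
  - intros x Dx. destruct (excluded_middle_informative (D x)); tauto.
Qed.

Lemma fin_on {X} (A : (X -> R) -> R) : fin A -> exists S : list X, on (fun x => In x S) A.
Proof.
  intros [l Hl]. exists (map snd l). intros f g E. rewrite !Hl. f_equal.
  apply map_ext_in. intros a Ha. rewrite E; auto. apply in_map; auto.
Qed.

(** * The lattice walk and the points it reaches *)

Definition stepZ (d : nat) (F : vecZ -> R) (x : vecZ) : R :=
  / (2 * INR d) * rsum d (fun i => F (shift x i 1) + F (shift x i (-1))).

(** [E F(X_n)]. The law is independent of the direction, so return probabilities for [p] and [q]
    become integrals of two indicators against one measure. *)
Fixpoint Ez (d n : nat) (F : vecZ -> R) : R :=
  match n with O => F zeroZ | S n => Ez d n (stepZ d F) end.

Definition isx (x0 x : vecZ) : R := if excluded_middle_informative (x = x0) then 1 else 0.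

Lemma isx_eq x : isx x x = 1.
Proof. unfold isx. destruct (excluded_middle_informative (x = x)); tauto. Qed.

Lemma isx_range x y : 0 <= isx x y <= 1.
Proof. unfold isx. destruct (excluded_middle_informative (y = x)); lra. Qed.

Section Ez.
Context (d : nat) (Hd : (1 <= d)%nat).

Lemma fin_Ez n : fin (Ez d n).
Proof.
  induction n as [|n IH]; [apply fin_pt|]. simpl.
  apply (fin_bind _ (fun x F => stepZ d F x) IH). intros x. unfold stepZ. apply fin_mult.
  apply (fin_sum d (fun i F => F (shift x i 1) + F (shift x i (-1)))). intros i.
  apply fin_add; apply fin_pt.
Qed.

Lemma posf_Ez n : posf (Ez d n).
Proof.
  induction n as [|n IH]; intros F HF; simpl; [auto|]. apply IH. intros x. unfold stepZ.
  apply Rmult_le_pos.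
  - left; apply Rinv_0_lt_compat. generalize (d_pos d Hd); lra.
  - apply rsum_nonneg. intros i _. apply Rplus_le_le_0_compat; auto.
Qed.

Lemma on_Ez n : on (supported d) (Ez d n).
Proof.
  induction n as [|n IH]; intros F G E; simpl; [apply E, supported_zero|].
  apply IH. intros x Sx. unfold stepZ. f_equal. apply rsum_ext. intros i Hi.
  rewrite !E; auto using supported_shift.
Qed.

Lemma walk_Ez p n f : walk d p n f = Ez d n (fun x => f (dotRZ d p x)).
Proof.
  revert f. induction n as [|n IH]; intros f; simpl; [rewrite dot_zero; auto|].
  rewrite IH. apply on_Ez. intros x Sx. unfold Pop, stepZ, mu. f_equal. apply rsum_ext.
  intros i Hi. rewrite !dot_shift; auto. f_equal; f_equal; lra.
Qed.

Lemma ret_Ez p n : ret d p n = Ez d n (fun x => ind0 (dotRZ d p x)).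
Proof. apply walk_Ez. Qed.

Definition reach (x : vecZ) : Prop := exists n, 0 < Ez d n (isx x).

Lemma reach_step x i s : (i < d)%nat -> s = 1%Z \/ s = (-1)%Z -> reach x -> reach (shift x i s).
Proof.
  intros Hi Hs [n Hn]. exists (S n). simpl. generalize (d_pos d Hd); intros Dp.
  assert (B : 0 < / (2 * INR d)) by (apply Rinv_0_lt_compat; lra).
  apply Rlt_le_trans with (Ez d n (fun y => / (2 * INR d) * isx x y)).
  - rewrite fin_scal; [|apply fin_Ez]. apply Rmult_lt_0_compat; auto.
  - apply pos_le; [apply fin_Ez|apply posf_Ez|]. intros y. unfold stepZ.
    apply Rmult_le_compat_l; [lra|].
    set (f := fun j => _). assert (P : forall j, (j < d)%nat -> 0 <= f j).
    { intros j _. unfold f. generalize (isx_range (shift x i s) (shift y j 1)) (isx_range (shift x i s) (shift y j (-1))); lra. }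
    apply Rle_trans with (f i); [|apply rsum_term_le; auto].
    unfold f. unfold isx at 1. destruct (excluded_middle_informative (y = x)) as [->|]; [|apply P; auto].
    generalize (isx_range (shift x i s) (shift x i 1)) (isx_range (shift x i s) (shift x i (-1))).
    destruct Hs as [-> | ->]; rewrite isx_eq; lra.
Qed.

Lemma shift_shift x i s t : shift (shift x i s) i t = shift x i (s + t).
Proof.
  apply functional_extensionality; intros j. unfold shift. destruct (Nat.eqb j i); lia.
Qed.

Lemma shift_0 x i : shift x i 0 = x.
Proof.
  apply functional_extensionality; intros j. unfold shift. destruct (Nat.eqb j i); lia.
Qed.

Lemma reach_shift x i z : (i < d)%nat -> reach x -> reach (shift x i z).
Proof.
  intros Hi Rx. apply (Z.peano_ind (fun z => reach (shift x i z))).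
  - rewrite shift_0; auto.
  - intros k Hk. replace (Z.succ k) with (k + 1)%Z by lia. rewrite <- shift_shift. apply reach_step; auto.
  - intros k Hk. replace (Z.pred k) with (k + -1)%Z by lia. rewrite <- shift_shift. apply reach_step; auto.
Qed.

(** Adjust the coordinates one after another by unit steps. The positive mass obtained is the loss
    in [near_ret_gap]. *)
Lemma reach_all x : supported d x -> reach x.
Proof.
  intros Sx.
  assert (T : forall m, (m <= d)%nat -> reach (fun i => if Nat.ltb i m then x i else 0%Z)).
  { induction m as [|m IH]; intros Hm.
    - exists O. simpl. replace zeroZ with (fun i => if Nat.ltb i 0 then x i else 0%Z); [rewrite isx_eq; lra|].
      apply functional_extensionality; intros i. reflexivity.
    - replace (fun i => if Nat.ltb i (S m) then x i else 0%Z)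
        with (shift (fun i => if Nat.ltb i m then x i else 0%Z) m (x m)).
      + apply reach_shift; [lia|]. apply IH; lia.
      + apply functional_extensionality; intros i. unfold shift.
        destruct (Nat.eqb_spec i m), (Nat.ltb_spec i m), (Nat.ltb_spec i (S m)); subst; lia. }
  replace x with (fun i => if Nat.ltb i d then x i else 0%Z); [apply T; lia|].
  apply functional_extensionality; intros i. destruct (Nat.ltb_spec i d); auto.
  rewrite Sx; auto.
Qed.

End Ez.

(** Gaussian elimination: if some [a] in [A] has nonzero last coordinate, subtract multiples of it
    to clear that coordinate and recurse; otherwise the last coordinate vanishes on [A]. *)
Lemma finite_spanning_subset (d : nat) (A : vecR -> Prop) :
  exists F : list vecR, (forall v, In v F -> A v) /\
    forall q : vecR, (forall v, In v F -> rsum d (fun i => q i * v i) = 0) ->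
      forall v, A v -> rsum d (fun i => q i * v i) = 0.
Proof.
  revert A. induction d as [|d IH]; intros A; [exists nil; simpl; split; [tauto|auto]|].
  destruct (excluded_middle_informative (exists a, A a /\ a d <> 0)) as [(a & Aa & Ha)|N].
  - set (red := fun x : vecR => (fun i => x i - x d / a d * a i) : vecR).
    destruct (IH (fun y => exists x, A x /\ y = red x)) as (F & HF & HS).
    assert (L : exists G : list vecR, (forall v, In v G -> A v) /\ forall y, In y F -> exists x, In x G /\ y = red x).
    { clear HS. induction F as [|y F IHF].
      - exists nil; simpl; split; tauto.
      - destruct IHF as (G & G1 & G2); [intros; apply HF; right; auto|].
        destruct (HF y (or_introl eq_refl)) as (x & Ax & ->).
        exists (x :: G). split; [intros v [<-|Hv]; auto|].
        intros y [<-|Hy]; [exists x; simpl; auto|]. destruct (G2 y Hy) as (x' & H1 & H2).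
        exists x'; simpl; auto. }
    destruct L as (G & G1 & G2). exists (a :: G). split; [intros v [<-|Hv]; auto|].
    intros q Hq. assert (Qa : rsum (S d) (fun i => q i * a i) = 0) by (apply Hq; left; auto).
    assert (E : forall x, rsum d (fun i => q i * red x i) = rsum (S d) (fun i => q i * x i)).
    { intros x. rewrite (rsum_ext d _ (fun i => q i * x i - x d / a d * (q i * a i))).
      - rewrite rsum_minus, rsum_scal. cbn [rsum] in *.
        replace (rsum d (fun i => q i * a i)) with (- (q d * a d)) by lra. field; auto.
      - intros; unfold red; ring. }
    intros v Av. rewrite <- E. apply HS; [|exists v; auto].
    intros y Hy. destruct (G2 y Hy) as (x & Gx & ->). rewrite E. apply Hq. right; auto.
  - destruct (IH A) as (F & HF & HS). exists F. split; auto.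
    assert (Z : forall v, A v -> v d = 0).
    { intros v Av. destruct (Req_dec (v d) 0); auto. exfalso; apply N; eauto. }
    intros q Hq v Av. cbn [rsum]. rewrite (Z v Av), Rmult_0_r, Rplus_0_r. apply HS; auto.
    intros w Hw. specialize (Hq w Hw). cbn [rsum] in Hq. rewrite (Z w), Rmult_0_r, Rplus_0_r in Hq; auto.
Qed.

(** * Comparison of return probabilities in nearby directions *)

Definition near (d : nat) (p : vecR) (P : vecR -> Prop) : Prop :=
  exists delta, delta > 0 /\ forall q, distR d q p < delta -> P q.

Section Near.
Context (d : nat) (p : vecR) (Hd : (1 <= d)%nat) (Hp : nonzeroR d p).

Lemma near_and P Q : near d p P -> near d p Q -> near d p (fun q => P q /\ Q q).
Proof.
  intros (a & Ha & Pa) (b & Hb & Pb). exists (Rmin a b). split; [apply Rmin_pos; auto|].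
  intros q Hq. split; [apply Pa|apply Pb]; eapply Rlt_le_trans; eauto; [apply Rmin_l|apply Rmin_r].
Qed.

Lemma near_imp (P Q : vecR -> Prop) : (forall q, P q -> Q q) -> near d p P -> near d p Q.
Proof. intros I (a & Ha & Pa). exists a; auto. Qed.

Lemma near_true (P : vecR -> Prop) : (forall q, P q) -> near d p P.
Proof. intros A. exists 1; split; auto; lra. Qed.

Lemma near_list {X} (P : X -> vecR -> Prop) (l : list X) :
  (forall x, In x l -> near d p (P x)) -> near d p (fun q => forall x, In x l -> P x q).
Proof.
  induction l as [|a l IH]; intros E; [apply near_true; simpl; tauto|].
  apply near_imp with (fun q => P a q /\ forall x, In x l -> P x q).
  - intros q [Pa Pl] x [<-|Hx]; auto.
  - apply near_and; [apply E; left; auto|apply IH; intros; apply E; right; auto].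
Qed.

Lemma near_lt (P : nat -> vecR -> Prop) (n : nat) :
  (forall m, near d p (P m)) -> near d p (fun q => forall m, (m < n)%nat -> P m q).
Proof.
  intros E. apply near_imp with (fun q => forall m, In m (seq 0 n) -> P m q).
  - intros q Hq m Hm. apply Hq, in_seq. lia.
  - apply near_list. auto.
Qed.

Lemma coord_le_dist q i : (i < d)%nat -> Rabs (q i - p i) <= distR d q p.
Proof.
  intros Hi. unfold distR. rewrite <- (sqrt_pow2 (Rabs (q i - p i))) by apply Rabs_pos.
  apply sqrt_le_1_alt. rewrite pow2_abs.
  apply (rsum_term_le d (fun i => (q i - p i) ^ 2)); auto. intros; apply pow2_ge_0.
Qed.

Lemma near_dot x : dotRZ d p x <> 0 -> near d p (fun q => dotRZ d q x <> 0).
Proof.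
  intros Hx. set (K := rsum d (fun i => Rabs (IZR (x i)))).
  assert (K0 : 0 <= K) by (apply rsum_nonneg; intros; apply Rabs_pos).
  exists (Rabs (dotRZ d p x) / (K + 1)).
  assert (A : 0 < Rabs (dotRZ d p x)) by (apply Rabs_pos_lt; auto).
  split; [apply Rdiv_lt_0_compat; lra|]. intros q Hq Z.
  assert (B : Rabs (dotRZ d q x - dotRZ d p x) <= distR d q p * K).
  { unfold dotRZ, K. rewrite <- rsum_minus, <- rsum_scal. eapply Rle_trans; [apply Rabs_rsum_le|].
    apply rsum_le. intros i Hi. rewrite <- Rmult_minus_distr_r, Rabs_mult.
    apply Rmult_le_compat_r; [apply Rabs_pos|]. apply coord_le_dist; auto. }
  rewrite Z, Rminus_0_l, Rabs_Ropp in B.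
  assert (D0 : 0 <= distR d q p) by apply sqrt_pos.
  apply (Rmult_lt_compat_r (K + 1)) in Hq; [|lra].
  unfold Rdiv in Hq. rewrite Rmult_assoc, Rinv_l in Hq by lra. nra.
Qed.

(** Upper semicontinuity: [p.x <> 0] persists nearby, whereas [p.x = 0] may be destroyed. The
    neighbourhood depends on [x], hence the finite supports in [near_ind0_on]. *)
Lemma near_ind0 x : near d p (fun q => ind0 (dotRZ d q x) <= ind0 (dotRZ d p x)).
Proof.
  destruct (Req_dec (dotRZ d p x) 0) as [Z|N].
  - apply near_true. intros q. rewrite Z, ind0_0. apply ind0_range.
  - generalize (near_dot x N). apply near_imp. intros q Hq. rewrite !ind0_ne; auto; lra.
Qed.

Lemma near_ind0_on n : exists S, on (fun x => In x S) (Ez d n) /\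
  near d p (fun q => forall x, In x S -> ind0 (dotRZ d q x) <= ind0 (dotRZ d p x)).
Proof.
  destruct (fin_on (Ez d n) (fin_Ez d n)) as [S HS]. exists S. split; auto.
  apply near_list. intros; apply near_ind0.
Qed.

Lemma near_ret n : near d p (fun q => ret d q n <= ret d p n).
Proof.
  destruct (near_ind0_on n) as (S & HS & N). revert N. apply near_imp. intros q Hq.
  rewrite !ret_Ez; auto. apply (pos_le_on (fun x => In x S)); auto; [apply fin_Ez|apply posf_Ez; auto].
Qed.

Lemma ret_Lam_sub q n : Lam_sub d p q -> ret d p n <= ret d q n.
Proof.
  intros L. rewrite !ret_Ez; auto.
  apply (pos_le_on (supported d)); [apply fin_Ez|apply posf_Ez; auto|apply on_Ez|].
  intros x Sx. destruct (Req_dec (dotRZ d p x) 0) as [Z|N].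
  - destruct (L x (conj Sx Z)) as [_ Z']. rewrite Z, Z'. lra.
  - rewrite (ind0_ne _ N). apply ind0_range.
Qed.

(** The mass [eta] that the walk puts on the single point [x] at time [n] is counted for [p] and
    lost for [q]. *)
Lemma near_ret_gap x : Lam d p x -> exists eta n, 0 < eta /\
  near d p (fun q => dotRZ d q x <> 0 -> (1 <= n)%nat /\ ret d q n <= ret d p n - eta).
Proof.
  intros [Sx Zx]. destruct (reach_all d Hd x Sx) as [n Hn].
  exists (Ez d n (isx x)), n. split; auto.
  destruct (near_ind0_on n) as (S & HS & N). revert N. apply near_imp. intros q Hq Nx. split.
  (* Mass on [x] at time [0] would force [x = 0], but [q.0 = 0]. *)
  - destruct n; [|lia]. exfalso. simpl in Hn. unfold isx in Hn.
    destruct (excluded_middle_informative (zeroZ = x)) as [<-|]; [|lra]. apply Nx, dot_zero.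
  - apply Rplus_le_reg_r with (Ez d n (isx x)).
    replace (ret d p n - Ez d n (isx x) + Ez d n (isx x)) with (ret d p n) by ring.
    rewrite !ret_Ez; auto. rewrite <- fin_plus; [|apply fin_Ez].
    apply (pos_le_on (fun y => In y S)); auto; [apply fin_Ez|apply posf_Ez; auto|].
    intros y Hy. unfold isx. destruct (excluded_middle_informative (y = x)) as [->|]; [|generalize (Hq y Hy); lra].
    rewrite Zx, ind0_0, ind0_ne; auto. lra.
Qed.

(** A [q] that fails on [Lam p] already fails on one of finitely many vectors; this makes [eta] and
    [N] independent of [q]. *)
Lemma not_Lam_sub_gap : exists eta N, 0 < eta /\ near d p (fun q => ~ Lam_sub d p q ->
  exists n, (1 <= n <= N)%nat /\ ret d q n <= ret d p n - eta).
Proof.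
  destruct (finite_spanning_subset d (fun v => exists x, Lam d p x /\ v = fun i => IZR (x i))) as (F & HF & HS).
  assert (G : exists eta N, 0 < eta /\ near d p (fun q => (exists v, In v F /\ rsum d (fun i => q i * v i) <> 0) ->
     exists n, (1 <= n <= N)%nat /\ ret d q n <= ret d p n - eta)).
  { clear HS. induction F as [|v F IH].
    - exists 1, O. split; [lra|]. apply near_true. intros q (v & [] & _).
    - destruct IH as (eta & N & He & Hn); [intros; apply HF; right; auto|].
      destruct (HF v (or_introl eq_refl)) as (x & Lx & ->).
      destruct (near_ret_gap x Lx) as (eta' & n & He' & Hn').
      exists (Rmin eta eta'), (Nat.max N n). split; [apply Rmin_pos; auto|].
      generalize (near_and _ _ Hn Hn'). apply near_imp. intros q [Q1 Q2] (w & [<-|Hw] & Nw).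
      + destruct (Q2 Nw) as [B1 B2]. exists n. split; [lia|]. generalize (Rmin_r eta eta'). lra.
      + destruct Q1 as (m & B1 & B2); [eauto|]. exists m. split; [lia|]. generalize (Rmin_l eta eta'). lra. }
  destruct G as (eta & N & He & Hn). exists eta, N. split; auto. revert Hn. apply near_imp.
  intros q Hq Nq. apply Hq. apply NNPP. intros C. apply Nq. intros x [Sx Zx]. split; auto.
  apply (HS q) with (v := fun i => IZR (x i)); [|exists x; split; [split; auto|auto]].
  intros v Hv. apply NNPP. intros Nv. apply C; eauto.
Qed.

Lemma near_nonzero : near d p (nonzeroR d).
Proof.
  destruct Hp as (i & Hi & Hne). exists (Rabs (p i)). split; [apply Rabs_pos_lt; auto|].
  intros q Hq. exists i. split; auto. intros Z. generalize (coord_le_dist q i Hi).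
  rewrite Z, Rminus_0_l, Rabs_Ropp. lra.
Qed.

Lemma near_norm2 eps : 0 < eps ->
  near d p (fun q => Rabs (rsum d (fun i => q i ^ 2) - rsum d (fun i => p i ^ 2)) < eps).
Proof.
  intros He. set (K := rsum d (fun i => 2 * Rabs (p i) + 1)).
  assert (K0 : 0 <= K) by (apply rsum_nonneg; intros i _; generalize (Rabs_pos (p i)); lra).
  exists (Rmin 1 (eps / (K + 1))). split; [apply Rmin_pos; [lra|apply Rdiv_lt_0_compat; lra]|].
  intros q Hq. assert (D0 : 0 <= distR d q p) by apply sqrt_pos.
  assert (Q1 := Rlt_le_trans _ _ _ Hq (Rmin_l _ _)). assert (Q2 := Rlt_le_trans _ _ _ Hq (Rmin_r _ _)).
  apply Rle_lt_trans with (distR d q p * K).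
  - unfold K. rewrite <- rsum_minus, <- rsum_scal. eapply Rle_trans; [apply Rabs_rsum_le|].
    apply rsum_le. intros i Hi. replace (q i ^ 2 - p i ^ 2) with ((q i - p i) * (q i - p i + 2 * p i)) by ring.
    rewrite Rabs_mult. generalize (coord_le_dist q i Hi); intros C.
    assert (T := Rabs_triang (q i - p i) (2 * p i)). rewrite (Rabs_mult 2), (Rabs_right 2) in T by lra.
    apply Rmult_le_compat; try apply Rabs_pos; lra.
  - apply (Rmult_lt_compat_r (K + 1)) in Q2; [|lra].
    unfold Rdiv in Q2. rewrite Rmult_assoc, Rinv_l in Q2 by lra. nra.
Qed.

Definition Snorm (q : vecR) : R := sqrt (2 * INR d * rsum d (fun i => q i ^ 2)).

Lemma Snorm_pos q : nonzeroR d q -> 0 < Snorm q.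
Proof.
  intros (i & Hi & Hne). apply sqrt_lt_R0. generalize (d_pos d Hd); intros.
  apply Rmult_lt_0_compat; [lra|]. apply Rlt_le_trans with (q i ^ 2).
  - rewrite <- pow2_abs. apply pow_lt, Rabs_pos_lt; auto.
  - apply (rsum_term_le d (fun i => q i ^ 2)); auto. intros; apply pow2_ge_0.
Qed.

Lemma near_Snorm eps : 0 < eps -> near d p (fun q => Rabs (Snorm q - Snorm p) < eps).
Proof.
  intros He. set (np := 2 * INR d * rsum d (fun i => p i ^ 2)).
  generalize (d_pos d Hd); intros Dp.
  assert (P : 0 <= np) by (apply Rmult_le_pos; [lra|apply rsum_nonneg; intros; apply pow2_ge_0]).
  destruct (continuity_pt_sqrt np P eps He) as (alp & Ha & Hc).
  assert (A2 : 0 < alp / (2 * INR d)) by (apply Rdiv_lt_0_compat; lra).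
  generalize (near_norm2 _ A2). apply near_imp. intros q Hq.
  destruct (Req_dec np (2 * INR d * rsum d (fun i => q i ^ 2))) as [E|N].
  - unfold Snorm. fold np. rewrite <- E, Rminus_diag, Rabs_R0; auto.
  - apply Hc. split; [split; [exact I|exact N]|]. simpl. unfold Rdist, np.
    rewrite <- Rmult_minus_distr_l, Rabs_mult, (Rabs_right (2 * INR d)) by lra.
    apply (Rmult_lt_compat_l (2 * INR d)) in Hq; [|lra].
    replace (2 * INR d * (alp / (2 * INR d))) with alp in Hq by (field; lra). auto.
Qed.

Lemma tail_small tau N0 : 0 < tau -> exists N, (N0 <= N)%nat /\ 4 * INR d * sqrt (/ INR (S N)) <= tau.
Proof.
  intros Ht. generalize (d_pos d Hd); intros Dp.
  destruct (INR_unbounded (((4 * INR d) / tau) ^ 2)) as [k Hk].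
  exists (Nat.max N0 k). split; [lia|].
  set (m := INR (S (Nat.max N0 k))).
  assert (Hm : ((4 * INR d) / tau) ^ 2 <= m).
  { apply Rle_trans with (INR k); [lra|]. apply le_INR. lia. }
  assert (T : 0 < 4 * INR d / tau) by (apply Rdiv_lt_0_compat; lra).
  assert (B : sqrt (/ m) <= tau / (4 * INR d)).
  { rewrite <- (sqrt_pow2 (tau / (4 * INR d))) by (left; apply Rdiv_lt_0_compat; lra).
    apply sqrt_le_1_alt. replace ((tau / (4 * INR d)) ^ 2) with (/ ((4 * INR d / tau) ^ 2)) by (field; lra).
    apply Rinv_le_contravar; auto. apply pow_lt; auto. }
  apply (Rmult_le_compat_l (4 * INR d)) in B; [|lra].
  replace (4 * INR d * (tau / (4 * INR d))) with tau in B by (field; lra). auto.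
Qed.

Lemma retn_mono q n : ret d q n <= ret d p n -> retn d q n <= retn d p n.
Proof.
  intros E. unfold retn. destruct n as [|n]; [simpl; lra|].
  apply Rmult_le_compat_r; [|exact E]. left. apply Rinv_0_lt_compat, lt_0_INR. lia.
Qed.

Lemma Aexp_ge_rsum q n : nonzeroR d q -> rsum n (retn d q) <= Aexp d q.
Proof. intros Hq. apply Series_ge_rsum; [apply retn_range; auto|apply ex_an; auto]. Qed.

(** Up to time [N] each term can only drop, and the tail of [A(q)] after [N] is at most [tau]
    whatever [q] is. *)
Lemma near_Aexp_le tau : 0 < tau -> near d p (fun q => Aexp d q <= Aexp d p + tau).
Proof.
  intros Ht. destruct (tail_small tau 0 Ht) as (N & _ & HN).
  generalize (near_and _ _ near_nonzero (near_lt _ (S N) near_ret)). apply near_imp.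
  intros q [Nq Hq]. assert (T := an_tail d q Hd Nq N).
  assert (rsum (S N) (retn d q) <= rsum (S N) (retn d p)).
  { apply rsum_le. intros n Hn. apply retn_mono; auto. }
  generalize (Aexp_ge_rsum p (S N) Hp). lra.
Qed.

Lemma Aexp_ge_Lam_sub q : nonzeroR d q -> Lam_sub d p q -> Aexp d p <= Aexp d q.
Proof.
  intros Nq L. apply Series_le; [|apply ex_an; auto]. intros n. split; [apply retn_range; auto|].
  unfold retn. destruct n as [|n]; [simpl; lra|].
  apply Rmult_le_compat_r; [|apply ret_Lam_sub; auto]. left. apply Rinv_0_lt_compat, lt_0_INR. lia.
Qed.

Lemma near_Aexp_gap : exists eta, 0 < eta /\
  near d p (fun q => ~ Lam_sub d p q -> Aexp d q <= Aexp d p - eta).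
Proof.
  destruct not_Lam_sub_gap as (eta & N0 & He & Hg).
  (* A loss [eta] at a time [n <= N0] costs at least [eta / (N0 + 1) = 2 e] in [A], and the tail of
     [A(q)] can give back at most [e]. *)
  set (e := eta / (2 * INR (S N0))).
  assert (Np : 0 < INR (S N0)) by (apply lt_0_INR; lia).
  assert (Pe : 0 < e) by (apply Rdiv_lt_0_compat; lra).
  exists e. split; auto. destruct (tail_small e N0 Pe) as (N & HN0 & HN).
  generalize (near_and _ _ Hg (near_and _ _ near_nonzero (near_lt _ (S N) near_ret))). apply near_imp.
  intros q (Hq & Nq & Hr) NL. destruct (Hq NL) as (n & Hn & Gn).
  assert (T := an_tail d q Hd Nq N).
  assert (M : forall m, (m < S N)%nat -> 0 <= retn d p m - retn d q m).
  { intros m Hm. generalize (retn_mono q m (Hr m Hm)). lra. }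
  assert (Q : retn d p n - retn d q n <= rsum (S N) (fun m => retn d p m - retn d q m)).
  { apply (rsum_term_le (S N) (fun m => retn d p m - retn d q m)); auto. lia. }
  rewrite rsum_minus in Q.
  assert (2 * e <= retn d p n - retn d q n).
  { unfold retn. destruct n as [|n]; [lia|]. unfold Rdiv.
    change (retp d p (S n)) with (ret d p (S n)). change (retp d q (S n)) with (ret d q (S n)).
    rewrite <- Rmult_minus_distr_r. unfold e, Rdiv. rewrite Rinv_mult.
    replace (2 * (eta * (/ 2 * / INR (S N0)))) with (eta * / INR (S N0)) by (field; apply not_0_INR; lia).
    apply Rmult_le_compat; [lra|left; apply Rinv_0_lt_compat; lra|lra|].
    apply Rinv_le_contravar; [apply lt_0_INR; lia|apply le_INR; lia]. }
  generalize (Aexp_ge_rsum p (S N) Hp). lra.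
Qed.

Lemma Aexp_nonneg q : nonzeroR d q -> 0 <= Aexp d q.
Proof. intros Nq. apply (Aexp_ge_rsum q 0 Nq). Qed.

Lemma H_continuous_along_Lam eps : 0 < eps ->
  near d p (fun q => Lam_sub d p q -> Rabs (H d q - H d p) < eps).
Proof.
  intros He. assert (Sp := Snorm_pos p Hp).
  set (f := fun a => exp (- a / 2)).
  assert (Cf : continuity_pt f (Aexp d p)) by (unfold f; reg).
  assert (E2 : 0 < eps / 2 / (Snorm p + 1)) by (apply Rdiv_lt_0_compat; lra).
  destruct (Cf _ E2) as (tau & Ht & Hc). simpl in Hc. unfold Rdist, D_x, no_cond in Hc.
  assert (Ht2 : 0 < tau / 2) by lra. assert (He2 : 0 < eps / 2) by lra.
  generalize (near_and _ _ near_nonzero (near_and _ _ (near_Aexp_le _ Ht2) (near_Snorm _ He2))).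
  apply near_imp. intros q (Nq & Aq & Sq) L.
  assert (Aq' := Aexp_ge_Lam_sub q Nq L).
  rewrite (H_formula d q), (H_formula d p); auto. fold (Snorm q). fold (Snorm p).
  change (exp (- Aexp d q / 2)) with (f (Aexp d q)). change (exp (- Aexp d p / 2)) with (f (Aexp d p)).
  assert (F : Rabs (f (Aexp d q) - f (Aexp d p)) < eps / 2 / (Snorm p + 1)).
  { destruct (Req_dec (Aexp d p) (Aexp d q)) as [E|N]; [rewrite E, Rminus_diag, Rabs_R0; auto|].
    apply Hc. split; [split; [exact I|auto]|]. rewrite Rabs_pos_eq; lra. }
  assert (F1 : 0 <= f (Aexp d q) <= 1).
  { unfold f. split; [left; apply exp_pos|]. rewrite <- exp_0. generalize (Aexp_nonneg q Nq); intros P.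
    destruct (Rle_lt_or_eq_dec _ _ P) as [P'|<-]; [left; apply exp_increasing; lra|right; f_equal; lra]. }
  replace (Snorm q * f (Aexp d q) - Snorm p * f (Aexp d p)) with
    ((Snorm q - Snorm p) * f (Aexp d q) + Snorm p * (f (Aexp d q) - f (Aexp d p))) by ring.
  eapply Rle_lt_trans; [apply Rabs_triang|]. rewrite !Rabs_mult.
  rewrite (Rabs_pos_eq (f (Aexp d q))), (Rabs_pos_eq (Snorm p)) by lra.
  assert (Snorm p * Rabs (f (Aexp d q) - f (Aexp d p)) <= eps / 2).
  { apply Rle_trans with (Snorm p * (eps / 2 / (Snorm p + 1))); [apply Rmult_le_compat_l; lra|].
    apply Rle_trans with ((Snorm p + 1) * (eps / 2 / (Snorm p + 1))); [apply Rmult_le_compat_r; lra|].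
    right. field. lra. }
  generalize (Rabs_pos (Snorm q - Snorm p)). nra.
Qed.

Lemma H_jump_across_Lam : exists c, c > H d p /\ near d p (fun q => ~ Lam_sub d p q -> c <= H d q).
Proof.
  assert (Sp := Snorm_pos p Hp). destruct near_Aexp_gap as (eta & He & Hg).
  (* The exponent gains [eta / 2]; half of it is kept and the other half absorbs the change of the
     norm from [p] to [q]. *)
  exists (Snorm p * exp (- Aexp d p / 2 + eta / 4)). split.
  - rewrite (H_formula d p); auto. fold (Snorm p). apply Rmult_lt_compat_l; auto. apply exp_increasing. lra.
  - assert (E1 : exp (- (eta / 4)) < 1) by (rewrite <- exp_0; apply exp_increasing; lra).
    assert (E : 0 < Snorm p * (1 - exp (- (eta / 4)))) by (apply Rmult_lt_0_compat; lra).
    generalize (near_and _ _ near_nonzero (near_and _ _ Hg (near_Snorm _ E))). apply near_imp.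
    intros q (Nq & Aq & Sq) NL. specialize (Aq NL). rewrite (H_formula d q); auto. fold (Snorm q).
    apply Rabs_def2 in Sq. destruct Sq as [_ Sq].
    replace (- Aexp d p / 2 + eta / 4) with (- (eta / 4) + (- Aexp d p / 2 + eta / 2)) by field.
    rewrite exp_plus, <- Rmult_assoc. apply Rmult_le_compat.
    + apply Rmult_le_pos; [lra|left; apply exp_pos].
    + left; apply exp_pos.
    + lra.
    + assert (P : - Aexp d p / 2 + eta / 2 <= - Aexp d q / 2) by lra.
      destruct (Rle_lt_or_eq_dec _ _ P) as [P'| ->]; [left; apply exp_increasing; lra|lra].
Qed.

End Near.

(** * Uniform approximation by polynomials *)

Inductive polyf : (R -> R) -> Prop :=
| polyf_const c : polyf (fun _ => c)
| polyf_id : polyf (fun t => t)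
| polyf_plus f g : polyf f -> polyf g -> polyf (fun t => f t + g t)
| polyf_mult f g : polyf f -> polyf g -> polyf (fun t => f t * g t).

Definition ua (g : R -> R) : Prop :=
  forall eps, 0 < eps -> exists f, polyf f /\ forall t, -1 <= t <= 1 -> Rabs (g t - f t) <= eps.

Lemma polyf_ua f : polyf f -> ua f.
Proof. intros P eps He. exists f. split; auto. intros. rewrite Rminus_diag, Rabs_R0; lra. Qed.

Lemma ua_uniform g : (forall eps, 0 < eps -> exists f, ua f /\ forall t, -1 <= t <= 1 -> Rabs (g t - f t) <= eps) -> ua g.
Proof.
  intros E eps He. destruct (E (eps / 2)) as (f & Uf & Hf); [lra|].
  destruct (Uf (eps / 2)) as (h & Ph & Hh); [lra|]. exists h. split; auto. intros t Ht.
  replace (g t - h t) with ((g t - f t) + (f t - h t)) by ring.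
  eapply Rle_trans; [apply Rabs_triang|]. specialize (Hf t Ht). specialize (Hh t Ht). lra.
Qed.

Lemma ua_plus f g : ua f -> ua g -> ua (fun t => f t + g t).
Proof.
  intros U V eps He. destruct (U (eps / 2)) as (a & Pa & Ha); [lra|]. destruct (V (eps / 2)) as (b & Pb & Hb); [lra|].
  exists (fun t => a t + b t). split; [constructor; auto|]. intros t Ht.
  replace (f t + g t - (a t + b t)) with ((f t - a t) + (g t - b t)) by ring.
  eapply Rle_trans; [apply Rabs_triang|]. specialize (Ha t Ht). specialize (Hb t Ht). lra.
Qed.

Lemma ua_scal c f : ua f -> ua (fun t => c * f t).
Proof.
  intros U eps He. assert (C : 0 < Rabs c + 1) by (generalize (Rabs_pos c); lra).
  destruct (U (eps / (Rabs c + 1))) as (a & Pa & Ha); [apply Rdiv_lt_0_compat; lra|].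
  exists (fun t => c * a t). split; [apply (polyf_mult (fun _ => c)); auto; constructor|].
  intros t Ht. rewrite <- Rmult_minus_distr_l, Rabs_mult. specialize (Ha t Ht).
  apply Rle_trans with ((Rabs c + 1) * (eps / (Rabs c + 1))).
  - apply Rmult_le_compat; try apply Rabs_pos; lra.
  - right; field; lra.
Qed.

Lemma polyf_bounded f : polyf f -> exists B, 0 < B /\ forall t, -1 <= t <= 1 -> Rabs (f t) <= B.
Proof.
  induction 1 as [c| |f g Pf (B & B0 & HB) Pg (C & C0 & HC)|f g Pf (B & B0 & HB) Pg (C & C0 & HC)].
  - exists (Rabs c + 1). generalize (Rabs_pos c). split; [lra|]. intros; lra.
  - exists 1. split; [lra|]. intros; apply Rabs_le; lra.
  - exists (B + C). split; [lra|]. intros t Ht. eapply Rle_trans; [apply Rabs_triang|].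
    specialize (HB t Ht); specialize (HC t Ht); lra.
  - exists (B * C). split; [nra|]. intros t Ht. rewrite Rabs_mult.
    apply Rmult_le_compat; try apply Rabs_pos; auto.
Qed.

(* Newton-type iteration for [sqrt (y^2)], as in the classical proof of Stone-Weierstrass *)
Fixpoint abs_iter (k : nat) (y : R) : R :=
  match k with O => 0 | S k => abs_iter k y + (y * y - abs_iter k y * abs_iter k y) / 2 end.

(** With [a = |y|] and [q] the current iterate, the error [a - q] is multiplied by [1 - (a + q)/2],
    which lies between [0] and [1 - a/2]. *)
Lemma abs_iter_bound k y : -1 <= y <= 1 ->
  0 <= abs_iter k y <= Rabs y /\ Rabs y - abs_iter k y <= Rabs y * (1 - Rabs y / 2) ^ k.
Proof.
  intros Hy. set (a := Rabs y). assert (A : 0 <= a <= 1) by (split; [apply Rabs_pos|apply Rabs_le; lra]).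
  assert (Y : y * y = a * a) by (unfold a; rewrite <- Rabs_mult, Rabs_pos_eq; [auto|nra]).
  induction k as [|k (IH1 & IH2)]; simpl; [split; lra|]. rewrite Y.
  set (q := abs_iter k y) in *. set (w := (1 - a / 2) ^ k) in *.
  assert (W : 0 <= w) by (apply pow_le; lra).
  replace (q + (a * a - q * q) / 2) with (a - (a - q) * (1 - (a + q) / 2)) by field.
  assert (0 <= (a - q) * (1 - (a + q) / 2)) by (apply Rmult_le_pos; lra).
  assert ((a - q) * (1 - (a + q) / 2) <= (a - q) * 1) by (apply Rmult_le_compat_l; lra).
  assert ((a - q) * (1 - (a + q) / 2) <= (a * w) * (1 - a / 2)) by (apply Rmult_le_compat; lra).
  split; [lra|]. nra.
Qed.

(** With [z = |y|/2], Bernoulli gives [(1 - z)^n (1 + n z) <= 1], so the error [2 z (1 - z)^n] is at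
    most [2/n], uniformly in [y]. *)
Lemma abs_iter_close k y : -1 <= y <= 1 -> Rabs (Rabs y - abs_iter (S k) y) <= 2 / INR (S k).
Proof.
  intros Hy. destruct (abs_iter_bound (S k) y Hy) as (B1 & B2).
  rewrite Rabs_pos_eq by lra. eapply Rle_trans; [exact B2|].
  set (z := Rabs y / 2). assert (Z : 0 <= z <= / 2).
  { unfold z. assert (0 <= Rabs y <= 1) by (split; [apply Rabs_pos|apply Rabs_le; lra]). lra. }
  replace (Rabs y) with (2 * z) by (unfold z; field). replace (2 * z / 2) with z by field.
  assert (NP : 0 < INR (S k)) by (apply lt_0_INR; lia).
  destruct (Req_dec z 0) as [->|Hz].
  - rewrite Rmult_0_r, Rmult_0_l. left. apply Rdiv_lt_0_compat; lra.
  - assert (P : (1 - z) ^ S k * (1 + INR (S k) * z) <= 1).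
    { apply Rle_trans with ((1 - z) ^ S k * (1 + z) ^ S k).
      - apply Rmult_le_compat_l; [apply pow_le; lra|]. apply poly; lra.
      - rewrite <- Rpow_mult_distr. apply pow_range. nra. }
    assert (Q : 0 <= (1 - z) ^ S k) by (apply pow_le; lra).
    set (w := (1 - z) ^ S k) in *. set (n := INR (S k)) in *.
    apply Rmult_le_reg_r with n; auto. replace (2 / n * n) with 2 by (field; lra). nra.
Qed.

Lemma ua_abs g : ua g -> ua (fun t => Rabs (g t)).
Proof.
  intros U. apply ua_uniform. intros eps He. destruct (U eps He) as (f & Pf & Hf).
  exists (fun t => Rabs (f t)). split.
  2:{ intros t Ht. eapply Rle_trans; [apply Rabs_triang_inv2|]. auto. }
  clear g U Hf. destruct (polyf_bounded f Pf) as (B & B0 & HB).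
  intros e Hee. destruct (INR_unbounded (2 * B / e)) as [k Hk].
  (* The iteration is controlled on [[-1, 1]], so [f] is first divided by its bound. *)
  set (y := fun t => / B * f t).
  assert (Py : polyf y) by (apply (polyf_mult (fun _ => / B)); auto; constructor).
  assert (Pk : forall k, polyf (fun t => abs_iter k (y t))).
  { clear k Hk. induction k as [|k IH]; simpl; [apply polyf_const|]. apply (polyf_plus _ _ IH).
    apply (polyf_mult (fun t => y t * y t - abs_iter k (y t) * abs_iter k (y t)) (fun _ => / 2)); [|apply polyf_const].
    apply (polyf_plus (fun t => y t * y t) (fun t => - (abs_iter k (y t) * abs_iter k (y t)))).
    - apply (polyf_mult y y); auto.
    - replace (fun t => - (abs_iter k (y t) * abs_iter k (y t))) with (fun t => (-1) * (abs_iter k (y t) * abs_iter k (y t))).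
      + apply (polyf_mult (fun _ => -1)); [apply polyf_const|]. apply (polyf_mult _ _ IH IH).
      + apply functional_extensionality; intros; ring. }
  exists (fun t => B * abs_iter (S k) (y t)). split; [apply (polyf_mult (fun _ => B)); auto; constructor|].
  intros t Ht. specialize (HB t Ht).
  assert (Yt : -1 <= y t <= 1).
  { apply Rabs_le_between. unfold y. rewrite Rabs_mult, Rabs_pos_eq by (left; apply Rinv_0_lt_compat; auto).
    apply Rmult_le_reg_l with B; auto. rewrite <- Rmult_assoc, Rinv_r; lra. }
  replace (Rabs (f t)) with (B * Rabs (y t)).
  2:{ unfold y. rewrite Rabs_mult, Rabs_pos_eq by (left; apply Rinv_0_lt_compat; auto). field; lra. }
  rewrite <- Rmult_minus_distr_l, Rabs_mult, (Rabs_pos_eq B) by lra.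
  apply Rle_trans with (B * (2 / INR (S k))); [apply Rmult_le_compat_l; [lra|]; apply abs_iter_close; auto|].
  assert (NP : 0 < INR (S k)) by (apply lt_0_INR; lia).
  assert (K2 : 2 * B / e < INR (S k)) by (rewrite S_INR; lra).
  apply Rmult_le_reg_r with (INR (S k)); auto.
  replace (B * (2 / INR (S k)) * INR (S k)) with (2 * B) by (field; lra).
  apply (Rmult_lt_compat_l e) in K2; auto. replace (e * (2 * B / e)) with (2 * B) in K2 by (field; lra). lra.
Qed.

Lemma ua_max f g : ua f -> ua g -> ua (fun t => Rmax (f t) (g t)).
Proof.
  intros U V. replace (fun t => Rmax (f t) (g t)) with
    (fun t => / 2 * ((f t + g t) + Rabs (f t + (-1) * g t))).
  - apply ua_scal, ua_plus; [apply ua_plus; auto|].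
    apply (ua_abs (fun t => f t + -1 * g t)), ua_plus; auto. apply ua_scal; auto.
  - apply functional_extensionality; intros t. replace (f t + -1 * g t) with (f t - g t) by ring.
    unfold Rmax. destruct (Rle_dec (f t) (g t)).
    + rewrite Rabs_left1; lra.
    + rewrite Rabs_right; lra.
Qed.

(** * Riemann sums on the torus *)

(** Characteristic function of one step of the simple random walk. *)
Definition phi (d : nat) (th : vecR) : R := / INR d * rsum d (fun j => cos (th j)).

Lemma lsum_app l l' : lsum (l ++ l') = lsum l + lsum l'.
Proof. unfold lsum. induction l as [|a l IH]; simpl; [lra|rewrite IH; lra]. Qed.

Lemma lsum_flat_map {X Y} (f : Y -> R) (g : X -> list Y) (l : list X) :
  lsum (map f (flat_map g l)) = lsum (map (fun x => lsum (map f (g x))) l).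
Proof.
  induction l as [|a l IH]; [reflexivity|]. simpl. rewrite map_app, lsum_app, IH. reflexivity.
Qed.

Lemma lsum_seq (f : nat -> R) N : lsum (map f (seq 0 N)) = rsum N f.
Proof.
  induction N as [|N IH]; [reflexivity|]. rewrite seq_S, map_app, lsum_app, IH. simpl. unfold lsum; simpl. lra.
Qed.

Lemma lsum_scal {X} (c : R) (f : X -> R) l : lsum (map (fun x => c * f x) l) = c * lsum (map f l).
Proof. unfold lsum. induction l as [|a l IH]; simpl; [lra|rewrite IH; lra]. Qed.

Lemma lsum_nonneg {X} (f : X -> R) l : (forall x, 0 <= f x) -> 0 <= lsum (map f l).
Proof. intros P. unfold lsum. induction l as [|a l IH]; simpl; [lra|]. generalize (P a); lra. Qed.

Lemma fin_riem d N : fin (riem d N).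
Proof.
  exists (map (fun k => (/ INR N ^ d, theta N k)) (grid d N)). intros f. unfold riem.
  rewrite map_map, <- lsum_scal. reflexivity.
Qed.

Lemma posf_riem d N : posf (riem d N).
Proof.
  intros f Hf. unfold riem. apply Rmult_le_pos; [|apply lsum_nonneg; auto].
  destruct (Req_dec (INR N ^ d) 0) as [->|E]; [rewrite Rinv_0; lra|].
  left; apply Rinv_0_lt_compat. generalize (pow_le (INR N) d (pos_INR N)). lra.
Qed.

(** For [x <> 0], multiplying by [2 sin w] with [w = PI x / N] makes the sum telescope to
    [2 cos B sin (PI x) = 0]; [sin w] is nonzero because [0 < |x| < N]. *)
Lemma cos_row_sum (N : nat) (B : R) (x : Z) : (Z.abs x < Z.of_nat N)%Z ->
  rsum N (fun j => cos (B + (- PI + (2 * INR j + 1) * PI / INR N) * IZR x)) =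
  if Z.eq_dec x 0 then INR N * cos B else 0.
Proof.
  intros Hx. destruct (Z.eq_dec x 0) as [->|Hne].
  - rewrite <- rsum_const. apply rsum_ext. intros. f_equal. ring.
  - assert (NP : 0 < INR N) by (apply lt_0_INR; lia).
    set (m := IZR x). set (w := m * PI / INR N).
    assert (Sw : sin w <> 0).
    { intros Z. apply sin_eq_0_0 in Z. destruct Z as [k Hk]. unfold w, m in Hk.
      assert (E : IZR x = IZR k * INR N).
      { apply Rmult_eq_reg_r with (PI / INR N).
        - replace (IZR x * (PI / INR N)) with (IZR x * PI / INR N) by (field; lra). rewrite Hk. field; lra.
        - apply Rgt_not_eq, Rdiv_lt_0_compat; [apply PI_RGT_0|auto]. }
      rewrite INR_IZR_INZ, <- mult_IZR in E. apply eq_IZR in E.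
      assert (K : k = 0%Z \/ (1 <= Z.abs k)%Z) by lia. destruct K as [->|K]; [lia|].
      rewrite E, Z.abs_mul, (Z.abs_eq (Z.of_nat N)) in Hx by lia. nia. }
    assert (T : forall n, 2 * sin w * rsum n (fun j => cos (B + (- PI + (2 * INR j + 1) * PI / INR N) * m))
       = sin (B + (- PI + 2 * INR n * PI / INR N) * m) - sin (B - PI * m)).
    { induction n as [|n IH].
      - simpl. replace (B + (- PI + 2 * 0 * PI / INR N) * m) with (B - PI * m) by (field; lra). ring.
      - cbn [rsum]. rewrite Rmult_plus_distr_l, IH.
        set (C := B + (- PI + (2 * INR n + 1) * PI / INR N) * m).
        replace (B + (- PI + 2 * INR n * PI / INR N) * m) with (C - w) by (unfold C, w; field; lra).
        replace (B + (- PI + 2 * INR (S n) * PI / INR N) * m) with (C + w) by (rewrite S_INR; unfold C, w; field; lra).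
        rewrite sin_plus, sin_minus. ring. }
    specialize (T N).
    replace (B + (- PI + 2 * INR N * PI / INR N) * m) with (B + PI * m) in T by (field; lra).
    rewrite sin_plus, sin_minus in T.
    replace (sin (PI * m)) with 0 in T by (symmetry; apply sin_eq_0_1; exists x; unfold m; ring).
    apply Rmult_eq_reg_l with (2 * sin w); [|lra]. lra.
Qed.

(** The free phase [B] holds the other coordinates while the last one is summed, which lets the
    induction peel off one coordinate at a time. *)
Lemma cos_grid_sum (N m : nat) (x : vecZ) : (forall i, (Z.abs (x i) < Z.of_nat N)%Z) -> forall B,
  lsum (map (fun k => cos (B + rsum m (fun i => theta N k i * IZR (x i)))) (grid m N)) =
  if excluded_middle_informative (forall i, (i < m)%nat -> x i = 0%Z) then INR N ^ m * cos B else 0.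
Proof.
  intros Hx. induction m as [|m IH]; intros B.
  - simpl. unfold lsum; simpl. rewrite !Rplus_0_r.
    destruct (excluded_middle_informative (forall i, (i < 0)%nat -> x i = 0%Z)) as [_|C]; [lra|].
    exfalso; apply C; intros; lia.
  - simpl grid. rewrite lsum_flat_map.
    (* Writing [0 * 0] lets [lsum_scal] evaluate the vanishing branch too. *)
    rewrite (map_ext _ (fun k => if Z.eq_dec (x m) 0 then INR N * cos (B + rsum m (fun i => theta N k i * IZR (x i))) else 0 * 0)).
    + destruct (Z.eq_dec (x m) 0) as [Z|NZ].
      * rewrite lsum_scal, IH.
        destruct (excluded_middle_informative (forall i, (i < m)%nat -> x i = 0%Z)) as [A|A],
          (excluded_middle_informative (forall i, (i < S m)%nat -> x i = 0%Z)) as [A'|A'].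
        -- simpl; ring.
        -- exfalso; apply A'. intros i Hi. destruct (Nat.eq_dec i m) as [->|]; auto. apply A; lia.
        -- exfalso; apply A. intros i Hi. apply A'; lia.
        -- ring.
      * rewrite lsum_scal, Rmult_0_l.
        destruct (excluded_middle_informative (forall i, (i < S m)%nat -> x i = 0%Z)) as [A'|A']; auto.
        exfalso; apply NZ, A'; lia.
    + intros k. rewrite map_map, lsum_seq.
      rewrite (rsum_ext N _ (fun j => cos ((B + rsum m (fun i => theta N k i * IZR (x i))) + (- PI + (2 * INR j + 1) * PI / INR N) * IZR (x m)))).
      * rewrite cos_row_sum; auto. destruct (Z.eq_dec (x m) 0); ring.
      * intros j Hj. f_equal. cbn [rsum]. rewrite Rplus_assoc. do 2 f_equal.
        -- apply rsum_ext. intros i Hi. unfold theta. destruct (Nat.eqb_spec i m); [lia|reflexivity].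
        -- unfold theta. rewrite Nat.eqb_refl. reflexivity.
Qed.

Lemma riem_cos d N x : (1 <= N)%nat -> supported d x -> (forall i, (Z.abs (x i) < Z.of_nat N)%Z) ->
  riem d N (fun th => cos (dotRZ d th x)) = isx zeroZ x.
Proof.
  intros HN Sx Hx. unfold riem, dotRZ.
  rewrite (map_ext _ (fun k => cos (0 + rsum d (fun i => theta N k i * IZR (x i)))))
    by (intros; rewrite Rplus_0_l; auto).
  rewrite cos_grid_sum; auto. rewrite cos_0, Rmult_1_r. unfold isx.
  destruct (excluded_middle_informative (forall i, (i < d)%nat -> x i = 0%Z)) as [A|A],
    (excluded_middle_informative (x = zeroZ)) as [E|E].
  - apply Rinv_l, pow_nonzero, not_0_INR. lia.
  - exfalso; apply E. apply functional_extensionality; intros i.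
    destruct (Nat.lt_ge_cases i d); [apply A; auto|apply Sx; auto].
  - exfalso; apply A. intros; rewrite E; reflexivity.
  - ring.
Qed.

Section Torus.
Context (d : nat) (Hd : (1 <= d)%nat).

Lemma phi_range th : -1 <= phi d th <= 1.
Proof.
  unfold phi. generalize (d_pos d Hd); intros Dp.
  assert (B : Rabs (rsum d (fun j => cos (th j))) <= INR d).
  { eapply Rle_trans; [apply Rabs_rsum_le|]. rewrite <- (Rmult_1_r (INR d)), <- rsum_const.
    apply rsum_le. intros. apply Rabs_le, COS_bound. }
  apply Rabs_le_between in B. destruct B as [B1 B2].
  assert (I : 0 < / INR d) by (apply Rinv_0_lt_compat; auto).
  assert (E : / INR d * INR d = 1) by (field; lra). split; nra.
Qed.

Lemma Ez_cos n th : Ez d n (fun x => cos (dotRZ d th x)) = phi d th ^ n.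
Proof.
  induction n as [|n IH]; simpl; [rewrite dot_zero, cos_0; auto|].
  rewrite <- IH, <- fin_scal; [|apply fin_Ez]. apply on_Ez. intros x Sx. unfold stepZ, phi.
  rewrite (rsum_ext d _ (fun i => 2 * cos (dotRZ d th x) * cos (th i))).
  - rewrite rsum_scal. generalize (d_pos d Hd); intros. field; lra.
  - intros i Hi. rewrite !dot_shift; auto.
    replace (dotRZ d th x + th i * 1) with (dotRZ d th x + th i) by ring.
    replace (dotRZ d th x + th i * -1) with (dotRZ d th x - th i) by ring.
    rewrite cos_plus, cos_minus. ring.
Qed.

Lemma on_Ez_box n : on (fun x => supported d x /\ forall i, (Z.abs (x i) <= Z.of_nat n)%Z) (Ez d n).
Proof.
  induction n as [|n IH]; intros F G E; cbn [Ez].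
  - apply E. split; [apply supported_zero|intros; simpl; lia].
  - apply IH. intros x [Sx Bx]. unfold stepZ. f_equal. apply rsum_ext. intros i Hi.
    assert (K : forall s, (Z.abs s <= 1)%Z -> F (shift x i s) = G (shift x i s)).
    { intros s Hs. apply E. split; [apply supported_shift; auto|]. intros j. unfold shift.
      specialize (Bx j). destruct (Nat.eqb j i); lia. }
    rewrite !K; auto; simpl; lia.
Qed.

(** [phi^k] is the characteristic function of [X_k], a trigonometric polynomial with frequencies at
    most [k < N]: the grid produces no aliasing, and the average is exactly [P(X_k = 0)]. *)
Lemma riem_phi_pow N k : (k < N)%nat -> riem d N (fun th => phi d th ^ k) = Ez d k (isx zeroZ).
Proof.
  intros Hk. rewrite (fin_ext (riem d N) _ (fun th => Ez d k (fun x => cos (dotRZ d th x)))).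
  - rewrite (fin_swap (riem d N) (Ez d k)); [|apply fin_riem|apply fin_Ez].
    apply on_Ez_box. intros x [Sx Bx]. apply riem_cos; auto; [lia|].
    intros i. specialize (Bx i). lia.
  - apply fin_riem.
  - intros th. rewrite Ez_cos; auto.
Qed.

Definition avg_cv (g : R -> R) (l : R) : Prop := Un_cv (fun N => riem d (S N) (fun th => g (phi d th))) l.

Lemma riem_le N f g : (forall t, -1 <= t <= 1 -> f t <= g t) ->
  riem d N (fun th => f (phi d th)) <= riem d N (fun th => g (phi d th)).
Proof. intros E. apply pos_le; [apply fin_riem|apply posf_riem|]. intros; apply E, phi_range. Qed.

Lemma riem_one N : (1 <= N)%nat -> riem d N (fun _ => 1) = 1.
Proof.
  intros HN. transitivity (riem d N (fun th => phi d th ^ 0)); [reflexivity|].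
  rewrite riem_phi_pow by lia. simpl. apply isx_eq.
Qed.

Lemma riem_close N f g eps : (1 <= N)%nat -> (forall t, -1 <= t <= 1 -> Rabs (f t - g t) <= eps) ->
  Rabs (riem d N (fun th => f (phi d th)) - riem d N (fun th => g (phi d th))) <= eps.
Proof.
  intros HN E.
  assert (C : forall c, riem d N (fun _ => c) = c).
  { intros c. rewrite (fin_ext (riem d N) _ (fun _ => c * 1)); [|apply fin_riem|intros; ring].
    rewrite (fin_scal (riem d N) c (fun _ => 1)), riem_one; auto; [ring|apply fin_riem]. }
  assert (U : riem d N (fun th => f (phi d th)) - riem d N (fun th => g (phi d th)) <= eps).
  { rewrite <- fin_minus, <- (C eps); [|apply fin_riem].
    apply (riem_le N (fun t => f t - g t) (fun _ => eps)). intros t Ht. specialize (E t Ht). apply Rabs_le_between in E. lra. }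
  assert (L : - eps <= riem d N (fun th => f (phi d th)) - riem d N (fun th => g (phi d th))).
  { rewrite <- fin_minus, <- (C (- eps)); [|apply fin_riem].
    apply (riem_le N (fun _ => - eps) (fun t => f t - g t)). intros t Ht. specialize (E t Ht). apply Rabs_le_between in E. lra. }
  apply Rabs_le; lra.
Qed.

Lemma avg_cv_pow k : avg_cv (fun t => t ^ k) (Ez d k (isx zeroZ)).
Proof.
  intros eps He. exists k. intros n Hn. rewrite riem_phi_pow by lia.
  unfold Rdist. rewrite Rminus_diag, Rabs_R0. auto.
Qed.

Lemma avg_cv_plus f g l m : avg_cv f l -> avg_cv g m -> avg_cv (fun t => f t + g t) (l + m).
Proof.
  intros A B. unfold avg_cv.
  apply (Un_cv_ext (fun N => riem d (S N) (fun th => f (phi d th)) + riem d (S N) (fun th => g (phi d th)))).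
  - intros n. rewrite <- fin_plus; auto. apply fin_riem.
  - apply CV_plus; auto.
Qed.

Lemma avg_cv_scal c f l : avg_cv f l -> avg_cv (fun t => c * f t) (c * l).
Proof.
  intros A. unfold avg_cv. apply (Un_cv_ext (fun N => c * riem d (S N) (fun th => f (phi d th)))).
  - intros n. rewrite <- fin_scal; auto. apply fin_riem.
  - apply CV_mult; auto. intros eps He. exists O. intros. unfold Rdist. rewrite Rminus_diag, Rabs_R0. auto.
Qed.

Lemma avg_cv_const c : avg_cv (fun _ => c) c.
Proof.
  assert (A := avg_cv_scal c _ _ (avg_cv_pow 0)). simpl in A. rewrite isx_eq, Rmult_1_r in A. exact A.
Qed.

Lemma avg_cv_rsum n (f : nat -> R -> R) (l : nat -> R) : (forall k, (k < n)%nat -> avg_cv (f k) (l k)) ->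
  avg_cv (fun t => rsum n (fun k => f k t)) (rsum n l).
Proof.
  induction n as [|n IH]; intros E; simpl; [apply avg_cv_const|]. apply avg_cv_plus; auto.
Qed.

Lemma avg_cv_le f g l m : avg_cv f l -> avg_cv g m -> (forall t, -1 <= t <= 1 -> f t <= g t) -> l <= m.
Proof.
  intros A B E. eapply Rle_cv_lim; [|exact A|exact B]. intros n. apply riem_le; auto.
Qed.

Lemma avg_cv_uniform g l :
  (forall eps, 0 < eps -> exists f m, avg_cv f m /\ Rabs (m - l) <= eps /\
     forall t, -1 <= t <= 1 -> Rabs (g t - f t) <= eps) -> avg_cv g l.
Proof.
  intros E eps He. destruct (E (eps / 4)) as (f & m & Cf & Hm & Hf); [lra|].
  destruct (Cf (eps / 4)) as [N HN]; [lra|]. exists N. intros n Hn. specialize (HN n Hn).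
  assert (K := riem_close (S n) g f (eps / 4) ltac:(lia) Hf). unfold Rdist in *.
  apply Rabs_def2 in HN. apply Rabs_le_between in K, Hm. apply Rabs_def1; lra.
Qed.

Lemma polyf_cv f : polyf f -> exists l, avg_cv f l.
Proof.
  intros P.
  (* Convergence of averages is not stable under products, so the induction shows that
     multiplication by [f] preserves [good]; products then become compositions. *)
  set (good := fun h : R -> R => forall k, exists l, avg_cv (fun t => t ^ k * h t) l).
  assert (K : forall h, good h -> good (fun t => f t * h t)).
  { induction P as [c| |f g Pf IHf Pg IHg|f g Pf IHf Pg IHg]; intros h Hh k.
    - destruct (Hh k) as [l Hl]. exists (c * l). apply avg_cv_scal with (c := c) in Hl.
      replace (fun t => t ^ k * (c * h t)) with (fun t => c * (t ^ k * h t)); auto.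
      apply functional_extensionality; intros; ring.
    - destruct (Hh (S k)) as [l Hl]. exists l.
      replace (fun t => t ^ k * (t * h t)) with (fun t => t ^ S k * h t); auto.
      apply functional_extensionality; intros; simpl; ring.
    - destruct (IHf h Hh k) as [l Hl]. destruct (IHg h Hh k) as [m Hm]. exists (l + m).
      replace (fun t => t ^ k * ((f t + g t) * h t)) with (fun t => t ^ k * (f t * h t) + t ^ k * (g t * h t)).
      apply avg_cv_plus; auto. apply functional_extensionality; intros; ring.
    - destruct (IHf _ (IHg h Hh) k) as [l Hl]. exists l.
      replace (fun t => t ^ k * (f t * g t * h t)) with (fun t => t ^ k * (f t * (g t * h t))); auto.
      apply functional_extensionality; intros; ring. }
  destruct (K (fun _ => 1)) with (k := O) as [l Hl].
  - intros k. exists (Ez d k (isx zeroZ)).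
    replace (fun t => t ^ k * 1) with (fun t => t ^ k); [apply avg_cv_pow|].
    apply functional_extensionality; intros; ring.
  - exists l. replace f with (fun t => t ^ 0 * (f t * 1)); auto.
    apply functional_extensionality; intros; simpl; ring.
Qed.

Lemma ua_cv g : ua g -> exists l, avg_cv g l.
Proof.
  intros U.
  assert (C : Cauchy_crit (fun N => riem d (S N) (fun th => g (phi d th)))).
  { intros eps He. destruct (U (eps / 5)) as (f & Pf & Hf); [lra|].
    destruct (polyf_cv f Pf) as [l Hl]. destruct (Hl (eps / 5)) as [N HN]; [lra|].
    exists N. intros n m Hn Hm.
    assert (A := riem_close (S n) g f (eps / 5) ltac:(lia) Hf).
    assert (B := riem_close (S m) g f (eps / 5) ltac:(lia) Hf).
    assert (A' := HN n Hn). assert (B' := HN m Hm). unfold Rdist in *.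
    apply Rabs_def2 in A', B'. apply Rabs_le_between in A, B. apply Rabs_def1; lra. }
  destruct (R_complete _ C) as [l Hl]. exists l. exact Hl.
Qed.

End Torus.

(** * The logarithmic integral *)

Lemma geom_rsum (u : R) n : (1 - u) * rsum n (fun k => u ^ k) = 1 - u ^ n.
Proof. induction n as [|n IH]; simpl; [ring|]. rewrite Rmult_plus_distr_l, IH. ring. Qed.

Lemma is_derive_log_taylor (n : nat) (x : R) : x < 1 ->
  is_derive (fun u => ln (1 - u) + rsum n (fun k => u ^ S k / INR (S k))) x (- (x ^ n / (1 - x))).
Proof.
  intros Hx.
  assert (D1 : is_derive (fun u => ln (1 - u)) x (- / (1 - x))).
  { auto_derive; [lra|field; lra]. }
  assert (D2 : is_derive (fun u => rsum n (fun k => u ^ S k / INR (S k))) x (rsum n (fun k => x ^ k))).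
  { induction n as [|n IH]; cbn [rsum]; [apply @is_derive_const|].
    apply @is_derive_plus; auto. auto_derive; auto.
    replace (match n with O => 1 | S _ => INR n + 1 end) with (INR (S n)) by reflexivity.
    simpl Init.Nat.pred. field. apply not_0_INR; lia. }
  evar_last; [apply @is_derive_plus; [exact D1|exact D2]|].
  unfold plus; simpl. replace (rsum n (fun k => x ^ k)) with ((1 - x ^ n) / (1 - x)).
  - field; lra.
  - rewrite <- geom_rsum. field; lra.
Qed.

(** Mean value theorem on [[0, u]]: by the geometric sum, the error has derivative
    [- x^n / (1 - x)]. *)
Lemma log_taylor (n : nat) (s u : R) : 0 <= s < 1 -> Rabs u <= s ->
  Rabs (ln (1 - u) + rsum n (fun k => u ^ S k / INR (S k))) <= s ^ n / (1 - s).
Proof.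
  intros Hs Hu. set (D := fun u => ln (1 - u) + rsum n (fun k => u ^ S k / INR (S k))).
  assert (Hu' := Hu). apply Rabs_le_between in Hu'.
  assert (R : forall x, Rmin 0 u <= x <= Rmax 0 u -> Rabs x <= s).
  { intros x Hx. apply Rabs_le. unfold Rmin, Rmax in Hx. destruct (Rle_dec 0 u); lra. }
  destruct (MVT_gen D 0 u (fun x => - (x ^ n / (1 - x)))) as (c & Hc & E).
  - intros x Hx. apply is_derive_log_taylor.
    assert (Rabs x <= s) by (apply R; lra). apply Rabs_le_between in H. lra.
  - intros x Hx. apply derivable_continuous_pt. eexists. apply is_derive_Reals, is_derive_log_taylor.
    assert (Rabs x <= s) by (apply R; lra). apply Rabs_le_between in H. lra.
  - assert (D0 : D 0 = 0).
    { unfold D. rewrite Rminus_0_r, ln_1, rsum_zero; [lra|]. intros; simpl; unfold Rdiv; ring. }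
    change (Rabs (D u) <= s ^ n / (1 - s)). rewrite D0, !Rminus_0_r in E. rewrite E.
    assert (Ac := R c Hc). assert (Ac' := Ac). apply Rabs_le_between in Ac'.
    rewrite Rabs_mult, Rabs_Ropp. unfold Rdiv. rewrite Rabs_mult, <- RPow_abs, Rabs_inv, (Rabs_pos_eq (1 - c)) by lra.
    assert (P1 : 0 <= Rabs c ^ n <= s ^ n).
    { split; [apply pow_le, Rabs_pos|]. apply pow_incr. split; [apply Rabs_pos|auto]. }
    assert (P2 : 0 <= / (1 - c) <= / (1 - s)).
    { split; [left; apply Rinv_0_lt_compat; lra|]. apply Rinv_le_contravar; lra. }
    assert (P3 : 0 <= Rabs u <= 1) by (split; [apply Rabs_pos|lra]).
    assert (0 <= Rabs c ^ n * / (1 - c) <= s ^ n * / (1 - s)).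
    { split; [apply Rmult_le_pos; lra|]. apply Rmult_le_compat; lra. }
    nra.
Qed.

Lemma geom_small (s eps : R) : 0 <= s < 1 -> 0 < eps -> exists N, forall n, (N <= n)%nat -> s ^ n / (1 - s) <= eps.
Proof.
  intros Hs He. destruct (pow_lt_1_zero s) with (y := eps * (1 - s)) as [N HN].
  - rewrite Rabs_pos_eq; lra.
  - apply Rmult_lt_0_compat; lra.
  - exists N. intros n Hn. specialize (HN n Hn). assert (0 <= s ^ n) by (apply pow_le; lra).
    rewrite Rabs_pos_eq in HN by auto. apply Rmult_le_reg_r with (1 - s); [lra|].
    unfold Rdiv. rewrite Rmult_assoc, Rinv_l; lra.
Qed.

Lemma polyf_pow k : polyf (fun t => t ^ k).
Proof. induction k as [|k IH]; simpl; [apply polyf_const|apply (polyf_mult _ _ polyf_id IH)]. Qed.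

Lemma polyf_rsum n (c : nat -> R) (e : nat -> nat) : polyf (fun t => rsum n (fun k => c k * t ^ e k)).
Proof.
  induction n as [|n IH]; simpl; [apply polyf_const|]. apply (polyf_plus _ _ IH).
  apply (polyf_mult (fun _ => c n)); [apply polyf_const|apply polyf_pow].
Qed.

Lemma log_poly_close n s t : 0 <= s < 1 -> -1 <= t <= 1 ->
  Rabs (ln (1 - s * t) - rsum n (fun k => - (s ^ S k / INR (S k)) * t ^ S k)) <= s ^ n / (1 - s).
Proof.
  intros Hs Ht. replace (ln (1 - s * t) - rsum n (fun k => - (s ^ S k / INR (S k)) * t ^ S k))
    with (ln (1 - s * t) + rsum n (fun k => (s * t) ^ S k / INR (S k))).
  - apply log_taylor; auto. rewrite Rabs_mult, (Rabs_pos_eq s) by lra.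
    assert (Rabs t <= 1) by (apply Rabs_le; lra). generalize (Rabs_pos t); nra.
  - unfold Rminus. f_equal. replace (- rsum n (fun k => - (s ^ S k / INR (S k)) * t ^ S k))
      with (-1 * rsum n (fun k => - (s ^ S k / INR (S k)) * t ^ S k)) by ring.
    rewrite <- rsum_scal. apply rsum_ext. intros. rewrite Rpow_mult_distr. unfold Rdiv. ring.
Qed.

Lemma ua_log s : 0 <= s < 1 -> ua (fun t => ln (1 - s * t)).
Proof.
  intros Hs eps He. destruct (geom_small s eps Hs He) as [N HN].
  exists (fun t => rsum N (fun k => - (s ^ S k / INR (S k)) * t ^ S k)). split; [apply (polyf_rsum N _ S)|].
  intros t Ht. eapply Rle_trans; [apply log_poly_close; auto|]. apply HN; lia.
Qed.

(** For [c = exp (- n)] and [t = phi] this is the truncated symbol [Strunc]. *)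
Definition logmax (c t : R) : R := ln (Rmax (1 - t) c).

Lemma ln_lipschitz c x y : 0 < c -> c <= x -> c <= y -> Rabs (ln x - ln y) <= Rabs (x - y) / c.
Proof.
  intros Hc. assert (K : forall x y, c <= x -> c <= y -> ln x - ln y <= Rabs (x - y) / c).
  { intros a b Ha Hb. rewrite <- ln_div by lra.
    assert (E := exp_ineq1_le (ln (a / b))). rewrite exp_ln in E by (apply Rdiv_lt_0_compat; lra).
    apply Rle_trans with (a / b - 1); [lra|]. replace (a / b - 1) with ((a - b) / b) by (field; lra).
    unfold Rdiv. apply Rle_trans with (Rabs (a - b) * / b).
    - apply Rmult_le_compat_r; [left; apply Rinv_0_lt_compat; lra|apply Rle_abs].
    - apply Rmult_le_compat_l; [apply Rabs_pos|]. apply Rinv_le_contravar; lra. }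
  intros Hx Hy. apply Rabs_le. generalize (K x y Hx Hy) (K y x Hy Hx). rewrite (Rabs_minus_sym y x). lra.
Qed.

Lemma Rmax_1lip a b c : Rabs (Rmax a c - Rmax b c) <= Rabs (a - b).
Proof.
  unfold Rmax. destruct (Rle_dec a c), (Rle_dec b c); unfold Rabs;
    destruct (Rcase_abs _), (Rcase_abs (a - b)); lra.
Qed.

(** The Taylor series of [ln (1 - t)] does not converge at [t = 1]. Replacing [t] by [(1 - e) t]
    cures this and moves the argument by at most [e]; as [ln] is [1/c]-Lipschitz above [c],
    [e <= eps c] suffices. *)
Lemma ua_logmax c : 0 < c -> ua (logmax c).
Proof.
  intros Hc. apply ua_uniform. intros eps He.
  set (e := Rmin (/ 2) (eps * c)).
  assert (E0 : 0 < e) by (apply Rmin_pos; [lra|apply Rmult_lt_0_compat; auto]).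
  assert (E1 : e <= / 2) by apply Rmin_l. assert (E2 : e <= eps * c) by apply Rmin_r.
  exists (fun t => Rmax (ln (1 - (1 - e) * t)) (ln c)). split.
  - apply ua_max; [apply ua_log; lra|apply polyf_ua, polyf_const].
  - intros t Ht. assert (P : 0 < 1 - (1 - e) * t) by nra.
    replace (Rmax (ln (1 - (1 - e) * t)) (ln c)) with (ln (Rmax (1 - (1 - e) * t) c)).
    + unfold logmax. eapply Rle_trans; [apply (ln_lipschitz c); auto; apply Rmax_r|].
      apply Rmult_le_reg_r with c; auto. unfold Rdiv. rewrite Rmult_assoc, Rinv_l, Rmult_1_r by lra.
      eapply Rle_trans; [apply Rmax_1lip|]. replace (1 - t - (1 - (1 - e) * t)) with (- (e * t)) by ring.
      rewrite Rabs_Ropp, Rabs_mult, (Rabs_pos_eq e) by lra.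
      assert (Rabs t <= 1) by (apply Rabs_le; lra). generalize (Rabs_pos t); nra.
    + unfold Rmax. destruct (Rle_dec (1 - (1 - e) * t) c) as [L|L], (Rle_dec (ln (1 - (1 - e) * t)) (ln c)) as [M|M]; auto.
      * exfalso; apply M, ln_le; auto.
      * exfalso; apply L. apply Rnot_lt_le. intros G. apply ln_increasing in G; auto; lra.
Qed.

(** * Averages of the truncated symbol and their limit *)

Section Shat.
Context (d : nat) (p : vecR) (Hd : (1 <= d)%nat) (Hp : nonzeroR d p).
Context (Htriv : forall x, Lam d p x -> x = zeroZ).

Lemma Strunc_logmax n th : Strunc d n th = logmax (exp (- n)) (phi d th).
Proof.
  unfold Strunc, Sfun, logmax, phi. set (a := 1 - _).
  destruct (Rlt_dec (exp (- n)) a) as [L|L].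
  - rewrite Rmax_left; lra.
  - rewrite Rmax_right, ln_exp; lra.
Qed.

Lemma ret_isx n : ret d p n = Ez d n (isx zeroZ).
Proof.
  rewrite ret_Ez; auto. apply on_Ez. intros x Sx. unfold isx.
  destruct (excluded_middle_informative (x = zeroZ)) as [->|N].
  - rewrite dot_zero. apply ind0_0.
  - apply ind0_ne. intros Z. apply N, Htriv. split; auto.
Qed.

(** For [s < 1] the Taylor series converges uniformly in [t] and may be averaged term by term; the
    moments of [phi] are the return probabilities, equal to those of [p.X_n] as [Lam p] is
    trivial. *)
Lemma avg_cv_log s : 0 <= s < 1 -> avg_cv d (fun t => ln (1 - s * t)) (- PSeries (retn d p) s).
Proof.
  intros Hs. apply avg_cv_uniform; auto. intros eps He.
  destruct (geom_small s eps Hs He) as [N1 HN1].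
  assert (E : ex_series (fun n => retn d p n * s ^ n)).
  { apply ex_series_pow; [apply retn_range; auto|apply ex_an; auto|lra]. }
  destruct (proj2 (is_lim_seq_spec _ _) (is_lim_seq_rsum _ E) (mkposreal eps He)) as [N2 HN2].
  set (n := Nat.max N1 N2).
  exists (fun t => rsum n (fun k => - (s ^ S k / INR (S k)) * t ^ S k)).
  exists (rsum n (fun k => - (s ^ S k / INR (S k)) * ret d p (S k))). split; [|split].
  - apply (avg_cv_rsum d Hd n (fun k t => - (s ^ S k / INR (S k)) * t ^ S k)). intros k Hk.
    apply avg_cv_scal. rewrite ret_isx. apply avg_cv_pow; auto.
  - specialize (HN2 n ltac:(lia)). cbn [pos] in HN2. left.
    rewrite Rabs_minus_sym. replace (- PSeries (retn d p) s - rsum n (fun k => - (s ^ S k / INR (S k)) * ret d p (S k)))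
      with (rsum (S n) (fun n => retn d p n * s ^ n) - Series (fun n => retn d p n * s ^ n)); [exact HN2|].
    unfold PSeries. rewrite rsum_S_l.
    replace (rsum n (fun k => - (s ^ S k / INR (S k)) * ret d p (S k)))
      with (-1 * rsum n (fun i => retn d p (S i) * s ^ S i)).
    + replace (retn d p 0) with 0 by (unfold retn; simpl; unfold Rdiv; ring). ring.
    + rewrite <- rsum_scal. apply rsum_ext. intros k _. unfold retn, Rdiv.
      change (retp d p (S k)) with (ret d p (S k)). ring.
  - intros t Ht. eapply Rle_trans; [apply log_poly_close; auto|]. apply HN1. lia.
Qed.

(** [1 - (1 - eta c) t = (1 - t) + eta c t] is at most [(1 + eta)] times the maximum, and
    [ln (1 + eta) <= eta]. *)
Lemma logmax_ge c eta t : 0 < c < 1 -> 0 < eta <= 1 -> -1 <= t <= 1 ->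
  ln (1 - (1 - eta * c) * t) - eta <= logmax c t.
Proof.
  intros Hc He Ht. unfold logmax. assert (B : 0 < eta * c < 1) by nra.
  assert (P : 0 < 1 - (1 - eta * c) * t) by nra.
  assert (M1 := Rmax_l (1 - t) c). assert (M2 := Rmax_r (1 - t) c). set (m := Rmax (1 - t) c) in *.
  assert (L : 1 - (1 - eta * c) * t <= (1 + eta) * m).
  { destruct (Rle_dec 0 t); nra. }
  apply ln_le in L; auto. rewrite ln_mult in L by lra.
  assert (ln (1 + eta) <= eta).
  { assert (E := exp_ineq1_le eta). apply ln_le in E; [|lra]. rewrite ln_exp in E. auto. }
  lra.
Qed.

(** Multiplied by [1 - c], both [1 - t] and [c] are at most [1 - (1 - c) t]. *)
Lemma logmax_le c t : 0 < c < 1 -> -1 <= t <= 1 ->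
  logmax c t <= ln (1 - (1 - c) * t) - ln (1 - c).
Proof.
  intros Hc Ht. unfold logmax. assert (P : 0 < 1 - (1 - c) * t) by nra.
  rewrite <- ln_div by lra. apply ln_le.
  - apply Rlt_le_trans with c; [lra|apply Rmax_r].
  - assert (E : (1 - (1 - c) * t) / (1 - c) * (1 - c) = 1 - (1 - c) * t) by (field; lra).
    set (q := (1 - (1 - c) * t) / (1 - c)) in *.
    apply Rmax_lub; apply Rmult_le_reg_r with (1 - c); try lra; rewrite E; nra.
Qed.

Lemma trunc_avg_bounds c l : 0 < c < 1 -> avg_cv d (logmax c) l ->
  - Aexp d p <= l <= - Aexp d p + 2 * INR d * sqrt c - ln (1 - c).
Proof.
  intros Hc Hl. split.
  - apply Rnot_lt_le. intros C.
    (* The lower bound loses only [eta], here at most half of the supposed gap. *)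
    set (eta := Rmin 1 ((- Aexp d p - l) / 2)).
    assert (E0 : 0 < eta) by (apply Rmin_pos; lra).
    assert (E1 : eta <= 1) by apply Rmin_l. assert (E2 : eta <= (- Aexp d p - l) / 2) by apply Rmin_r.
    assert (Hs : 0 <= 1 - eta * c < 1) by nra.
    assert (K : - PSeries (retn d p) (1 - eta * c) + - eta <= l).
    { apply (avg_cv_le d Hd (fun t => ln (1 - (1 - eta * c) * t) + - eta) (logmax c)); auto.
      - apply avg_cv_plus; [apply avg_cv_log; auto|apply avg_cv_const; auto].
      - intros t Ht. generalize (logmax_ge c eta t). lra. }
    assert (PSeries (retn d p) (1 - eta * c) <= Aexp d p).
    { apply PSeries_le_Series; [apply retn_range; auto|apply ex_an; auto|lra]. }
    lra.
  - assert (Hs : 0 <= 1 - c < 1) by lra.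
    assert (K : l <= - PSeries (retn d p) (1 - c) + - ln (1 - c)).
    { apply (avg_cv_le d Hd (logmax c) (fun t => ln (1 - (1 - c) * t) + - ln (1 - c))); auto.
      - apply avg_cv_plus; [apply avg_cv_log; auto|apply avg_cv_const; auto].
      - intros t Ht. generalize (logmax_le c t). lra. }
    assert (G := Aexp_gap d p Hd Hp (1 - c) Hs). replace (1 - (1 - c)) with c in G by ring. lra.
Qed.

Lemma trunc_avg_cv n : avg_cv d (logmax (exp (- n))) (trunc_avg d n).
Proof.
  assert (E : forall l, Un_cv (fun N => riem d (S N) (Strunc d n)) l -> avg_cv d (logmax (exp (- n))) l).
  { intros l. apply Un_cv_ext. intros N. apply fin_ext; [apply fin_riem|]. intros. apply Strunc_logmax. }
  apply E. unfold trunc_avg. apply epsilon_spec.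
  destruct (ua_cv d Hd (logmax (exp (- n)))) as [l Hl]; [apply ua_logmax, exp_pos|].
  exists l. revert Hl. apply Un_cv_ext. intros N. apply fin_ext; [apply fin_riem|]. intros. symmetry; apply Strunc_logmax.
Qed.

Lemma exp_opp_INR_lim : is_lim_seq (fun n => exp (- INR n)) 0.
Proof.
  apply (is_lim_seq_ext (fun n => exp (-1) ^ n)).
  - intros n. induction n as [|n IH]; [simpl; rewrite Ropp_0, exp_0; auto|].
    rewrite S_INR. simpl pow. rewrite IH, <- exp_plus. f_equal. ring.
  - apply is_lim_seq_geom. rewrite Rabs_pos_eq; [|left; apply exp_pos].
    apply Rlt_le_trans with (exp 0); [|rewrite exp_0; lra]. apply exp_increasing; lra.
Qed.

Lemma Shat0_Aexp : Shat0 d = - Aexp d p.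
Proof.
  assert (L : is_lim_seq (fun n => trunc_avg d (INR n)) (- Aexp d p)).
  { apply is_lim_seq_le_le_loc with (u := fun _ => - Aexp d p)
      (w := fun n => - Aexp d p + 2 * INR d * sqrt (exp (- INR n)) - ln (1 - exp (- INR n))).
    (* [n >= 1] ensures [exp (- n) < 1]. *)
    - exists 1%nat. intros n Hn. apply trunc_avg_bounds; [|apply trunc_avg_cv].
      split; [apply exp_pos|]. rewrite <- exp_0. apply exp_increasing.
      apply (lt_INR 0) in Hn. simpl in Hn. lra.
    - apply is_lim_seq_const.
    - replace (- Aexp d p) with (- Aexp d p + 2 * INR d * sqrt 0 - ln (1 - 0)) at 1 by (rewrite sqrt_0, Rminus_0_r, ln_1; ring).
      apply is_lim_seq_minus'.
      + apply is_lim_seq_plus'; [apply is_lim_seq_const|]. apply is_lim_seq_mult'; [apply is_lim_seq_const|].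
        apply is_lim_seq_continuous; [apply continuity_pt_sqrt; lra|apply exp_opp_INR_lim].
      + apply (is_lim_seq_continuous ln (fun n => 1 - exp (- INR n))).
        * apply derivable_continuous_pt. eexists. apply derivable_pt_lim_ln. lra.
        * apply is_lim_seq_minus'; [apply is_lim_seq_const|apply exp_opp_INR_lim]. }
  apply is_lim_seq_Reals in L.
  unfold Shat0. eapply UL_sequence; [|exact L]. apply epsilon_spec. exists (- Aexp d p). exact L.
Qed.

Lemma H_formula_trivial_Lam : rsum d (fun i => p i ^ 2) = 1 -> (H d p) ^ 2 = 2 * INR d * exp (Shat0 d).
Proof.
  intros E. rewrite H_formula, E, Rpow_mult_distr, pow2_sqrt, Shat0_Aexp, Rmult_1_r; auto.
  - simpl. rewrite Rmult_1_r, <- exp_plus. do 2 f_equal. field.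
  - generalize (d_pos d Hd); lra.
Qed.

End Shat.

(** * Rationally dependent directions are negligible *)

Lemma ball_w_nonneg s r : 0 <= r -> 0 <= ball_w s r.
Proof. intros Hr. unfold ball_w. destruct (Req_EM_T r 0); [lra|]. apply pow_le; lra. Qed.

(** Each coordinate of a pair is at most its Cantor code, so the first [M] pairs lie in the square
    of side [M]. *)
Lemma rsum_cantor_le (f : nat * nat -> R) M : (forall z, 0 <= f z) ->
  rsum M (fun n => f (Cantor.of_nat n)) <= rsum M (fun k => rsum M (fun j => f (k, j))).
Proof.
  intros P.
  rewrite (rsum_ext M _ (fun n => rsum M (fun k => rsum M (fun j => if Nat.eqb (Cantor.to_nat (k, j)) n then f (k, j) else 0)))).
  - rewrite rsum_swap. apply rsum_le. intros k Hk. rewrite rsum_swap. apply rsum_le. intros j Hj.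
    destruct (Nat.lt_ge_cases (Cantor.to_nat (k, j)) M) as [L|L].
    + rewrite (rsum_single M (Cantor.to_nat (k, j))); [rewrite Nat.eqb_refl; lra|auto|].
      intros i Hi Hne. destruct (Nat.eqb_spec (Cantor.to_nat (k, j)) i); [lia|auto].
    + rewrite rsum_zero; auto. intros i Hi. destruct (Nat.eqb_spec (Cantor.to_nat (k, j)) i); [lia|auto].
  - intros n Hn. destruct (Cantor.of_nat n) as [k j] eqn:E.
    assert (T : Cantor.to_nat (k, j) = n) by (rewrite <- E; apply Cantor.cancel_to_of).
    assert (B := Cantor.to_nat_non_decreasing k j). rewrite T in B.
    rewrite (rsum_single M k); [|lia|].
    + rewrite (rsum_single M j); [rewrite T, Nat.eqb_refl; auto|lia|].
      intros j' Hj Hne. destruct (Nat.eqb_spec (Cantor.to_nat (k, j')) n) as [Q|]; auto.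
      rewrite <- T in Q. apply Cantor.to_nat_inj in Q. congruence.
    + intros k' Hk Hne. apply rsum_zero. intros j' Hj.
      destruct (Nat.eqb_spec (Cantor.to_nat (k', j')) n) as [Q|]; auto.
      rewrite <- T in Q. apply Cantor.to_nat_inj in Q. congruence.
Qed.

Lemma rsum_half_pow n : rsum n (fun k => (/ 2) ^ S k) <= 1.
Proof.
  assert (E : rsum n (fun k => (/ 2) ^ S k) = 1 - (/ 2) ^ n).
  { induction n as [|n IH]; [simpl; lra|]. cbn [rsum]. rewrite IH. simpl. lra. }
  rewrite E. assert (0 <= (/ 2) ^ n) by (apply pow_le; lra). lra.
Qed.

Lemma Hnull_countable_union d s (A : nat -> vecR -> Prop) :
  (forall k, Hnull d s (A k)) -> Hnull d s (fun p => exists k, A k p).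
Proof.
  intros HA eps He.
  assert (C : forall k, { cr : (nat -> vecR) * (nat -> R) |
     (forall n, 0 <= snd cr n) /\ (forall x, A k x -> exists n, distR d x (fst cr n) < snd cr n) /\
     (forall M, rsum M (fun n => ball_w s (snd cr n)) <= eps * (/ 2) ^ S k) }).
  { intros k. apply constructive_indefinite_description.
    destruct (HA k (eps * (/ 2) ^ S k)) as (c & r & B1 & B2 & B3).
    - apply Rmult_lt_0_compat; auto. apply pow_lt; lra.
    - exists (c, r); auto. }
  set (cc := fun z => fst (proj1_sig (C (fst z))) (snd z) : vecR).
  set (rr := fun z => snd (proj1_sig (C (fst z))) (snd z)).
  assert (R0 : forall z, 0 <= rr z) by (intros [k j]; unfold rr; simpl; apply (proj2_sig (C k))).
  exists (fun n => cc (Cantor.of_nat n)), (fun n => rr (Cantor.of_nat n)). split; [auto|split].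
  - intros x [k Hk]. destruct (proj1 (proj2 (proj2_sig (C k))) x Hk) as [j Hj].
    exists (Cantor.to_nat (k, j)). rewrite Cantor.cancel_of_to. exact Hj.
  - intros M. eapply Rle_trans; [apply (rsum_cantor_le (fun z => ball_w s (rr z)))|].
    + intros; apply ball_w_nonneg; auto.
    + apply Rle_trans with (rsum M (fun k => eps * (/ 2) ^ S k)).
      * apply rsum_le. intros k _. apply (proj2 (proj2 (proj2_sig (C k)))).
      * rewrite rsum_scal. generalize (rsum_half_pow M); nra.
Qed.

Lemma Hnull_subset d s (A B : vecR -> Prop) : (forall p, A p -> B p) -> Hnull d s B -> Hnull d s A.
Proof.
  intros I HB eps He. destruct (HB eps He) as (c & r & B1 & B2 & B3). exists c, r. auto.
Qed.

Lemma Hnull_empty d s (A : vecR -> Prop) : (forall p, ~ A p) -> Hnull d s A.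
Proof.
  intros N eps He. exists (fun _ _ => 0), (fun _ => 0). split; [intros; lra|split].
  - intros x Ax. destruct (N x Ax).
  - intros M. rewrite rsum_zero; [lra|]. intros. unfold ball_w. destruct (Req_EM_T 0 0); lra.
Qed.

(** Any point of a cell of diameter below [rho] is the centre of a covering ball of radius [rho], so
    centres are chosen inside the cells. *)
Lemma Hnull_of_cells d s (A : vecR -> Prop) :
  (forall eps, eps > 0 -> exists (code : vecR -> nat) (B : nat) (rho : R), 0 < rho /\
    (forall p, A p -> (code p < B)%nat) /\
    (forall p q, A p -> A q -> code p = code q -> distR d p q < rho) /\
    INR B * (2 * rho) ^ s <= eps) -> Hnull d s A.
Proof.
  intros HA eps He. destruct (HA eps He) as (code & B & rho & Hr & HB & Hd & Hs).
  set (c := fun n => epsilon (inhabits (fun _ : nat => 0)) (fun p => A p /\ code p = n)).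
  (* Past [B] the radius [0] has weight [0] by the convention of [ball_w], even for [s = 0]. *)
  exists c, (fun n => if Nat.ltb n B then rho else 0). split; [|split].
  - intros n. destruct (Nat.ltb n B); lra.
  - intros x Ax. exists (code x). destruct (Nat.ltb_spec (code x) B) as [L|L]; [|specialize (HB x Ax); lia].
    destruct (epsilon_spec (inhabits (fun _ : nat => 0)) (fun p => A p /\ code p = code x)) as [A1 A2].
    + exists x; auto.
    + apply Hd; auto.
  - intros M. eapply Rle_trans; [|exact Hs].
    assert (P : 0 <= (2 * rho) ^ s) by (apply pow_le; lra).
    assert (G : rsum M (fun n => ball_w s (if Nat.ltb n B then rho else 0)) <= INR (Nat.min M B) * (2 * rho) ^ s).
    { induction M as [|M IH]; [simpl; lra|]. cbn [rsum]. unfold ball_w at 2.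
      destruct (Nat.ltb_spec M B) as [L|L].
      - destruct (Req_EM_T rho 0); [lra|]. replace (Nat.min (S M) B) with (S (Nat.min M B)) by lia.
        rewrite S_INR. lra.
      - destruct (Req_EM_T 0 0); [|lra]. replace (Nat.min (S M) B) with (Nat.min M B) by lia. lra. }
    eapply Rle_trans; [exact G|]. apply Rmult_le_compat_r; auto. apply le_INR. lia.
Qed.

(** * Small cells on a great subsphere *)

(** Position of [v] in [[-1, 1]] on a mesh [1/K]; the endpoint [1] accounts for the extra value in
    [2 K + 1]. *)
Definition digit (K : nat) (v : R) : nat := Z.to_nat (Int_part ((v + 1) * INR K)).

Lemma digit_bound K v : -1 <= v <= 1 -> (digit K v < 2 * K + 1)%nat.
Proof.
  intros Hv. unfold digit. destruct (base_Int_part ((v + 1) * INR K)) as [L _].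
  assert (N := pos_INR K).
  assert (U : IZR (Int_part ((v + 1) * INR K)) <= IZR (2 * Z.of_nat K)).
  { rewrite mult_IZR, <- INR_IZR_INZ. nra. }
  apply le_IZR in U. lia.
Qed.

Lemma digit_close K v w : (1 <= K)%nat -> -1 <= v <= 1 -> -1 <= w <= 1 -> digit K v = digit K w ->
  Rabs (v - w) <= / INR K.
Proof.
  intros HK Hv Hw E. unfold digit in E.
  assert (N : 0 < INR K) by (apply lt_0_INR; lia).
  assert (P : forall u, -1 <= u <= 1 -> (0 <= Int_part ((u + 1) * INR K))%Z).
  { intros u Hu. destruct (base_Int_part ((u + 1) * INR K)) as [_ L].
    assert (0 <= (u + 1) * INR K) by nra. assert (IZR (-1) < IZR (Int_part ((u + 1) * INR K))) by lra.
    apply lt_IZR in H0. lia. }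
  apply Z2Nat.inj in E; auto.
  destruct (base_Int_part ((v + 1) * INR K)) as [A1 A2]. destruct (base_Int_part ((w + 1) * INR K)) as [B1 B2].
  rewrite E in A1, A2. apply Rmult_le_reg_r with (INR K); auto. rewrite Rinv_l by lra.
  rewrite <- (Rabs_pos_eq (INR K)) at 1 by lra. rewrite <- Rabs_mult. apply Rabs_le. lra.
Qed.

Section Cells.
Context (i j : nat).

(** Two ratios are not recorded: the one at [j] is [1], and the one at [i] follows from the linear
    relation. *)
Definition skip (m : nat) : bool := (Nat.eqb m i || Nat.eqb m j)%bool.

Fixpoint cell_code (K : nat) (v : nat -> R) (m : nat) : nat :=
  match m with
  | O => O
  | S m => if skip m then cell_code K v m else (cell_code K v m * (2 * K + 1) + digit K (v m))%nat
  end.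

Fixpoint kept (m : nat) : nat :=
  match m with O => O | S m => if skip m then kept m else S (kept m) end.

(** The additive form avoids truncated subtraction; for distinct [i], [j] below [d] it gives
    [kept d = d - 2]. *)
Lemma kept_spec m : (kept m + (if Nat.ltb i m then 1 else 0) + (if Nat.ltb j m then 1 else 0) = m
  + (if (Nat.ltb i m && Nat.eqb i j)%bool then 1 else 0))%nat.
Proof.
  induction m as [|m IH]; [reflexivity|]. simpl kept. unfold skip. revert IH.
  destruct (Nat.eqb_spec m i), (Nat.eqb_spec m j), (Nat.eqb_spec i j), (Nat.ltb_spec i m), (Nat.ltb_spec j m),
    (Nat.ltb_spec i (S m)), (Nat.ltb_spec j (S m)); simpl; lia.
Qed.

Lemma cell_code_bound K v m : (forall k, (k < m)%nat -> -1 <= v k <= 1) ->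
  (cell_code K v m < (2 * K + 1) ^ kept m)%nat.
Proof.
  induction m as [|m IH]; intros Hv; [simpl; lia|]. cbn [cell_code kept].
  assert (IH' : (cell_code K v m < (2 * K + 1) ^ kept m)%nat) by (apply IH; auto).
  destruct (skip m); auto. cbn [Nat.pow].
  generalize (digit_bound K (v m) (Hv m (Nat.lt_succ_diag_r m))). set (B := (2 * K + 1)%nat) in *. intros. nia.
Qed.

Lemma cell_code_inj K v w m : (forall k, (k < m)%nat -> -1 <= v k <= 1) ->
  (forall k, (k < m)%nat -> -1 <= w k <= 1) -> cell_code K v m = cell_code K w m ->
  forall k, (k < m)%nat -> skip k = false -> digit K (v k) = digit K (w k).
Proof.
  induction m as [|m IH]; intros Hv Hw E k Hk Sk; [lia|]. cbn [cell_code] in E.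
  destruct (skip m) eqn:Sm.
  - destruct (Nat.eq_dec k m) as [->|]; [congruence|]. apply IH; auto; lia.
  - generalize (digit_bound K (v m) (Hv m (Nat.lt_succ_diag_r m)))
      (digit_bound K (w m) (Hw m (Nat.lt_succ_diag_r m))). intros B1 B2.
    assert (Q : cell_code K v m = cell_code K w m /\ digit K (v m) = digit K (w m)).
    { apply (Nat.div_mod_unique (2 * K + 1)); auto. rewrite !(Nat.mul_comm (2 * K + 1)). auto. }
    destruct Q as [Q1 Q2]. destruct (Nat.eq_dec k m) as [->|]; auto. apply IH; auto; lia.
Qed.

End Cells.

(* On this piece of the sphere the ratios [p_k / p_j], [k <> i, j], determine [p]. *)
Definition piece (d i j b : nat) (x : vecZ) (p : vecR) : Prop :=
  (i < d)%nat /\ (j < d)%nat /\ i <> j /\ x i <> 0%Z /\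
  rsum d (fun k => p k ^ 2) = 1 /\ dotRZ d p x = 0 /\
  (forall k, (k < d)%nat -> Rabs (p k) <= Rabs (p j)) /\
  (match b with O => 0 < p j | S _ => p j < 0 end).

Section Piece.
Context (d i j b : nat) (x : vecZ) (p : vecR) (Hp : piece d i j b x p).
Let v (k : nat) : R := p k / p j.

Lemma piece_pj : p j <> 0.
Proof. destruct Hp as (_ & _ & _ & _ & _ & _ & _ & S). destruct b; lra. Qed.

Lemma piece_ratio k : (k < d)%nat -> -1 <= v k <= 1.
Proof.
  intros Hk. assert (N := piece_pj). destruct Hp as (_ & _ & _ & _ & _ & _ & B & _).
  apply Rabs_le_between. unfold v, Rdiv. rewrite Rabs_mult, Rabs_inv.
  assert (P : 0 < Rabs (p j)) by (apply Rabs_pos_lt; auto).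
  apply Rmult_le_reg_r with (Rabs (p j)); auto. rewrite Rmult_assoc, Rinv_l by lra.
  specialize (B k Hk). lra.
Qed.

Lemma piece_vj : v j = 1.
Proof. unfold v. field. apply piece_pj. Qed.

Lemma piece_dot : rsum d (fun k => v k * IZR (x k)) = 0.
Proof.
  assert (N := piece_pj). destruct Hp as (_ & _ & _ & _ & _ & E & _).
  rewrite (rsum_ext d _ (fun k => / p j * (p k * IZR (x k)))).
  - rewrite rsum_scal. unfold dotRZ in E. rewrite E. ring.
  - intros. unfold v. field; auto.
Qed.

Lemma piece_norm : p j ^ 2 * rsum d (fun k => v k ^ 2) = 1.
Proof.
  assert (N := piece_pj). destruct Hp as (_ & _ & _ & _ & E & _).
  rewrite <- rsum_scal, <- E. apply rsum_ext. intros. unfold v. field; auto.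
Qed.

(** All ratios are at most [1] in modulus, so [1 = p_j^2 sum v_k^2 <= d p_j^2 <= d |p_j|]. *)
Lemma piece_pj_bounds : Rabs (p j) <= 1 /\ 1 <= INR d * Rabs (p j).
Proof.
  assert (N := piece_norm). destruct Hp as (_ & Hj & _ & _ & E & _).
  assert (A : Rabs (p j) <= 1).
  { apply Rabs_le. assert (p j ^ 2 <= 1).
    { rewrite <- E. apply (rsum_term_le d (fun k => p k ^ 2)); auto. intros; apply pow2_ge_0. }
    nra. }
  split; auto.
  assert (B : rsum d (fun k => v k ^ 2) <= INR d * 1).
  { rewrite <- rsum_const. apply rsum_le. intros k Hk. generalize (piece_ratio k Hk). nra. }
  assert (P := Rabs_pos (p j)). rewrite <- pow2_abs in N. set (a := Rabs (p j)) in *.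
  assert (A2 : a ^ 2 <= a) by nra. assert (D0 := pos_INR d). rewrite Rmult_1_r in B.
  rewrite <- N. apply Rle_trans with (a ^ 2 * INR d).
  - apply Rmult_le_compat_l; [apply pow2_ge_0|exact B].
  - rewrite (Rmult_comm (INR d)). apply Rmult_le_compat_r; auto.
Qed.

End Piece.

Lemma piece_cell_close d i j b x p q K :
  (1 <= K)%nat -> piece d i j b x p -> piece d i j b x q ->
  cell_code i j K (fun k => p k / p j) d = cell_code i j K (fun k => q k / q j) d ->
  distR d p q <= INR d * ((INR d ^ 2 + 1) * rsum d (fun k => Rabs (IZR (x k)))) * / INR K.
Proof.
  intros HK Pp Pq E. set (X := rsum d (fun k => Rabs (IZR (x k)))).
  assert (Rp := piece_ratio _ _ _ _ _ _ Pp). assert (Rq := piece_ratio _ _ _ _ _ _ Pq).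
  assert (Ip := piece_vj _ _ _ _ _ _ Pp). assert (Iq := piece_vj _ _ _ _ _ _ Pq).
  assert (Dp := piece_dot _ _ _ _ _ _ Pp). assert (Dq := piece_dot _ _ _ _ _ _ Pq).
  assert (Np := piece_norm _ _ _ _ _ _ Pp). assert (Nq := piece_norm _ _ _ _ _ _ Pq).
  assert (Bp := piece_pj_bounds _ _ _ _ _ _ Pp). assert (Bq := piece_pj_bounds _ _ _ _ _ _ Pq).
  assert (Zp := piece_pj _ _ _ _ _ _ Pp). assert (Zq := piece_pj _ _ _ _ _ _ Pq).
  assert (D := cell_code_inj i j K _ _ d Rp Rq E). cbv beta in *.
  destruct Pp as (Hi & Hj & Hij & Hx & _ & _ & _ & Sp). destruct Pq as (_ & _ & _ & _ & _ & _ & _ & Sq).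
  set (v := fun k => p k / p j) in *. set (w := fun k => q k / q j) in *.
  set (del := / INR K). assert (D0 : 0 < del) by (apply Rinv_0_lt_compat, lt_0_INR; lia).
  assert (Xi : 1 <= Rabs (IZR (x i))).
  { rewrite <- abs_IZR. apply IZR_le. lia. }
  assert (X1 : 1 <= X).
  { eapply Rle_trans; [exact Xi|]. apply (rsum_term_le d (fun k => Rabs (IZR (x k)))); auto. intros; apply Rabs_pos. }
  assert (C1 : forall k, (k < d)%nat -> k <> i -> Rabs (v k - w k) <= del).
  { intros k Hk Ni. destruct (Nat.eq_dec k j) as [->|Nj].
    - change (v j) with (p j / p j). change (w j) with (q j / q j).
      rewrite Ip, Iq, Rminus_diag, Rabs_R0. lra.
    - apply digit_close; auto; [apply Rp; auto|apply Rq; auto|]. apply D; auto. unfold skip.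
      destruct (Nat.eqb_spec k i), (Nat.eqb_spec k j); auto; lia. }
  (* Solve the relation with [x] for the ratio at [i]; the nonzero integer [x i] has modulus at
     least [1]. *)
  assert (C2 : Rabs (v i - w i) <= X * del).
  { set (f := fun k => if Nat.eqb k i then 0 else (v k - w k) * IZR (x k)).
    assert (S1 : (v i - w i) * IZR (x i) = - rsum d f).
    { assert (S2 : rsum d (fun k => (v k - w k) * IZR (x k)) - rsum d f = (v i - w i) * IZR (x i)).
      { rewrite <- rsum_minus, (rsum_single d i); auto.
        - unfold f. rewrite Nat.eqb_refl. ring.
        - intros k Hk Hne. unfold f. destruct (Nat.eqb_spec k i); [lia|ring]. }
      rewrite (rsum_ext d (fun k => (v k - w k) * IZR (x k)) (fun k => v k * IZR (x k) - w k * IZR (x k))) in S2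
        by (intros; ring).
      rewrite rsum_minus in S2. change (rsum d (fun k => v k * IZR (x k)) = 0) in Dp. change (rsum d (fun k => w k * IZR (x k)) = 0) in Dq.
      rewrite Dp, Dq in S2. lra. }
    assert (S3 : Rabs (v i - w i) * Rabs (IZR (x i)) <= X * del).
    { rewrite <- Rabs_mult, S1, Rabs_Ropp. eapply Rle_trans; [apply Rabs_rsum_le|].
      unfold X. rewrite Rmult_comm, <- rsum_scal. apply rsum_le. intros k Hk. unfold f.
      destruct (Nat.eqb_spec k i) as [->|Ni].
      - rewrite Rabs_R0. generalize (Rabs_pos (IZR (x i))); nra.
      - rewrite Rabs_mult. apply Rmult_le_compat_r; [apply Rabs_pos|]. auto. }
    generalize (Rabs_pos (v i - w i)); nra. }
  assert (C3 : forall k, (k < d)%nat -> Rabs (v k - w k) <= X * del).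
  { intros k Hk. destruct (Nat.eq_dec k i) as [->|Ni]; auto. specialize (C1 k Hk Ni). nra. }
  set (V := rsum d (fun k => v k ^ 2)) in *. set (W := rsum d (fun k => w k ^ 2)) in *.
  change (p j ^ 2 * V = 1) in Np. change (q j ^ 2 * W = 1) in Nq.
  assert (C4 : Rabs (W - V) <= INR d * (2 * (X * del))).
  { unfold W, V. rewrite <- rsum_minus, <- rsum_const. eapply Rle_trans; [apply Rabs_rsum_le|].
    apply rsum_le. intros k Hk. replace (w k ^ 2 - v k ^ 2) with (- (v k - w k) * (v k + w k)) by ring.
    rewrite Rabs_mult, Rabs_Ropp, (Rmult_comm 2). apply Rmult_le_compat; try apply Rabs_pos; auto.
    assert (A1 := Rp k Hk). assert (A2 := Rq k Hk). apply Rabs_le. fold (v k) in A1. fold (w k) in A2. lra. }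
  (* The norm determines [p_j^2]. Equal signs give [|p_j + q_j| = |p_j| + |q_j| >= 2/d], so the
     difference of squares controls [p_j - q_j]. *)
  assert (C5 : Rabs (p j - q j) <= INR d ^ 2 * (X * del)).
  { assert (S1 : (p j - q j) * (p j + q j) = p j ^ 2 * q j ^ 2 * (W - V)).
    { replace (p j ^ 2 * q j ^ 2 * (W - V)) with (p j ^ 2 * (q j ^ 2 * W) - q j ^ 2 * (p j ^ 2 * V)) by ring.
      rewrite Np, Nq. ring. }
    assert (S2 : Rabs (p j + q j) = Rabs (p j) + Rabs (q j)).
    { destruct b; [rewrite !Rabs_pos_eq; lra|rewrite !Rabs_left; lra]. }
    assert (S3 : Rabs (p j - q j) * (Rabs (p j) + Rabs (q j)) <= INR d * (2 * (X * del))).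
    { rewrite <- S2, <- Rabs_mult, S1, Rabs_mult. eapply Rle_trans; [|exact C4].
      assert (Rabs (p j ^ 2 * q j ^ 2) <= 1).
      { rewrite Rabs_mult, <- !RPow_abs. generalize (Rabs_pos (p j)) (Rabs_pos (q j)); intros.
        assert (0 <= Rabs (p j) ^ 2 <= 1) by nra. assert (0 <= Rabs (q j) ^ 2 <= 1) by nra. nra. }
      generalize (Rabs_pos (W - V)); nra. }
    assert (S4 : 2 <= INR d * (Rabs (p j) + Rabs (q j))) by lra.
    assert (S5 := Rabs_pos (p j - q j)). assert (S6 := pos_INR d).
    assert (S7 : Rabs (p j - q j) * 2 <= Rabs (p j - q j) * (INR d * (Rabs (p j) + Rabs (q j)))) by nra.
    assert (S8 : INR d * (Rabs (p j - q j) * (Rabs (p j) + Rabs (q j))) <= INR d * (INR d * (2 * (X * del)))) by (apply Rmult_le_compat_l; auto).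
    nra. }
  set (M := (INR d ^ 2 + 1) * X * del).
  assert (M0 : 0 <= M) by (unfold M; generalize (pow2_ge_0 (INR d)); intros; repeat apply Rmult_le_pos; lra).
  assert (C6 : forall k, (k < d)%nat -> Rabs (p k - q k) <= M).
  { intros k Hk. replace (p k - q k) with ((p j - q j) * v k + q j * (v k - w k)) by (unfold v, w; field; auto).
    eapply Rle_trans; [apply Rabs_triang|]. rewrite !Rabs_mult. specialize (C3 k Hk).
    assert (A1 : Rabs (v k) <= 1) by (apply Rabs_le, Rp; auto).
    generalize (Rabs_pos (p j - q j)) (Rabs_pos (v k)) (Rabs_pos (v k - w k)) (Rabs_pos (q j)). intros.
    assert (Rabs (p j - q j) * Rabs (v k) <= INR d ^ 2 * (X * del)) by nra.
    assert (Rabs (q j) * Rabs (v k - w k) <= X * del) by nra.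
    unfold M. lra. }
  assert (D1 : 1 <= INR d) by (apply (le_INR 1); lia).
  replace (INR d * ((INR d ^ 2 + 1) * X) * del) with (INR d * M) by (unfold M; ring).
  unfold distR. rewrite <- (sqrt_pow2 (INR d * M)) by (apply Rmult_le_pos; lra).
  apply sqrt_le_1_alt. apply Rle_trans with (INR d * M ^ 2).
  - rewrite <- rsum_const. apply rsum_le. intros k Hk. rewrite <- pow2_abs. apply pow_incr.
    split; [apply Rabs_pos|auto].
  - assert (0 <= M ^ 2) by apply pow2_ge_0. rewrite Rpow_mult_distr. apply Rmult_le_compat_r; auto. nra.
Qed.

(** At most [(3K)^(d-2)] cells of radius of order [1/K] have total weight of order [1/K] in
    dimension [d - 1]. *)
Lemma Hnull_piece d i j b x : Hnull d (d - 1) (piece d i j b x).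
Proof.
  destruct (excluded_middle_informative ((i < d)%nat /\ (j < d)%nat /\ i <> j)) as [(Hi & Hj & Hij)|N].
  2:{ apply Hnull_empty. intros p (A & B & C & _). apply N; auto. }
  apply Hnull_of_cells. intros eps He.
  (* The constant of [piece_cell_close], plus [1] to make the distance bound strict. *)
  set (C := INR d * ((INR d ^ 2 + 1) * rsum d (fun k => Rabs (IZR (x k)))) + 1).
  assert (C1 : 1 <= C).
  { unfold C. assert (0 <= rsum d (fun k => Rabs (IZR (x k)))) by (apply rsum_nonneg; intros; apply Rabs_pos).
    generalize (pos_INR d) (pow2_ge_0 (INR d)). intros.
    assert (0 <= INR d * ((INR d ^ 2 + 1) * rsum d (fun k => Rabs (IZR (x k))))) by (repeat apply Rmult_le_pos; lra). lra. }
  set (T := 3 ^ (d - 2) * (2 * C) ^ (d - 1)).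
  assert (T0 : 0 < T) by (apply Rmult_lt_0_compat; apply pow_lt; lra).
  destruct (INR_unbounded (T / eps)) as [k0 Hk0]. set (K := S k0).
  assert (K0 : 1 <= INR K) by (apply (le_INR 1); unfold K; lia).
  assert (KT : T / eps <= INR K) by (unfold K; rewrite S_INR; lra).
  exists (fun p => cell_code i j K (fun k => p k / p j) d), ((2 * K + 1) ^ (d - 2))%nat, (C * / INR K).
  assert (IK : 0 < / INR K) by (apply Rinv_0_lt_compat; lra).
  split; [apply Rmult_lt_0_compat; lra|]. split; [|split].
  - intros p Pp. replace (d - 2)%nat with (kept i j d).
    + apply cell_code_bound. apply (piece_ratio _ _ _ _ _ _ Pp).
    + generalize (kept_spec i j d). destruct (Nat.ltb_spec i d), (Nat.ltb_spec j d), (Nat.eqb_spec i j); simpl; lia.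
  - intros p q Pp Pq E. eapply Rle_lt_trans; [apply (piece_cell_close d i j b x p q K); auto; unfold K; lia|].
    apply Rmult_lt_compat_r; auto. unfold C. lra.
  - assert (B : INR ((2 * K + 1) ^ (d - 2)) <= (3 * INR K) ^ (d - 2)).
    { rewrite pow_INR. apply pow_incr. split; [apply pos_INR|].
      rewrite plus_INR, mult_INR. simpl (INR 2). simpl (INR 1). lra. }
    assert (P : 0 < (2 * (C * / INR K)) ^ (d - 1)).
    { apply pow_lt. assert (0 < C * / INR K) by (apply Rmult_lt_0_compat; lra). lra. }
    apply Rle_trans with ((3 * INR K) ^ (d - 2) * (2 * (C * / INR K)) ^ (d - 1)).
    + apply Rmult_le_compat_r; lra.
    + apply Rle_trans with (T / INR K).
      * right. unfold T. replace (d - 1)%nat with (S (d - 2)) by lia.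
        assert (NK : INR K <> 0) by lra. generalize (d - 2)%nat. intros n. revert NK. generalize (INR K). intros k Nk.
        assert (Q : k ^ n * (/ k) ^ n = 1) by (rewrite <- Rpow_mult_distr, Rinv_r, pow1; auto).
        replace (2 * (C * / k)) with (2 * C * / k) by ring. cbn [pow]. rewrite !Rpow_mult_distr.
        transitivity (3 ^ n * (2 * C * (2 ^ n * C ^ n)) * (k ^ n * (/ k) ^ n) / k); [field; auto|rewrite Q; field; auto].
      * apply Rmult_le_reg_r with (INR K); [lra|]. unfold Rdiv. rewrite Rmult_assoc, Rinv_l by lra.
        apply (Rmult_le_compat_r eps) in KT; [|lra]. unfold Rdiv in KT. rewrite Rmult_assoc, Rinv_l in KT by lra. lra.
Qed.

(** * Enumeration of lattice vectors and the exceptional set *)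

(** Each integer coordinate is coded as a difference of two naturals; only surjectivity matters for
    a countable union. *)
Fixpoint decode (d n : nat) : vecZ :=
  match d with
  | O => zeroZ
  | S m => fun k =>
      if Nat.eqb k m then
        (Z.of_nat (fst (Cantor.of_nat (fst (Cantor.of_nat n)))) - Z.of_nat (snd (Cantor.of_nat (fst (Cantor.of_nat n)))))%Z
      else decode m (snd (Cantor.of_nat n)) k
  end.

Lemma decode_surj d (x : vecZ) : exists n, forall k, (k < d)%nat -> decode d n k = x k.
Proof.
  induction d as [|d [n IH]]; [exists O; intros; lia|].
  exists (Cantor.to_nat (Cantor.to_nat (Z.to_nat (x d), Z.to_nat (- x d)), n)).
  intros k Hk. cbn [decode]. rewrite !Cantor.cancel_of_to. cbn [fst snd]. rewrite Cantor.cancel_of_to. cbn [fst snd].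
  destruct (Nat.eqb_spec k d) as [->|Hne]; [lia|]. apply IH; lia.
Qed.

Definition dependent (d : nat) (p : vecR) : Prop :=
  rsum d (fun k => p k ^ 2) = 1 /\ exists x, Lam d p x /\ x <> zeroZ.

Lemma argmax_abs (d : nat) (p : vecR) : (1 <= d)%nat ->
  exists j, (j < d)%nat /\ forall k, (k < d)%nat -> Rabs (p k) <= Rabs (p j).
Proof.
  induction d as [|d IH]; intros Hd; [lia|]. destruct d as [|d].
  - exists O. split; [lia|]. intros k Hk. replace k with O by lia. lra.
  - destruct IH as (j & Hj & B); [lia|]. destruct (Rle_dec (Rabs (p (S d))) (Rabs (p j))) as [L|L].
    + exists j. split; [lia|]. intros k Hk. destruct (Nat.eq_dec k (S d)) as [->|]; auto. apply B; lia.
    + exists (S d). split; [lia|]. intros k Hk. destruct (Nat.eq_dec k (S d)) as [->|]; [lra|].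
      specialize (B k ltac:(lia)). lra.
Qed.

Lemma dependent_piece d p : (1 <= d)%nat -> dependent d p ->
  exists i j b n, piece d i j b (decode d n) p.
Proof.
  intros Hd (Hn & x & (Sx & Dx) & Nx).
  destruct (argmax_abs d p Hd) as (j & Hj & Bj).
  assert (Pj : p j <> 0).
  { intros Z. rewrite rsum_zero in Hn; [lra|]. intros k Hk. specialize (Bj k Hk).
    rewrite Z, Rabs_R0 in Bj. generalize (Rabs_pos (p k)); intros.
    rewrite <- pow2_abs. replace (Rabs (p k)) with 0 by lra. simpl; ring. }
  destruct (decode_surj d x) as [n Hdec].
  (* Otherwise [x] has at most its [j]-th coordinate nonzero, and [p_j x_j = 0] with [p_j <> 0]
     forces [x = 0]. *)
  assert (Ex : exists i, (i < d)%nat /\ i <> j /\ x i <> 0%Z).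
  { apply NNPP. intros C. apply Nx.
    assert (Z : forall k, (k < d)%nat -> k <> j -> x k = 0%Z).
    { intros k Hk Nk. destruct (Z.eq_dec (x k) 0); auto. exfalso; apply C; eauto. }
    apply functional_extensionality; intros k. destruct (Nat.lt_ge_cases k d) as [L|L]; [|apply Sx; auto].
    destruct (Nat.eq_dec k j) as [->|]; [|apply Z; auto].
    unfold dotRZ in Dx. rewrite (rsum_single d j) in Dx; auto.
    - apply Rmult_integral in Dx. destruct Dx as [|E]; [contradiction|]. apply eq_IZR in E. exact E.
    - intros m Hm Nm. rewrite Z; auto. ring. }
  destruct Ex as (i & Hi & Nij & Nxi).
  exists i, j, (if Rlt_dec 0 (p j) then 0%nat else 1%nat), n.
  repeat split; auto.
  - rewrite Hdec; auto.
  - rewrite <- Dx. unfold dotRZ. apply rsum_ext. intros k Hk. rewrite Hdec; auto.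
  - destruct (Rlt_dec 0 (p j)); lra.
Qed.

Lemma Hnull_dependent d : (1 <= d)%nat -> Hnull d (d - 1) (dependent d).
Proof.
  intros Hd. apply (Hnull_subset _ _ _ (fun p => exists i j b n, piece d i j b (decode d n) p)).
  - intros p. apply dependent_piece; auto.
  - do 4 (apply Hnull_countable_union; intros ?). apply Hnull_piece.
Qed.

Lemma independent_Lam d p : rsum d (fun i => p i ^ 2) = 1 -> ~ dependent d p ->
  nonzeroR d p /\ forall x, Lam d p x -> x = zeroZ.
Proof.
  intros E N. split.
  - apply NNPP. intros C. rewrite rsum_zero in E; [lra|]. intros i Hi.
    destruct (Req_dec (p i) 0) as [->|Hne]; [ring|]. exfalso; apply C. exists i; auto.
  - intros x Lx. apply NNPP. intros C. apply N. split; auto. exists x; auto.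
Qed.

Theorem mainTheorem2 (d : nat) (Hd : (1 <= d)%nat) :
  (forall p : vecR, nonzeroR d p ->
     (forall eps, eps > 0 -> exists delta, delta > 0 /\
        forall q : vecR, distR d q p < delta -> Lam_sub d p q ->
          Rabs (H d q - H d p) < eps) /\
     (exists c delta, c > H d p /\ delta > 0 /\
        forall q : vecR, distR d q p < delta -> ~ Lam_sub d p q ->
          c <= H d q)) /\
  (exists N : vecR -> Prop, Hnull d (d - 1) N /\
     forall p : vecR, rsum d (fun i => p i ^ 2) = 1 -> ~ N p ->
       (H d p) ^ 2 = 2 * INR d * exp (Shat0 d)).
Proof.
  split.
  - intros p Hp. split.
    + intros eps He. exact (H_continuous_along_Lam d p Hd Hp eps He).
    + destruct (H_jump_across_Lam d p Hd Hp) as (c & Hc & delta & Hdel & Hq).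
      exists c, delta. auto.
  - exists (dependent d). split; [apply Hnull_dependent; auto|].
    intros p E N. destruct (independent_Lam d p E N) as [Hp HL].
    apply (H_formula_trivial_Lam d p Hd Hp HL E).
Qed.
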